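(* For every positive integer $n$, \[ \sum_{w \in \mathrm{FC}(B_n)\setminus \mathrm{FC}(S_n)} q^{\mathrm{bl}(w^{-1})}\, F^B_{\mathrm{Des}_B(w)} =\sum_{k=1}^{n}\Big(\sum_{j=0}^{n} b_{n,k,j}\, q^j\Big)\, s_{(k)}(x_1,x_2,\ldots)\, s_{(n-k)}(x_0,x_1,\ldots), \] where $b_{n,k,j}:=\#\{T\in \mathrm{SYT}((n,k)/(k)) \mid \mathrm{ldes}(T)=n-j\}$. In particular the coefficients $b_{n,k,j}$ are non-negative integers.
   Context: $B_n$ is the group of signed permutations: bijections $w$ of $\{\pm1,\ldots,\pm n\}$ with $w(-i)=-w(i)$, written $w=[w_1,\ldots,w_n]$ with $w_i=w(i)$; products are composition of functions, $(uv)(i)=u(v(i))$. $S_n\subseteq B_n$ is the subgroup of permutations of $[n]$. As a Coxeter group, $B_n$ is generated by $s_0=[-1,2,\ldots,n]$ and $s_i=[1,\ldots,i-1,i+1,i,i+2,\ldots,n]$ for $1\le i\le n-1$ (with $s_0s_1$ of order 4, $s_is_{i+1}$ of order 3 for $i\ge1$, and all other pairs commuting). An element is fully commutative (FC) if any reduced expression (minimal-length word in the generators) can be obtained from any other using only relations $st=ts$ for commuting generators. $\mathrm{FC}(B_n)$ denotes the FC elements of $B_n$, and $\mathrm{FC}(S_n)=\mathrm{FC}(B_n)\cap S_n$ (the $321$-avoiding permutations). For $w\in B_n$, set $w_0:=0$ and $\mathrm{Des}_B(w):=\{0\le i\le n-1\mid w_i>w_{i+1}\}$; $\mathrm{bl}(w):=1+\#\{1\le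 i\le n-1\mid \max(w_1,\ldots,w_i)<\min(w_{i+1},\ldots,w_n)\}$. Chow's fundamental quasi-symmetric function for $J\subseteq\{0,1,\ldots,n-1\}$ is $F^B_J:=\sum x_{i_1}\cdots x_{i_n}$ over $0\le i_1\le\cdots\le i_n$ with $i_j<i_{j+1}$ whenever $j\in J$ (where $i_0:=0$, so $0\in J$ forces $i_1\ge1$). $s_{(m)}(x_a,x_{a+1},\ldots)$ is the Schur function of a one-row shape (complete homogeneous symmetric function of degree $m$) in the indicated variables. $\mathrm{SYT}((n,k)/(k))$ is the set of standard Young tableaux of the skew shape whose first row consists of the cells in columns $k+1,\ldots,n$ and whose second row consists of the cells in columns $1,\ldots,k$ (entries $1,\ldots,n$, increasing along rows and down columns). For a standard (skew) tableau $T$ with $n$ cells, $\mathrm{Des}(T)=\{1\le i<n\mid i+1 \text{ is in a lower row than } i\}$ and $\mathrm{ldes}(T)=\max \mathrm{Des}(T)$, or $0$ if $\mathrm{Des}(T)=\emptyset$. *)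

(* Defs.v *)
From HB Require Import structures.
From mathcomp Require Import all_boot all_order all_algebra all_fingroup.
From mathcomp Require Import mpoly.
From Stdlib Require Import Relations ClassicalEpsilon.

Set Implicit Arguments.
Unset Strict Implicit.
Unset Printing Implicit Defensive.

Import GRing.Theory Num.Theory.
Local Open Scope ring_scope.

(* A signed permutation w is encoded as a pair (s, e) with s : 'S_n   *)
(* and e : {ffun 'I_n -> bool}, meaning (1-indexed)                   *)
(*     w(i+1) = (-1)^(e i) * (s i + 1)     for i : 'I_n,              *)
(* and w(-j) = - w(j).  This is a bijection onto B_n.                 *)
Definition Bn (n : nat) := ('S_n * {ffun 'I_n -> bool})%type.

Definition sval n (w : Bn n) (i : 'I_n) : int :=
  if w.2 i then - ((w.1 i).+1)%:Z else ((w.1 i).+1)%:Z.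

Definition wseq n (w : Bn n) : seq int := [seq sval w i | i <- enum 'I_n].

Definition wv n (w : Bn n) (i : nat) : int := nth 0 (0 :: wseq w) i.

(* product (uv)(i) = u(v(i)) : with v(i+1) = ±(s_v i + 1) we get
   (uv)(i+1) = ±±(s_u (s_v i) + 1).  Note mathcomp's (p * q) x = q (p x). *)
Definition Bmul n (u v : Bn n) : Bn n :=
  ((v.1 * u.1)%g, [ffun i => v.2 i (+) u.2 (v.1 i)]).

Definition Bone n : Bn n := (1%g, [ffun _ => false]).

(* inverse: w^{-1}(s i + 1) = ±(i+1) with the same sign as w(i+1) *)
Definition Binv n (w : Bn n) : Bn n :=
  ((w.1^-1)%g, [ffun j => w.2 ((w.1^-1)%g j)]).

Definition inSn n (w : Bn n) : bool := [forall i, ~~ w.2 i].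

(* s_0 = [-1,2,...,n];  s_k (k>=1) swaps the values at positions k and *)
(* k+1 (1-indexed), i.e. 0-indexed positions k-1 and k.               *)
Definition ord_prev n (k : 'I_n) : 'I_n :=
  Ordinal (leq_ltn_trans (leq_pred k) (ltn_ord k)).

Definition Bgen n (k : 'I_n) : Bn n :=
  if val k == 0%N then (1%g, [ffun i : 'I_n => val i == 0%N])
  else (tperm (ord_prev k) k, [ffun _ => false]).

Definition Beval n (ws : seq 'I_n) : Bn n :=
  foldr (fun k acc => Bmul (Bgen k) acc) (Bone n) ws.

Definition reduced_word n (w : Bn n) (ws : seq 'I_n) : Prop :=
  Beval ws = w /\ (forall ws' : seq 'I_n, Beval ws' = w -> (size ws <= size ws')%N).

Definition gens_commute n (a b : 'I_n) : bool := (1 < `|(val a)%:Z - (val b)%:Z|)%N.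

Definition comm_move n (ws1 ws2 : seq 'I_n) : Prop :=
  exists (p t : seq 'I_n) (a b : 'I_n),
    gens_commute a b /\ ws1 = p ++ [:: a; b] ++ t /\ ws2 = p ++ [:: b; a] ++ t.

Definition FC n (w : Bn n) : Prop :=
  forall ws1 ws2, reduced_word w ws1 -> reduced_word w ws2 ->
    clos_refl_trans (seq 'I_n) (@comm_move n) ws1 ws2.

Definition FCb n (w : Bn n) : bool :=
  if excluded_middle_informative (FC w) then true else false.

Definition DesB n (w : Bn n) : pred nat :=
  fun i => (i < n)%N && (wv w i.+1 < wv w i).

Definition bl n (w : Bn n) : nat :=
  (1 + count (fun i => all (fun a => all (fun b => (a < b)%R) (drop i (wseq w)))
                          (take i (wseq w)))
             (iota 1 n.-1))%N.

(* Quasi-symmetric functions, truncated to the variables x_0..x_{N-1} *)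
(* (x_i is 'X_i in {mpoly R[N]}).                                     *)
Definition monom_of (R : comNzRingType) N m (c : {ffun 'I_m -> 'I_N}) : {mpoly R[N]} :=
  \prod_(j < m) 'X_(c j).

(* Chow's condition for the index sequence i_1..i_n (= c 0 .. c (n-1)),
   with i_0 := 0:  i_j <= i_{j+1}, strictly if j \in J  (0 <= j <= n-1) *)
Definition chow_ok N n (J : pred nat) (c : {ffun 'I_n -> 'I_N}) : bool :=
  [forall j : 'I_n,
     let prev := (if val j is j'.+1 then nth 0%N [seq val (c i) | i <- enum 'I_n] j' else 0%N) in
     if J (val j) then (prev < c j)%N else (prev <= c j)%N].

Definition FB (R : comNzRingType) N n (J : pred nat) : {mpoly R[N]} :=
  \sum_(c : {ffun 'I_n -> 'I_N} | chow_ok J c) monom_of R c.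

(* s_(m)(x_a, x_{a+1}, ...) = h_m(x_a, x_{a+1}, ...), truncated *)
Definition hrow (R : comNzRingType) N (a m : nat) : {mpoly R[N]} :=
  \sum_(c : {ffun 'I_m -> 'I_N} |
        sorted leq [seq val (c i) | i <- enum 'I_m] && [forall i, (a <= c i)%N])
     monom_of R c.

(* A filling T assigns to each entry e+1 (e : 'I_n) a cell (row, col),*)
(* rows numbered 1 (top), 2; columns 1..n.                            *)
Definition skew_cell (n k : nat) (rc : 'I_3 * 'I_n.+1) : bool :=
  ((val rc.1 == 1%N) && (k < val rc.2 <= n)%N) ||
  ((val rc.1 == 2%N) && (1 <= val rc.2 <= k)%N).

Definition isSYT n k (T : {ffun 'I_n -> 'I_3 * 'I_n.+1}) : bool :=
  [&& injectiveb T,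
      [forall e, @skew_cell n k (T e)],
      [forall rc, @skew_cell n k rc ==> [exists e, T e == rc]],
      [forall e1, forall e2, ((T e1).1 == (T e2).1) && (val (T e1).2 < val (T e2).2)%N
                              ==> (val e1 < val e2)%N] &
      [forall e1, forall e2, ((T e1).2 == (T e2).2) && (val (T e1).1 < val (T e2).1)%N
                              ==> (val e1 < val e2)%N]].

(* row of entry m+1 *)
Definition rowOf n (T : {ffun 'I_n -> 'I_3 * 'I_n.+1}) (m : nat) : nat :=
  nth 0%N [seq val (T e).1 | e <- enum 'I_n] m.

Definition DesT n (T : {ffun 'I_n -> 'I_3 * 'I_n.+1}) (i : nat) : bool :=
  [&& (1 <= i)%N, (i < n)%N & (rowOf T i.-1 < rowOf T i)%N].

Definition ldes n (T : {ffun 'I_n -> 'I_3 * 'I_n.+1}) : nat :=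
  \max_(i < n | DesT T i) i.

Definition bcoef (n k j : nat) : nat :=
  #|[pred T : {ffun 'I_n -> 'I_3 * 'I_n.+1} | isSYT k T && (ldes T == n - j)%N]|.

Arguments FB R N n J : clear implicits.
Arguments hrow R N a m : clear implicits.

(* Main.v *)
(* A signed word is fully commutative exactly when every inversion (x, y), x > y
   with x to the left of y, has no letter below y to the right of y and satisfies
   x + z >= 0 for all letters z other than y: a word violating this has a reduced
   expression containing a braid, and conversely two descents of such a word
   always commute.  Fix a descent set D.  In such a word the letter of largest
   absolute value is last, or on top of the last descent, or the word is one of
   few exceptions; removing it (and treating apart the words ending in n - 1)
   gives linear recursions for the generating function e(D) of the statistic.

   On the other side, merging a weakly increasing sequence over x_1, x_2, ...
   with one over x_0, x_1, ... expands a product h_k h_(n-k) as the sum of the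
   fundamental functions of the ascent sets of the binary words with k ones.  The
   polynomials b_(n,k) = sum_j b_(n,k,j) q^j satisfy Pascal's rule with the extra
   term q^(n+1) - q^n, and this makes sum_B b_(n,|B|), over the binary words B
   with ascent set D, satisfy the recursions of e(D), up to the term k = 0. *)

Require Import Defs.
From Stdlib Require Import Relations ClassicalEpsilon.
From HB Require Import structures.
From mathcomp Require Import all_boot all_order all_algebra all_fingroup.
From mathcomp Require Import mpoly.
From mathcomp Require Import zify ring.
Set Implicit Arguments.
Unset Strict Implicit.
Unset Printing Implicit Defensive.
Import Order.TTheory GRing.Theory Num.Theory.
Local Open Scope ring_scope.

(** * Signed words *)

(** The last letter controls the blocks. Within the words considered, removing a letter of absolute
    value n + 1 that is not last lowers the number of blocks by one if the last letter is negative
    and leaves it unchanged otherwise, provided that the shorter word does not end in n. So the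
    generating function is split according to the last letter, and the negative part is solved
    first, being the source term of the rest. A removal at the top of the last descent forgets
    whether the step there was a descent, so a recursion for P01 0^j sums over both P0 0^j and P1
    0^j. On the other side these two sets also arise together: after a prefix over P they allow
    exactly the continuations 1^i 0^(j+1-i). The extra term q^(n+1) - q^n has a single cause, the
    word 1^k 0^(n-k) without ascents, whose exponent n is not compensated by a last ascent when n
    grows. *)

Definition signed (n : nat) (s : seq int) :=
  perm_eq [seq absz x | x <- s] (iota 1 n).

Definition before (s : seq int) (x y : int) := (index x s < index y s)%N.

(** The case [z = x] of the last clause says that the left letter of an inversion is never
    negative. *)
Definition good (s : seq int) : bool :=
  all (fun x => all (fun y => before s x y && (y < x) ==>
    all (fun z => (before s y z ==> (y < z)) && ((z != y) ==> (0 <= x + z))) s) s) s.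

Lemma goodP s :
  reflect (forall x y z, x \in s -> y \in s -> z \in s -> before s x y -> y < x ->
             (before s y z -> y < z) /\ (z != y -> 0 <= x + z)) (good s).
Proof.
apply: (iffP idP) => [H x y z xs ys zs bxy yx|H].
  have /allP/(_ _ xs)/allP/(_ _ ys) := H.
  rewrite bxy yx /= => /allP/(_ _ zs)/andP[/implyP h1 /implyP h2]; split=> // .
apply/allP => x xs; apply/allP => y ys; apply/implyP => /andP[b yx].
by apply/allP => z zs; have [h1 h2] := H x y z xs ys zs b yx; apply/andP; split; apply/implyP.
Qed.

(* Compares the values at [x] and [y] of the inverse of the signed permutation
   with word [s]: the inverse sends [|x|] to plus or minus the position of [x]. *)
Definition inv_lt (s : seq int) (x y : int) : bool :=
  if 0 < y then (x < 0) || before s x y else (x < 0) && before s y x.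

(** A block boundary of the inverse after position [i], expressed by the letters of [s] so that
    insertions into [s] can be followed directly. *)
Definition cut (s : seq int) (i : nat) : bool :=
  all (fun x => all (fun y => (absz x <= i < absz y)%N ==> inv_lt s x y) s) s.

Lemma cutP s i :
  reflect (forall x y, x \in s -> y \in s -> (absz x <= i < absz y)%N -> inv_lt s x y)
          (cut s i).
Proof.
apply: (iffP allP) => [H x y xs ys b|H x xs].
  by have /allP/(_ _ ys)/implyP/(_ b) := H _ xs.
by apply/allP => y ys; apply/implyP; apply: H.
Qed.

Definition inv_blocks (s : seq int) : nat := (1 + count (cut s) (iota 1 (size s).-1))%N.

(** The initial 0 is the convention w_0 = 0: the first bit records a negative first letter. *)
Definition des (s : seq int) : seq bool := pairmap (fun x y => y < x) 0 s.

Definition has_neg (s : seq int) := has (fun x => x < 0) s.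

Definition topword n (s : seq int) := [&& signed n s, good s & has_neg s].

Lemma signed_size n s : signed n s -> size s = n.
Proof. by move/perm_size; rewrite size_map size_iota. Qed.

Lemma signed_uniqabs n s : signed n s -> uniq [seq absz x | x <- s].
Proof. by move/perm_uniq->; apply: iota_uniq. Qed.

Lemma signed_uniq n s : signed n s -> uniq s.
Proof. by move/signed_uniqabs/map_uniq. Qed.

Lemma signed_mem n s x : signed n s -> x \in s -> (0 < absz x <= n)%N.
Proof.
move=> /perm_mem H xs; have := H (absz x); rewrite map_f // mem_iota => /esym.
by rewrite add1n ltnS.
Qed.

Lemma signed_inj n s x y : signed n s -> x \in s -> y \in s -> absz x = absz y -> x = y.
Proof.
move=> sg xs ys e; have u := signed_uniqabs sg.
have := xs; have := ys; rewrite -!index_mem => ly lx.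
have E := nth_uniq 0%N _ _ u; have := E (index x s) (index y s).
rewrite !size_map => /(_ lx ly); rewrite !(nth_map 0) // !nth_index // e eqxx.
by move=> /esym/eqP h; rewrite -(nth_index 0 xs) h nth_index.
Qed.

Lemma signed_ex n s v : signed n s -> (0 < v <= n)%N -> v%:Z \in s \/ - v%:Z \in s.
Proof.
move=> /perm_mem H /andP[v0 vn]; have := H v; rewrite mem_iota add1n ltnS v0 vn /=.
case/mapP=> x xs ->; have [h|h] : `|x|%N%:Z = x \/ - `|x|%N%:Z = x by lia.
  by left; rewrite h.
by right; rewrite h.
Qed.

Lemma before_neq s x y : before s x y -> x != y.
Proof. by apply: contraTneq => ->; rewrite /before ltnn. Qed.

Lemma before_total s x y : x \in s -> y \in s -> x != y -> before s x y || before s y x.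
Proof.
move=> xs ys; apply: contraNT; rewrite negb_or /before -!leqNgt => /andP[h1 h2].
have e : index x s = index y s by lia.
by rewrite -(nth_index 0 xs) e nth_index.
Qed.

Lemma before_asym s x y : before s x y -> before s y x = false.
Proof. by rewrite /before => h; apply/negbTE; rewrite -leqNgt ltnW. Qed.

(** * Insertion of a letter into a word *)

Definition insert (p : nat) (v : int) (t : seq int) := take p t ++ v :: drop p t.

Section Insert.
Variables (p : nat) (v : int) (t : seq int).
Hypotheses (pt : (p <= size t)%N) (vt : v \notin t).

Lemma perm_insert : perm_eq (insert p v t) (v :: t).
Proof. by rewrite /insert perm_catC /= perm_cons perm_catC cat_take_drop. Qed.

Lemma mem_insert x : (x \in insert p v t) = (x == v) || (x \in t).
Proof. by rewrite (perm_mem perm_insert) inE. Qed.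

Lemma size_insert : size (insert p v t) = (size t).+1.
Proof. by rewrite (perm_size perm_insert). Qed.

Lemma index_insert x : x \in t ->
  index x (insert p v t) = if (index x t < p)%N then index x t else (index x t).+1.
Proof.
move=> xt; rewrite /insert index_cat.
have xv : (v == x) = false by apply/negbTE; apply: contra vt => /eqP->.
rewrite /= xv; have sz : size (take p t) = p by rewrite size_takel.
have -> : index x t = index x (take p t ++ drop p t) by rewrite cat_take_drop.
rewrite index_cat sz; case: ifP => xtk; last first.
  by rewrite addnS ltnNge leq_addr.
by rewrite -index_mem sz in xtk; rewrite xtk.
Qed.

Lemma index_insert_new : index v (insert p v t) = p.
Proof.
rewrite /insert index_cat /= eqxx addn0 size_takel //.
by case: ifP => // /mem_take h; case/negP: vt.
Qed.

Lemma before_insert x y : x \in t -> y \in t -> before (insert p v t) x y = before t x y.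
Proof. by move=> xt yt; rewrite /before !index_insert //; case: (ltnP (index x t) p); case: (ltnP (index y t) p); lia. Qed.

Lemma before_insertl y : y \in t -> before (insert p v t) v y = (p <= index y t)%N.
Proof. by move=> yt; rewrite /before index_insert_new index_insert //; case: (ltnP (index y t) p); lia. Qed.

Lemma before_insertr x : x \in t -> before (insert p v t) x v = (index x t < p)%N.
Proof. by move=> xt; rewrite /before index_insert_new index_insert //; case: (ltnP (index x t) p); lia. Qed.

Lemma good_sub_insert : good (insert p v t) -> good t.
Proof.
move=> /goodP H; apply/goodP => x y z xs ys zs b yx.
have := H x y z; rewrite !mem_insert xs ys zs !orbT !before_insert //.
by apply.
Qed.

Lemma inv_lt_insert x y : x \in t -> y \in t -> inv_lt (insert p v t) x y = inv_lt t x y.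
Proof. by move=> xt yt; rewrite /inv_lt !before_insert. Qed.

(** A letter of absolute value above [i] can only stand on the upper side of the cut, so it adds one
    family of comparisons. *)
Lemma cut_insert i : (i < absz v)%N ->
  cut (insert p v t) i =
    cut t i && all (fun x => (absz x <= i)%N ==> inv_lt (insert p v t) x v) t.
Proof.
move=> iv; apply/cutP/andP => [H|[/cutP H1 /allP H2] x y].
  split.
    apply/cutP => x y xt yt b; rewrite -inv_lt_insert //; apply: H => //; rewrite mem_insert.
      by rewrite xt orbT.
    by rewrite yt orbT.
  apply/allP => x xt; apply/implyP => xi; apply: H; rewrite ?mem_insert ?xt ?eqxx ?orbT //.
  by rewrite xi iv.
rewrite !mem_insert => /orP[/eqP->|xt]; first by lia.
case/orP=> [/eqP->|yt] b; first by have /implyP := H2 _ xt; apply; case/andP: b.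
by rewrite inv_lt_insert //; apply: H1.
Qed.

Lemma signed_insert n : absz v = n.+1 -> signed n.+1 (insert p v t) = signed n t.
Proof.
move=> av; rewrite /signed.
have -> : iota 1 n.+1 = iota 1 n ++ [:: n.+1] by have := iotaD 1 n 1; rewrite addn1 add1n.
rewrite (permPl (perm_map _ perm_insert)) /= av perm_sym perm_catC /= perm_cons.
by rewrite perm_sym.
Qed.

Lemma has_neg_insert : 0 < v -> has_neg (insert p v t) = has_neg t.
Proof. by move=> v0; rewrite /has_neg (perm_has _ perm_insert) /= ltNge ltW. Qed.

End Insert.

Lemma insert_rcons t v : rcons t v = insert (size t) v t.
Proof. by rewrite /insert take_size drop_size cats1. Qed.

Lemma insert_rem (s : seq int) v : v \in s -> uniq s ->
  s = insert (index v s) v (rem v s) /\ v \notin rem v s.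
Proof.
move=> vs us; split; last by rewrite mem_rem_uniq // inE eqxx.
rewrite {1}/insert; elim: s vs us => //= x s IH; rewrite inE => /orP[/eqP->|vs] /andP[xs us].
  by rewrite eqxx /= take0 drop0.
have nxv : x != v by apply: contraNneq xs => ->.
by rewrite (negbTE nxv) /= -IH.
Qed.

Lemma size_rem_index (s : seq int) v : v \in s -> (index v s <= size (rem v s))%N.
Proof. by move=> vs; rewrite size_rem //; move: vs; rewrite -index_mem; case: (size s). Qed.

Lemma rem_insert p v (t : seq int) : v \notin t -> rem v (insert p v t) = t.
Proof.
rewrite /insert; elim: t p => [|x t IH] [|p] //=; rewrite ?eqxx //.
by rewrite inE negb_or eq_sym => /andP[/negbTE-> /IH->].
Qed.

(** * Signed permutations as signed words *)

Lemma size_wseq n (w : Bn n) : size (wseq w) = n.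
Proof. by rewrite size_map size_enum_ord. Qed.

Lemma nth_wseq n (w : Bn n) (i : 'I_n) : nth 0 (wseq w) i = Defs.sval w i.
Proof. by rewrite (nth_map i) ?size_enum_ord // nth_ord_enum. Qed.

Lemma absz_sval n (w : Bn n) i : absz (Defs.sval w i) = (w.1 i).+1.
Proof. by rewrite /Defs.sval; case: ifP => _; rewrite ?abszN. Qed.

Lemma signed_wseq n (w : Bn n) : signed n (wseq w).
Proof.
rewrite /signed -map_comp.
rewrite (eq_map (g := fun i => (1 + val (w.1 i))%N)); last first.
  by move=> i /=; rewrite absz_sval add1n.
rewrite (map_comp (fun i : 'I_n => (1 + val i)%N)) (map_comp (addn 1) val).
rewrite -[X in iota X _](addn0 1) iotaDl -val_enum_ord.
apply/perm_map/perm_map/uniq_perm.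
- by rewrite map_inj_uniq ?enum_uniq //; apply: perm_inj.
- exact: enum_uniq.
move=> i; rewrite mem_enum; apply/mapP; exists ((w.1^-1)%g i); rewrite ?mem_enum //.
by rewrite permKV.
Qed.

Lemma sval_inj n (u v : Bn n) : (forall i, Defs.sval u i = Defs.sval v i) -> u = v.
Proof.
move=> E; have e1 : u.1 = v.1.
  by apply/permP => i; apply: val_inj; have := absz_sval u i; rewrite E absz_sval => -[].
suff e2 : u.2 = v.2 by move: e1 e2; case: (u) => ? ?; case: (v) => ? ? /= -> ->.
apply/ffunP => i; have := E i; rewrite /Defs.sval e1.
by case: (u.2 i); case: (v.2 i) => //; lia.
Qed.

Lemma wseq_inj n : injective (@wseq n).
Proof. by move=> u v e; apply: sval_inj => i; rewrite -!nth_wseq e. Qed.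

Lemma wseq_surj n s : signed n s -> exists w : Bn n, wseq w = s.
Proof.
move=> sg; have sz := signed_size sg.
have lt (i : 'I_n) : ((absz (nth 0%R s i)).-1 < n)%N.
  have /(signed_mem sg) : nth 0%R s i \in s by rewrite mem_nth ?sz.
  by case: (absz (nth 0%R s i)).
pose f i := Ordinal (lt i).
have f_inj : injective f.
  move=> i j /(congr1 val) /= e.
  have mi : nth 0 s i \in s by rewrite mem_nth ?sz.
  have mj : nth 0 s j \in s by rewrite mem_nth ?sz.
  have /andP[h1 _] := signed_mem sg mi; have /andP[h2 _] := signed_mem sg mj.
  have ea : absz (nth 0 s i) = absz (nth 0 s j) by rewrite -(prednK h1) e prednK.
  have /eqP := signed_inj sg mi mj ea.
  by rewrite nth_uniq ?sz ?(signed_uniq sg) // => /eqP/val_inj.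
exists (perm f_inj, [ffun i : 'I_n => nth 0 s i < 0]).
apply: (@eq_from_nth _ 0); rewrite size_wseq ?sz // => i ilt.
rewrite (nth_wseq _ (Ordinal ilt)) /Defs.sval ffunE permE /=.
have /(signed_mem sg) : nth 0%R s i \in s by rewrite mem_nth ?sz.
case/andP=> h _; rewrite prednK //; move: (nth 0 s i) h => x h; case: ltP => x0; lia.
Qed.

(** * Generating functions of the number of blocks *)

Definition tops n : seq (seq int) :=
  [seq wseq w | w <- enum {: Bn n} & topword n (wseq w)].

Lemma mem_tops n s : (s \in tops n) = topword n s.
Proof.
apply/mapP/idP => [[w]|t]; first by rewrite mem_filter => /andP[h _] ->.
have [w e] : exists w : Bn n, wseq w = s by apply: wseq_surj; case/and3P: t.
by exists w; rewrite // mem_filter e t mem_enum.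
Qed.

Lemma uniq_tops n : uniq (tops n).
Proof. rewrite map_inj_uniq; [exact/filter_uniq/enum_uniq | exact: wseq_inj]. Qed.

Definition wsum n (c : pred (seq int)) : {poly int} :=
  \sum_(s <- tops n | c s) 'X^(inv_blocks s).

(** Every recursion below is an instance: the hypotheses make [h] and [h'] mutually inverse, and [h]
    removes exactly [k] blocks. *)
Lemma wsum_bij n m (c d : pred (seq int)) (h h' : seq int -> seq int) k :
  (forall s, topword n s -> c s ->
     [/\ topword m (h s), d (h s), h' (h s) = s & inv_blocks s = (inv_blocks (h s) + k)%N]) ->
  (forall t, topword m t -> d t -> [/\ topword n (h' t), c (h' t) & h (h' t) = t]) ->
  wsum n c = 'X^k * wsum m d.
Proof.
move=> H H'; rewrite /wsum big_distrr /= -!(big_filter _ c) -!(big_filter _ d).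
have p : perm_eq [seq h s | s <- tops n & c s] [seq t <- tops m | d t].
  apply: uniq_perm; rewrite ?filter_uniq ?uniq_tops //.
    rewrite map_inj_in_uniq ?filter_uniq ?uniq_tops // => s1 s2.
    rewrite !mem_filter !mem_tops => /andP[c1 t1] /andP[c2 t2] e.
    have [_ _ <- _] := H _ t1 c1; have [_ _ <- _] := H _ t2 c2; by rewrite e.
  move=> t; apply/mapP/idP => [[s]|].
    by rewrite !mem_filter !mem_tops => /andP[c1 t1] ->; have [-> -> _ _] := H _ t1 c1.
  rewrite mem_filter mem_tops => /andP[dt tt]; have [h1 h2 h3] := H' _ tt dt.
  by exists (h' t); rewrite ?h3 // mem_filter mem_tops h1 h2.
rewrite -(perm_big _ p) /= big_map; apply: eq_big_seq => s.
rewrite mem_filter mem_tops => /andP[cs ts]; have [_ _ _ ->] := H _ ts cs.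
by rewrite addnC exprD.
Qed.

Lemma eq_wsum n (c d : pred (seq int)) :
  (forall s, topword n s -> c s = d s) -> wsum n c = wsum n d.
Proof.
move=> H; rewrite /wsum big_seq_cond [RHS]big_seq_cond; apply: eq_bigl => s.
by rewrite mem_tops; case: (boolP (topword n s)) => //= /H.
Qed.

Lemma wsum_split n (a c : pred (seq int)) :
  wsum n c = wsum n (fun s => c s && a s) + wsum n (fun s => c s && ~~ a s).
Proof. by rewrite /wsum (bigID a). Qed.

Lemma wsum0 n (c : pred (seq int)) : (forall s, topword n s -> c s = false) -> wsum n c = 0.
Proof. by move=> H; rewrite (eq_wsum H) /wsum big_pred0. Qed.

(** * Insertion of an extreme letter *)

Notation descent := (fun x y : int => y < x).
Notation increasing := (sorted (fun x y : int => x <= y)).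

Lemma size_des s : size (des s) = size s.
Proof. exact: size_pairmap. Qed.

Lemma des_cat u v : des (u ++ v) = des u ++ pairmap descent (last 0 u) v.
Proof. exact: pairmap_cat. Qed.

Lemma des_rcons s x : des (rcons s x) = rcons (des s) (x < last 0 s).
Proof. by rewrite -cats1 des_cat cats1. Qed.

Lemma pairmap_increasing x v :
  (pairmap descent x v == nseq (size v) false) = path (fun x y : int => x <= y) x v.
Proof. by elim: v x => //= y v IH x; rewrite eqseq_cons IH eqbF_neg -leNgt. Qed.

(** Locates the last descent: read from the right, the last [true] is the first one. *)
Lemma last_true_inj (P Q : seq bool) j k :
  P ++ true :: nseq j false = Q ++ true :: nseq k false -> P = Q /\ j = k.
Proof.
move/(congr1 rev); rewrite !rev_cat !rev_cons -!cats1 -!catA !rev_nseq /=.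
elim: j k => [|j IH] [|k] //= [].
  by move/(congr1 rev); rewrite !revK.
by move/IH => [-> ->].
Qed.

Lemma index_drop p (t : seq int) y : y \in t -> (p <= index y t)%N ->
  y \in drop p t /\ index y t = (p + index y (drop p t))%N.
Proof.
move=> yt; have pt : y \in t -> (p <= index y t)%N -> (p <= size t)%N.
  by move=> _ h; apply: leq_trans h _; apply: index_size.
move=> h; have sz := size_takel (pt yt h).
have -> : index y t = index y (take p t ++ drop p t) by rewrite cat_take_drop.
rewrite index_cat sz; case: ifP => ytk.
  move: h; have -> : index y t = index y (take p t ++ drop p t) by rewrite cat_take_drop.
  by rewrite index_cat ytk; move: ytk; rewrite -index_mem sz ltnNge => /negbTE->.
by move: yt; rewrite -{1}(cat_take_drop p t) mem_cat ytk /= => ->.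
Qed.

Lemma before_increasing (s : seq int) y z :
  increasing s -> y \in s -> z \in s -> before s y z -> y < z.
Proof.
move=> so ys zs b; rewrite lt_neqAle (before_neq b) /=.
have tr : transitive (fun x y : int => x <= y) by move=> a b' c; apply: le_trans.
exact: (sorted_ltn_index tr so y z ys zs b).
Qed.

Lemma before_drop p (t : seq int) y z : increasing (drop p t) ->
  y \in t -> z \in t -> (p <= index y t)%N -> before t y z -> y < z.
Proof.
move=> so yt zt py b; have [yd ey] := index_drop yt py.
have pz : (p <= index z t)%N by apply: leq_trans py (ltnW b).
have [zd ez] := index_drop zt pz.
by apply: (before_increasing so yd zd); move: b; rewrite /before ey ez ltn_add2l.
Qed.

Lemma index_last0 (s : seq int) : uniq s -> s != [::] -> index (last 0 s) s = (size s).-1.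
Proof. by case: s => // a s u _; exact: (index_last u). Qed.

Lemma le_last_drop p (t : seq int) (y : int) : uniq t -> increasing (drop p t) ->
  y \in t -> (p <= index y t)%N -> y <= last 0 t.
Proof.
move=> ut so yt py; have tn : t != [::] by case: (t) yt.
have lt : last 0 t \in t by case: (t) tn => // a s _; rewrite /= mem_last.
have [->//|ne] := eqVneq y (last 0 t).
apply/ltW/(before_drop so yt lt py).
have /orP[//|] := before_total yt lt ne; rewrite {1}/before index_last0 // => h.
by move: yt; rewrite -index_mem => h'; move: (leq_ltn_trans h h'); case: (size t) => // m; rewrite ltnn.
Qed.

Lemma absz_le_signed n (t : seq int) (x : int) : signed n t -> x \in t -> - n%:Z <= x <= n%:Z /\ x != 0.
Proof. by move=> sg xt; have := signed_mem sg xt; lia. Qed.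

(** As left letter of an inversion, n + 1 has a non-negative sum with every letter; it only requires
    that the letters after it increase. *)
Lemma good_insert_max n p t : signed n t -> (p <= size t)%N -> increasing (drop p t) ->
  good (insert p n.+1%:Z t) = good t.
Proof.
move=> sg pt so; have B (x : int) : x \in t -> - n%:Z <= x <= n%:Z /\ x != 0 by apply: absz_le_signed.
have nt : n.+1%:Z \notin t by apply/negP => /B; lia.
apply/idP/idP; first exact: good_sub_insert.
move=> /goodP G; apply/goodP => x y z; rewrite !mem_insert.
move=> /orP[/eqP->|xt] /orP[/eqP->|yt]; rewrite ?ltxx //.
- case/orP=> [/eqP->|zt]; rewrite before_insertl // => py _; split.
  + by rewrite before_insert //; apply: (before_drop so).
  + by move=> _; have := B z zt; lia.
- by move=> _ _; have := B x xt; lia.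
- case/orP=> [/eqP->|zt]; rewrite before_insert // => b yx.
    by split=> _; [have := B y yt | have := B x xt]; lia.
  by have := G x y z xt yt zt b yx; rewrite before_insert.
Qed.

Lemma topword_neq0 n s : topword n s -> (0 < n)%N.
Proof. by case: n => // /and3P[/signed_size/size0nil->]. Qed.

Lemma topword_last n s : topword n s -> last 0 s \in s.
Proof.
move=> t; have := topword_neq0 t; case/and3P: t => /signed_size <- _ _.
by case: s => //= a s _; apply: mem_last.
Qed.

Lemma topword_insert_max n p t : signed n t -> (p <= size t)%N -> increasing (drop p t) ->
  topword n.+1 (insert p n.+1%:Z t) = topword n t.
Proof.
move=> sg pt so; have B (x : int) : x \in t -> - n%:Z <= x <= n%:Z /\ x != 0 by apply: absz_le_signed.
have nt : n.+1%:Z \notin t by apply/negP => /B; lia.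
by rewrite /topword signed_insert // good_insert_max // has_neg_insert.
Qed.

Lemma last_insert p v (t : seq int) : (p < size t)%N -> last 0 (insert p v t) = last 0 t.
Proof.
move=> pt; rewrite /insert last_cat /= -{2}(cat_take_drop p t) last_cat.
have : size (drop p t) != 0%N by rewrite size_drop subn_eq0 -ltnNge.
by case: (drop p t).
Qed.

(** The cut at n holds when all letters from position [p] on are negative, and as they increase the
    last one decides. A cut at i < n survives: a positive letter x <= i behind the new one would
    have to precede a positive letter n, which would then lie in the increasing tail and end the
    word. *)
Lemma inv_blocks_insert_max n p t : topword n t -> (p < size t)%N -> increasing (drop p t) ->
  last 0 t != n%:Z ->
  inv_blocks (insert p n.+1%:Z t) = (inv_blocks t + (last 0%R t < 0)%R)%N.
Proof.
move=> tt pt so ln; have /and3P[sg gt _] := tt.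
have B (x : int) : x \in t -> - n%:Z <= x <= n%:Z /\ x != 0 by apply: absz_le_signed.
have nt : n.+1%:Z \notin t by apply/negP => /B; lia.
have lt := topword_last tt; have n0 := topword_neq0 tt; have ut := signed_uniq sg.
have szt := signed_size sg; have pt' := ltnW pt.
rewrite /inv_blocks size_insert // szt /= -addnA; congr (1 + _)%N.
have -> : iota 1 n = iota 1 n.-1 ++ [:: n].
  by have := iotaD 1 n.-1 1; rewrite addn1 add1n prednK.
rewrite count_cat /= addn0.
have tl x : x \in t -> ~~ before (insert p n.+1%:Z t) x n.+1%:Z -> x <= last 0 t.
by move=> xt; rewrite before_insertr // -leqNgt; apply: le_last_drop.
have E x : inv_lt (insert p n.+1%:Z t) x n.+1%:Z = (x < 0) || before (insert p n.+1%:Z t) x n.+1%:Z.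
  by [].
congr (_ + nat_of_bool _)%N; last first.
  rewrite cut_insert //.
  have -> : cut t n by apply/cutP => x y xt yt; have := signed_mem sg yt; lia.
  apply/allP/idP => /= [/(_ _ lt)|l0 x xt].
    rewrite E; have -> : (`|last 0%R t| <= n)%N by case/andP: (signed_mem sg lt).
    case/orP=> //; rewrite before_insertr // index_last0 // ?szt; lia || by case: (t) pt.
  apply/implyP => _; rewrite E; case: (boolP (before _ _ _)) => [_|/(tl _ xt)]; rewrite ?orbT //.
  by move=> h; rewrite (le_lt_trans h l0).
apply: eq_in_count => i; rewrite mem_iota => /andP[i1 i2].
rewrite cut_insert //; last lia.
case: (boolP (cut t i)) => //= /cutP C; apply/allP => x xt; apply/implyP => xi; rewrite E.
case: (ltP x 0) => //= x0; apply: contraT; rewrite before_insertr // -leqNgt => px.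
have n1 : (0 < n <= n)%N by rewrite n0 leqnn.
case: (signed_ex sg n1) => yt; have := C x _ xt yt; rewrite /inv_lt [x < 0]ltNge x0 /=; last first.
  by rewrite ifF; [move=> H; have := H ltac:(lia) | lia].
rewrite ifT; last lia.
move=> H; have b := H ltac:(lia).
have py : (p <= index n%:Z t)%N by apply: leq_trans px (ltnW b).
have := le_last_drop ut so yt py; have := B _ lt; move: ln; lia.
Qed.

Lemma increasing_before (t : seq int) : uniq t ->
  (forall x y : int, x \in t -> y \in t -> before t x y -> x <= y) -> increasing t.
Proof.
move=> ut H; apply/(sortedP 0) => i il; apply: H; rewrite ?mem_nth //; first exact: ltnW.
by rewrite /before !index_uniq // ltnW.
Qed.

Lemma index_drop_uniq p (t : seq int) (y : int) : uniq t -> y \in drop p t ->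
  index y t = (p + index y (drop p t))%N.
Proof.
move=> ut yd; have pt : (p <= size t)%N.
  by case: leqP => // h; move: yd; rewrite drop_oversize // ltnW.
have -> : index y t = index y (take p t ++ drop p t) by rewrite cat_take_drop.
rewrite index_cat size_takel //; case: ifP => // yk.
move: ut; rewrite -{1}(cat_take_drop p t) cat_uniq => /and3P[_ /hasPn h _].
by have := h y yd; rewrite yk.
Qed.

Lemma signed_ltS n (t : seq int) (x : int) : signed n t -> x \in t -> x < n.+1%:Z.
Proof. by move=> sg /(absz_le_signed sg); lia. Qed.

Lemma signed_gtS n (t : seq int) (x : int) : signed n t -> x \in t -> - n.+1%:Z < x.
Proof. by move=> sg /(absz_le_signed sg); lia. Qed.

(** [N] forms an inversion with every letter after it, and no letter following the bottom of an
    inversion may be smaller than that bottom. *)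
Lemma structure_max n s (N := n.+1%:Z) (p := index N s) (t := rem N s) :
  topword n.+1 s -> N \in s -> last 0 s != N ->
  [/\ s = insert p N t, (p < size t)%N, increasing (drop p t) & topword n t].
Proof.
move=> tt Ns ln; have /and3P[sg gs _] := tt.
have us := signed_uniq sg; have [e nt] := insert_rem Ns us.
have pt : (p <= size t)%N := size_rem_index Ns.
have pt' : (p < size t)%N.
  rewrite ltn_neqAle pt andbT; apply: contra ln => /eqP pe.
  by rewrite e -/p -/t pe -insert_rcons last_rcons.
have ut : uniq t := rem_uniq _ us.
have sgt : signed n t by rewrite -(signed_insert p t (v := N)) // -e.
have so : increasing (drop p t).
  apply: increasing_before => [|x y xd yd b]; first exact: drop_uniq.
  have xt := mem_drop xd; have yt := mem_drop yd.
  have ex := index_drop_uniq ut xd; have ey := index_drop_uniq ut yd.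
  have b' : before t x y by move: b; rewrite /before ex ey ltn_add2l.
  move/goodP: gs; rewrite e -/p -/t => /(_ N x y); rewrite !mem_insert xt yt eqxx !orbT.
  rewrite before_insertl // ex leq_addr before_insert //.
  have xN : x < N := signed_ltS sgt xt.
  by move=> /(_ isT isT isT isT xN) [/(_ b') /ltW].
by split=> //; rewrite -(topword_insert_max sgt pt so) -e.
Qed.

(** An inversion with top x among the other letters would violate the sum condition, because x - N <
    0. *)
Lemma structure_min n s (N := n.+1%:Z) (p := index (- N) s) (t := rem (- N) s) :
  topword n.+1 s -> N \notin s ->
  [/\ s = insert p (- N) t, (p <= size t)%N, increasing t, signed n t & - N \notin t].
Proof.
move=> tt Ns; have /and3P[sg gs _] := tt.
have Nm : - N \in s.
  have n1 : (0 < n.+1 <= n.+1)%N by rewrite leqnn.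
  by case: (signed_ex sg n1) => //; rewrite -/N (negbTE Ns).
have us := signed_uniq sg; have [e nt] := insert_rem Nm us.
have pt : (p <= size t)%N := size_rem_index Nm.
have ut : uniq t := rem_uniq _ us.
have sgt : signed n t by rewrite -(signed_insert p t (v := - N)) ?abszN // -e.
split=> //; apply: increasing_before => // x y xt yt b; rewrite leNgt; apply/negP => yx.
move/goodP: gs; rewrite e -/p -/t => /(_ x y (- N)); rewrite !mem_insert xt yt eqxx !orbT.
rewrite before_insert // => /(_ isT isT isT b yx) [_].
by rewrite lt_eqF ?(signed_gtS sgt yt) // subr_ge0 leNgt (signed_ltS sgt xt) => /(_ isT).
Qed.

Definition ids n : seq int := [seq i%:Z | i <- iota 1 n].

Lemma increasing_pos_ids n (t : seq int) : signed n t -> increasing t ->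
  (forall x : int, x \in t -> 0 < x) -> t = ids n.
Proof.
move=> sg so pos; have e : [seq absz x | x <- t] = iota 1 n.
  apply: (sorted_eq leq_trans anti_leq) => //; last exact: iota_sorted.
  rewrite sorted_map; have pos' : all (fun x : int => 0 < x) t by apply/allP; exact: pos.
  by apply: sub_in_sorted pos' so => x y; rewrite /in_mem /=; lia.
rewrite /ids -e -map_comp -[LHS]map_id; apply/eq_in_map => x /pos /=; lia.
Qed.

(** If a letter precedes [- N], the first letter [a] forms an inversion with it, so a + a >= 0 and
    the increasing rest is 1, ..., n. Then [- N] is last, since otherwise the word would end in
    n. *)
Lemma structure_min_last n s (N := n.+1%:Z) : (0 < n)%N ->
  topword n.+1 s -> N \notin s -> last 0 s != n%:Z ->
  (exists t, [/\ s = - N :: t, increasing t & signed n t]) \/ s = rcons (ids n) (- N).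
Proof.
move=> n0 tt Ns ln; have [e pt so sgt nt] := structure_min tt Ns.
set p := index _ _ in e pt; set t := rem _ _ in e so sgt nt pt.
have [p0|p0] := posnP p; first by left; exists t; rewrite {1}e p0 /insert take0 drop0.
have szt := signed_size sgt; have ut := signed_uniq sgt.
right; have pos (x : int) : x \in t -> 0 < x.
  case: t e pt so sgt nt szt ut => // a t' e pt so sgt nt szt ut xt.
  have a0 : 0 < a.
    have /and3P[_ /goodP G _] := tt; have at' : a \in a :: t' by rewrite mem_head.
    have := G a (- N) a; rewrite {1 2 3 4}e !mem_insert at' eqxx !orbT before_insertr //= eqxx p0.
    have aN := signed_gtS sgt at'; rewrite gt_eqF // => /(_ isT isT isT isT aN)[_ /(_ isT)].
    by case: (absz_le_signed sgt at') => _; clear; lia.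
  apply: (lt_le_trans a0); move: xt; rewrite inE => /orP[/eqP->//|xt'].
  have tr : transitive (fun x y : int => x <= y) by move=> b c d; apply: le_trans.
  by have /allP := order_path_min tr so; apply.
have et := increasing_pos_ids sgt so pos.
rewrite e -et insert_rcons; congr insert; apply/eqP; rewrite eqn_leq pt /= leqNgt.
apply: contra ln => pl; rewrite e last_insert // et /ids.
by case: (n) n0 => // m _; rewrite -[m.+1]addn1 iotaD map_cat last_cat /= add1n addn1.
Qed.

Notation zeros j := (nseq j false).

Lemma des_increasing_drop P b j (t : seq int) :
  des t = P ++ b :: zeros j -> increasing (drop (size P) t).
Proof.
move=> e; have sz := congr1 size e; rewrite size_des size_cat /= size_nseq in sz.
have pt : (size P <= size t)%N by lia.
move: e; rewrite -{1}(cat_take_drop (size P) t) des_cat => /eqP.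
rewrite eqseq_cat ?size_des ?size_takel // => /andP[_].
have : size (drop (size P) t) = j.+1 by rewrite size_drop; lia.
case: (drop _ t) => //= y v [sv]; rewrite eqseq_cons => /andP[_].
by rewrite -sv pairmap_increasing.
Qed.

(** The bit [b] is absent from the descent set after the insertion; this loss is what makes the
    recursions sum over both values of a bit. *)
Lemma des_insert_max n p (t : seq int) : signed n t -> (p < size t)%N -> increasing (drop p t) ->
  exists P b, [/\ size P = p, des t = P ++ b :: zeros (size t - p).-1 &
    des (insert p n.+1%:Z t) = P ++ false :: true :: zeros (size t - p).-1].
Proof.
move=> sg pt so; have : size (drop p t) != 0%N by rewrite size_drop; lia.
have szd : size (drop p t) = (size t - p)%N by rewrite size_drop.
rewrite /insert; move: szd so; case ed: (drop p t) => [//|y v] /= szd so _.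
have lt x : x \in t -> x < n.+1%:Z by move=> xt; have := absz_le_signed sg xt; lia.
have yt : y \in t by apply: (@mem_drop p); rewrite ed mem_head.
have ev : pairmap descent y v = zeros (size t - p).-1.
  by apply/eqP; rewrite -szd /= pairmap_increasing.
exists (des (take p t)), (y < last 0 (take p t)); split.
- by rewrite size_des size_takel // ltnW.
- by rewrite -{1}(cat_take_drop p t) des_cat ed /= ev.
rewrite des_cat /= ev (lt _ yt); congr (_ ++ _ :: _); apply/negbTE; rewrite -leNgt.
case tk: (take p t) => [//|a u]; apply/ltW/lt/(@mem_take p).
by rewrite tk /= mem_last.
Qed.

(* Deleting the largest letter, which stands at the top of the last descent. *)
Lemma wsum_delete_max P j (a : pred int) k (n := (size P + j).+1%N) :
  (forall x, a x -> [/\ x != n%:Z, x != n.+1%:Z & nat_of_bool (x < 0) = k]) ->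
  wsum n.+1 (fun s => [&& des s == P ++ false :: true :: zeros j, a (last 0 s) & n.+1%:Z \in s]) =
  'X^k * wsum n (fun t => ((des t == P ++ false :: zeros j) || (des t == P ++ true :: zeros j))
                           && a (last 0 t)).
Proof.
move=> H; pose N := n.+1%:Z; apply: (wsum_bij (h := rem N) (h' := insert (size P) N)) => [s ts|t tt].
  case/and3P=> /eqP ds al Ns; have [ln lN lk] := H _ al.
  have [e pt so tt] := structure_max ts Ns lN.
  have [sg _ _] := and3P tt; have [Q [b [sQ dt ds']]] := des_insert_max sg pt so.
  have [eP ej] : P = Q /\ j = (size (rem N s) - index N s).-1.
    move: ds; rewrite {1}e ds' -(cat_rcons false Q) -(cat_rcons false P).
    by case/last_true_inj => /rcons_inj[-> ->].
  have lt : last 0 (rem N s) = last 0 s by rewrite [in RHS]e last_insert.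
  have aln : last 0 (rem N s) != n%:Z by rewrite lt.
  split=> //.
  - by rewrite dt eP ej lt al andbT; case: b {dt}; rewrite eqxx ?orbT.
  - by rewrite eP sQ.
  - by rewrite [in LHS]e inv_blocks_insert_max // lt lk.
case/andP=> dt al; have [ln lN lk] := H _ al; have [sg _ _] := and3P tt.
have szt := signed_size sg.
have so : increasing (drop (size P) t) by case/orP: dt => /eqP /des_increasing_drop.
have pt : (size P < size t)%N by rewrite szt /n; lia.
have nt : N \notin t by apply/negP => /(absz_le_signed sg); rewrite /N; lia.
have [Q [b [sQ dt' ds']]] := des_insert_max sg pt so.
have ej : (size t - size P).-1 = j by rewrite szt /n; lia.
have eQ : Q = P by case/orP: dt; rewrite dt' eqseq_cat // => /andP[/eqP].
have e1 : index N (insert (size P) N t) = size P by rewrite index_insert_new // ltnW.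
split.
- by rewrite topword_insert_max // ltnW.
- by rewrite ds' eQ ej eqxx last_insert // al mem_insert eqxx.
exact: rem_insert.
Qed.

Lemma iotaSr n : iota 1 n.+1 = rcons (iota 1 n) n.+1.
Proof. by have := iotaD 1 n 1; rewrite addn1 add1n cats1. Qed.

Lemma inv_lt_rcons (t : seq int) (v x : int) : v \notin t -> x \in t -> 0 < v -> inv_lt (rcons t v) x v.
Proof.
by move=> vt xt v0; rewrite /inv_lt v0 insert_rcons before_insertr // index_mem xt orbT.
Qed.

Lemma cut_rcons (t : seq int) (v : int) i : v \notin t -> 0 < v -> (i < absz v)%N ->
  cut (rcons t v) i = cut t i.
Proof.
move=> vt v0 iv; rewrite insert_rcons cut_insert // -insert_rcons.
case: (cut t i) => //=; apply/allP => x xt; apply/implyP => _; exact: inv_lt_rcons.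
Qed.

Lemma cut_max n (t : seq int) : signed n t -> cut t n.
Proof.
move=> sg; apply/cutP => x y xt yt /andP[_ ny].
by case/andP: (signed_mem sg yt) => _; rewrite leqNgt ny.
Qed.

(** The inverse fixes n + 1, which becomes a block of its own. *)
Lemma inv_blocks_rcons_max n t : topword n t -> inv_blocks (rcons t n.+1%:Z) = (inv_blocks t + 1)%N.
Proof.
move=> tt; have [sg _ _] := and3P tt; have n0 := topword_neq0 tt.
have nt : n.+1%:Z \notin t by apply/negP => /(signed_ltS sg); rewrite ltxx.
rewrite /inv_blocks size_rcons (signed_size sg) /= -addnA; congr (1 + _)%N.
have -> : iota 1 n = iota 1 n.-1 ++ [:: n] by rewrite cats1 -[in LHS](prednK n0) iotaSr prednK.
rewrite count_cat /= addn0.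
rewrite cut_rcons // (cut_max sg) //; congr (_ + _)%N; apply: eq_in_count => i.
rewrite mem_iota => /andP[_ ilt]; apply: cut_rcons => //=.
by move: ilt; rewrite add1n !ltnS => h; apply: leq_trans h (leq_pred n).
Qed.

Definition unrcons (s : seq int) := take (size s).-1 s.

Lemma unrconsK s : s != [::] -> s = rcons (unrcons s) (last 0 s).
Proof.
by case/lastP: s => // s x _; rewrite last_rcons /unrcons size_rcons /= -cats1 take_size_cat // cats1.
Qed.

Lemma unrcons_rcons t x : unrcons (rcons t x) = t.
Proof. by rewrite /unrcons size_rcons /= -cats1 take_size_cat. Qed.

Lemma topword_nil n s : topword n s -> s != [::].
Proof. by case: s => // /topword_last. Qed.

(** * Words of length n + 1 ending in n *)

Section Swap.
Variable n : nat.
Hypothesis n0 : (0 < n)%N.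

(* Exchanges the letters of absolute values n and n+1. *)
Definition swap_top (x : int) : int :=
  if x == n%:Z then n.+1%:Z else if x == n.+1%:Z then n%:Z else
  if x == - n%:Z then - n.+1%:Z else if x == - n.+1%:Z then - n%:Z else x.

Definition swap_topn (x : nat) : nat :=
  if x == n then n.+1 else if x == n.+1 then n else x.

Lemma swap_topK : involutive swap_top.
Proof. by move=> x; rewrite {2}/swap_top; do 4?[case: eqP => ?]; rewrite /swap_top; do 4?[case: eqP => ?]; lia. Qed.

Lemma swap_top0 : swap_top 0 = 0.
Proof. by rewrite /swap_top; do 8?[case: eqP => ?]; lia. Qed.

Lemma swap_topnK : involutive swap_topn.
Proof. by move=> x; rewrite {2}/swap_topn; do 2?[case: eqP => ?]; rewrite /swap_topn; do 2?[case: eqP => ?]; lia. Qed.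

Lemma absz_swap_top x : absz (swap_top x) = swap_topn (absz x).
Proof. rewrite /swap_top; do 4?[case: eqP => ?]; rewrite /swap_topn; do 2?[case: eqP => ?]; lia. Qed.

(** On absolute values up to n the exchange only pushes the extreme values outwards, so it keeps the
    order and, below, the signs of sums. *)
Lemma swap_top_lt x y : (absz x <= n)%N -> (absz y <= n)%N -> (swap_top x < swap_top y) = (x < y).
Proof. by rewrite /swap_top; do 8?[case: eqP => ?]; lia. Qed.

Lemma swap_top_lt0 x : (swap_top x < 0) = (x < 0).
Proof. by rewrite /swap_top; do 8?[case: eqP => ?]; lia. Qed.

Lemma swap_top_gt0 x : (0 < swap_top x) = (0 < x).
Proof. by rewrite /swap_top; do 8?[case: eqP => ?]; lia. Qed.

Lemma swap_top_add x y : (absz x <= n)%N -> (absz y <= n)%N ->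
  (0 <= swap_top x + swap_top y) = (0 <= x + y).
Proof. by rewrite /swap_top; do 8?[case: eqP => ?]; lia. Qed.

Lemma swap_top_bound x : (absz x <= n)%N ->
  [/\ swap_top x != n%:Z, - n.+1%:Z <= swap_top x <= n.+1%:Z & swap_top x != - n%:Z].
Proof. by rewrite /swap_top; do 4?[case: ifP => ?]; split; lia. Qed.

Lemma swap_top_gt x : (absz x <= n)%N -> (n%:Z < swap_top x) = (x == n%:Z).
Proof. by rewrite /swap_top; do 4?[case: ifP => ?]; lia. Qed.

Lemma before_swap t x y : before (map swap_top t) (swap_top x) (swap_top y) = before t x y.
Proof. by rewrite /before !index_map //; apply: inv_inj swap_topK. Qed.

Lemma inv_lt_swap t x y : inv_lt (map swap_top t) (swap_top x) (swap_top y) = inv_lt t x y.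
Proof. by rewrite /inv_lt !before_swap swap_top_gt0 swap_top_lt0. Qed.

Lemma signed_swap t : signed n.+1 (rcons (map swap_top t) n%:Z) = signed n t.
Proof.
rewrite /signed map_rcons -map_comp /=.
rewrite (eq_map (g := swap_topn \o absz)); last by move=> x /=; rewrite absz_swap_top.
have -> : n = swap_topn n.+1 by rewrite /swap_topn eqxx; case: eqP => ?; lia.
rewrite map_comp -map_rcons; have [m en] : exists m, n = m.+1 by exists n.-1; rewrite prednK.
have -> : swap_topn n.+1 = n by rewrite /swap_topn eqxx; case: eqP => ?; lia.
have -> : perm_eq (map swap_topn (rcons (map absz t) n.+1)) (iota 1 n.+1)
       = perm_eq (map swap_topn (rcons (map absz t) n.+1)) (map swap_topn (rcons (iota 1 n) n.+1)).
  suff /permPr -> : perm_eq (iota 1 n.+1) (map swap_topn (rcons (iota 1 n) n.+1)) by [].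
  rewrite -iotaSr en !iotaSr -en !map_rcons.
  rewrite -!cats1 -!catA /=.
  have -> : map swap_topn (iota 1 m) = iota 1 m.
    rewrite -[RHS]map_id; apply/eq_in_map => i; rewrite mem_iota /swap_topn => ?.
    by do 2?[case: eqP => ?]; lia.
  rewrite perm_cat2l /swap_topn !eqxx; case: eqP => [|_]; first lia.
  by rewrite -(cat1s n [:: n.+1]) perm_catC.
apply/idP/idP => [/(perm_map_inj (inv_inj swap_topnK))|H]; last apply: perm_map;
  by rewrite ?perm_rcons 1?perm_sym perm_rcons perm_cons 1?perm_sym.
Qed.
End Swap.

Section AppendSubmax.
Variables (n : nat) (t : seq int).
Hypotheses (n0 : (0 < n)%N) (sg : signed n t).
Let u := map (swap_top n) t.
Let v : int := n%:Z.

Let bound (x : int) : x \in t -> (absz x <= n)%N.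
Proof. by move=> xt; case/andP: (signed_mem sg xt). Qed.

Let memu (x : int) : x \in u -> exists2 x', x' \in t & x = swap_top n x'.
Proof. by case/mapP=> x' ? ->; exists x'. Qed.

Let boundu (x : int) : x \in u ->
  [/\ x != v, - n.+1%:Z <= x <= n.+1%:Z & x != - v].
Proof. by case/memu=> x' xt ->; apply/(swap_top_bound n0)/bound. Qed.

Let vu : v \notin u.
Proof. by apply/negP => /boundu[]; rewrite eqxx. Qed.

Let v0 : 0 < v. Proof. by rewrite /v; clear -n0; lia. Qed.

Lemma good_swap : good u = good t.
Proof.
apply/goodP/goodP => G x y z.
  move=> xt yt zt b yx; have bx := bound xt; have by' := bound yt; have bz := bound zt.
  have := G (swap_top n x) (swap_top n y) (swap_top n z).
  rewrite !map_f // !before_swap // !swap_top_lt // swap_top_add // (inj_eq (inv_inj (swap_topK n0))).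
  by apply.
case/memu=> x' xt -> /memu[y' yt ->] /memu[z' zt ->].
have bx := bound xt; have by' := bound yt; have bz := bound zt.
rewrite !before_swap // !swap_top_lt // swap_top_add // (inj_eq (inv_inj (swap_topK n0))).
exact: G.
Qed.

(** The final n is the bottom of an inversion only under n + 1, whose sum with any letter is
    non-negative; as a third letter it exceeds every other bottom. *)
Lemma good_append : good (rcons u v) = good t.
Proof.
rewrite -good_swap insert_rcons; apply/idP/idP => [|/goodP G]; first exact: good_sub_insert.
apply/goodP => x y z; rewrite !mem_insert.
have last_v x' : x' \in u -> before (insert (size u) v u) v x' = false.
  by move=> xu; rewrite before_insertl // leqNgt index_mem xu.
move=> /orP[/eqP->|xu] /orP[/eqP->|yu]; rewrite ?ltxx //.
- by rewrite last_v.
- have [xv bx xv'] := boundu xu; move=> zs _ vx; split.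
    by case/orP: zs => [/eqP->|zu]; [rewrite /before ltnn | rewrite last_v].
  move=> zv; case/orP: zs zv => [/eqP->|/boundu[zv bz zv'] _]; first by rewrite eqxx.
  by move: xv bx xv' vx zv bz zv'; rewrite /v; clear; lia.
have [xv bx xv'] := boundu xu; have [yv by' yv'] := boundu yu.
case/orP=> [/eqP->|zu]; rewrite before_insert // => b yx.
  by move: xv bx xv' yv by' yv' yx; rewrite /v; clear; split; lia.
by rewrite before_insert //; apply: G.
Qed.

Lemma topword_append : topword n.+1 (rcons u v) = topword n t.
Proof.
rewrite /topword signed_swap // good_append; congr [&& _, _ & _].
rewrite /has_neg has_rcons ltNge (ltW v0) /= has_map; apply: eq_has => x /=.
exact: swap_top_lt0.
Qed.

Lemma last_swap : last 0 u = swap_top n (last 0 t).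
Proof. by rewrite -[in LHS](swap_top0 n0) last_map. Qed.

Lemma des_swap : des u = des t.
Proof.
have H (w : seq int) (x : int) : (absz x <= n)%N -> {subset w <= t} ->
    pairmap descent (swap_top n x) (map (swap_top n) w) = pairmap descent x w.
  elim: w x => //= y w IH x xn sub; have yn : (absz y <= n)%N by apply/bound/sub; rewrite mem_head.
  by rewrite swap_top_lt // IH // => z zw; apply: sub; rewrite inE zw orbT.
by rewrite /des /u -[in LHS](swap_top0 n0); apply: H.
Qed.

Lemma des_append : topword n t -> des (rcons u v) = rcons (des t) (last 0 t == v).
Proof.
by move=> tt; rewrite des_rcons des_swap last_swap swap_top_gt //; apply/bound/topword_last/tt.
Qed.

(** The cut at n fails: the inverse sends n to n + 1, the last position, hence n + 1 to something
    smaller. For i < n the exchange does not change which letters lie below or above the cut. *)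
Lemma inv_blocks_append : topword n t -> inv_blocks (rcons u v) = inv_blocks t.
Proof.
move=> tt; rewrite /inv_blocks size_rcons size_map (signed_size sg) /=; congr (1 + _)%N.
have -> : iota 1 n = iota 1 n.-1 ++ [:: n] by rewrite cats1 -[in LHS](prednK n0) iotaSr prednK.
rewrite count_cat /= addn0 [X in (_ + nat_of_bool X)%N](_ : _ = false) ?addn0.
  apply: eq_in_count => i; rewrite mem_iota => /andP[_ ilt].
  have i_n : (i < n)%N by move: ilt; rewrite add1n (prednK n0).
  rewrite cut_rcons //.
  have sw (x : int) : x \in t -> ((absz (swap_top n x) <= i) = (absz x <= i))%N
      /\ ((i < absz (swap_top n x)) = (i < absz x))%N.
    move=> /bound; rewrite absz_swap_top // /swap_topn; move: i_n; clear.
    by case: eqP => [->|?]; [|case: eqP => [->|?]]; lia.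
  apply/cutP/cutP => C x y.
    move=> xt yt b; have := C _ _ (map_f _ xt) (map_f _ yt).
    by rewrite inv_lt_swap // (sw x xt).1 (sw y yt).2; apply.
  case/memu=> x' xt -> /memu[y' yt ->].
  by rewrite inv_lt_swap // (sw x' xt).1 (sw y' yt).2; apply: C.
have n1 : (0 < n <= n)%N by rewrite n0 leqnn.
have vv : v \in rcons u v by rewrite mem_rcons mem_head.
have last_v x' : x' \in u -> before (rcons u v) v x' = false.
  by move=> xu; rewrite insert_rcons before_insertl // leqNgt index_mem xu.
apply/negP => /cutP C; have nv : (v < 0) = false by rewrite ltNge (ltW v0).
case: (signed_ex sg n1) => yt; have yu := map_f (swap_top n) yt; have := C v _ vv.
  move=> /(_ (swap_top n n%:Z)); rewrite mem_rcons inE yu orbT /inv_lt swap_top_gt0 // -/v v0 nv last_v //.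
  by rewrite absz_swap_top // /swap_topn /v /= eqxx leqnn ltnSn => /(_ isT isT).
move=> /(_ (swap_top n (- n%:Z))); rewrite mem_rcons inE yu orbT /inv_lt swap_top_gt0 // oppr_gt0 -/v nv /=.
by rewrite absz_swap_top // abszN /swap_topn /v /= eqxx leqnn ltnSn => /(_ isT isT).
Qed.

End AppendSubmax.

Lemma append_submax_surj n s : (0 < n)%N -> topword n.+1 s -> last 0 s = n%:Z ->
  exists2 t, topword n t & s = rcons (map (swap_top n) t) n%:Z.
Proof.
move=> n0 ts ls; have e := unrconsK (topword_nil ts); rewrite ls in e.
exists (map (swap_top n) (unrcons s)); last first.
  by rewrite -map_comp (eq_map (g := id)) ?map_id // => x /=; rewrite swap_topK.
have sg : signed n (map (swap_top n) (unrcons s)).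
  rewrite -signed_swap // -map_comp (eq_map (g := id)) => [|x /=]; last by rewrite swap_topK.
  by rewrite map_id -e; case/and3P: ts.
rewrite -topword_append // -map_comp (eq_map (g := id)) => [|x /=]; last by rewrite swap_topK.
by rewrite map_id -e.
Qed.

(** * Recursions for the descent generating functions *)

Definition eall D := wsum (size D) (fun s => des s == D).
Definition eneg D := wsum (size D) (fun s => (des s == D) && (last 0 s < 0)).
Definition epos D := wsum (size D) (fun s => (des s == D) && (0 < last 0 s < (size D)%:Z)).
Definition emax D := wsum (size D) (fun s => (des s == D) && (last 0 s == (size D)%:Z)).
(** For lengths at least 2 this is the part of [epos] that deletion of the largest letter cannot
    treat, since [inv_blocks_insert_max] excludes that last letter; the exchange of n and n + 1
    treats it. *)
Definition esub D := wsum (size D) (fun s => (des s == D) && (last 0 s == (size D).-1%:Z)).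

Lemma topword_last_bound n s : topword n s -> - n%:Z <= last 0 s <= n%:Z /\ last 0 s != 0.
Proof. by move=> ts; have [sg _ _] := and3P ts; apply: (absz_le_signed sg); apply: topword_last ts. Qed.

Lemma nmax_split D :
  wsum (size D) (fun s => (des s == D) && (last 0 s != (size D)%:Z)) = epos D + eneg D.
Proof.
rewrite (wsum_split _ (fun s => 0 < last 0 s)); congr (_ + _); apply: eq_wsum => s ts;
  rewrite -andbA; congr (_ && _); have := topword_last_bound ts; clear; lia.
Qed.

Lemma eall_split D : eall D = emax D + epos D + eneg D.
Proof. by rewrite -addrA -nmax_split /eall (wsum_split _ (fun s => last 0 s == (size D)%:Z)). Qed.

Lemma emax_rcons_true D : emax (rcons D true) = 0.
Proof.
apply: wsum0 => s ts; apply/negP => /andP[/eqP ds /eqP ls].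
have e := unrconsK (topword_nil ts); move: ds; rewrite e des_rcons ls => /rcons_inj[_].
have [sg _ _] := and3P ts; have : last 0 (unrcons s) = 0 \/ last 0 (unrcons s) \in s.
  case eu: (unrcons s) => [|a u]; first by left.
  by right; rewrite e eu mem_rcons inE /= mem_last orbT.
case=> [->|/(absz_le_signed sg)[bl _]]; first by rewrite ltNge le0z_nat.
by rewrite size_rcons in bl ls *; move: bl; case/andP => _; rewrite ltNge => ->.
Qed.

Lemma emax_rcons_false D : emax (rcons D false) = 'X * eall D.
Proof.
rewrite /emax size_rcons -['X]expr1; set n := size D.
apply: (wsum_bij (h := unrcons) (h' := fun t => rcons t n.+1%:Z)) => [s ts|t tt].
  case/andP=> /eqP ds /eqP ls; have e := unrconsK (topword_nil ts); rewrite ls in e.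
  have [sg _ _] := and3P ts.
  have nu : n.+1%:Z \notin unrcons s.
    by have := signed_uniq sg; rewrite {1}e rcons_uniq => /andP[].
  have sgu : signed n (unrcons s).
    by rewrite -(signed_insert (size (unrcons s)) (unrcons s) (v := n.+1%:Z)) // -insert_rcons -e.
  have tu : topword n (unrcons s).
    by rewrite -(topword_insert_max sgu (leqnn _)) ?drop_size // -insert_rcons -e.
  split=> //; last by rewrite {1}e inv_blocks_rcons_max.
  by move: ds; rewrite {1}e des_rcons => /rcons_inj[->].
move=> /eqP dt; have [sg _ _] := and3P tt; split.
- by rewrite insert_rcons topword_insert_max // drop_size.
- rewrite last_rcons eqxx andbT des_rcons dt; apply/eqP; congr rcons.
  by apply/negbTE; rewrite -leNgt; apply/ltW/(signed_ltS sg)/topword_last/tt.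
- exact: unrcons_rcons.
Qed.

(** The bit [b] tells whether the shorter word ended in n: the exchange turns this n into n + 1, the
    top of a final descent. *)
Lemma esub_rcons D b : (0 < size D)%N ->
  esub (rcons D b) = wsum (size D) (fun t => (des t == D) && ((last 0 t == (size D)%:Z) == b)).
Proof.
rewrite /esub size_rcons /= -[RHS]mul1r -(expr0 'X); set n := size D => n0.
apply: (wsum_bij (h := fun s => map (swap_top n) (unrcons s))
                 (h' := fun t => rcons (map (swap_top n) t) n%:Z)) => [s ts|t tt].
  case/andP=> /eqP ds /eqP ls; have [t tt e] := append_submax_surj n0 ts ls.
  have [sg _ _] := and3P tt.
  have et : map (swap_top n) (unrcons s) = t.
    rewrite e unrcons_rcons -map_comp (eq_map (g := id)) ?map_id // => x /=.
    by rewrite swap_topK.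
  rewrite et addn0 -e; split=> //; last by rewrite e inv_blocks_append.
  by move: ds; rewrite e des_append // => /rcons_inj[-> ->]; rewrite !eqxx.
case/andP=> /eqP dt /eqP lb; have [sg _ _] := and3P tt; split.
- by rewrite topword_append.
- by rewrite des_append // dt lb last_rcons !eqxx.
rewrite unrcons_rcons -map_comp (eq_map (g := id)) ?map_id // => x /=.
by rewrite swap_topK.
Qed.

Lemma esub_rcons_true D : (0 < size D)%N -> esub (rcons D true) = emax D.
Proof. by move=> D0; rewrite esub_rcons //; apply: eq_wsum => s _; rewrite eqb_id. Qed.

Lemma esub_rcons_false D : (0 < size D)%N -> esub (rcons D false) = epos D + eneg D.
Proof.
by move=> D0; rewrite esub_rcons // -nmax_split; apply: eq_wsum => s _; rewrite eqbF_neg.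
Qed.

Lemma wsum_or n (a b c : pred (seq int)) : (forall s, a s -> b s -> false) ->
  wsum n (fun s => (a s || b s) && c s) = wsum n (fun s => a s && c s) + wsum n (fun s => b s && c s).
Proof.
move=> H; rewrite (wsum_split _ a); congr (_ + _); apply: eq_wsum => s _;
  by have := H s; case: (a s); case: (b s); rewrite ?andbT ?andbF //= => /(_ isT isT).
Qed.

Lemma des_min_first n (t : seq int) : signed n t -> increasing t ->
  des (- n.+1%:Z :: t) = true :: zeros n.
Proof.
move=> sg so; rewrite /des /= oppr_lt0 /=; congr (_ :: _); apply/eqP.
have -> : zeros n = zeros (size t) by rewrite (signed_size sg).
rewrite pairmap_increasing; case: t sg so => //= a t sg ->; rewrite andbT.
by have := signed_gtS sg (mem_head a t); clear; lia.
Qed.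

Lemma des_ids_min n : des (rcons (ids n) (- n.+1%:Z)) = rcons (zeros n) true.
Proof.
rewrite des_rcons; congr rcons.
  apply/eqP; rewrite /des.
  have -> : zeros n = zeros (size (ids n)) by rewrite size_map size_iota.
  rewrite pairmap_increasing /ids.
  have H k m : path (fun x y : int => x <= y) m%:Z [seq i%:Z | i <- iota m.+1 k].
    by elim: k m => //= k IH m; rewrite IH andbT lez_nat.
  exact: (H n 0%N).
have : 0 <= last 0 (ids n).
  by rewrite /ids; case: n => // n; rewrite /= last_map.
by clear; lia.
Qed.

(** The weight of the exceptional word 1, ..., n, -(n+1), whose inverse has a single block. *)
Definition corner (P : seq bool) j : {poly int} :=
  if (j == 0)%N && (P == zeros (size P)) then 'X else 0.

(** Apart from the [esub] words, n + 1 must occur: of the two forms in [structure_min_last], one has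
    its only descent in front and the other has a negative last letter. Its deletion keeps the
    number of blocks. *)
Lemma epos_rec P j : epos (P ++ false :: true :: zeros j) =
  esub (P ++ false :: true :: zeros j) + epos (P ++ false :: zeros j) + epos (P ++ true :: zeros j).
Proof.
set D := P ++ _; have sD : size D = (size P + j).+2%N by rewrite size_cat /= size_nseq !addnS.
have sE b : size (P ++ b :: zeros j) = (size P + j).+1%N by rewrite size_cat /= size_nseq !addnS.
rewrite /epos sD !sE (wsum_split _ (fun s => last 0 s == (size P + j).+1%N%:Z)) -addrA; congr (_ + _).
  rewrite /esub sD /=; apply: eq_wsum => s _; rewrite -andbA; congr (_ && _).
  by clear; lia.
rewrite -wsum_or => [|s /eqP-> /eqP /(congr1 (drop (size P)))]; last by rewrite !drop_size_cat.
rewrite -[RHS]mul1r -(expr0 'X).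
rewrite -(wsum_delete_max (a := fun x => 0 < x < (size P + j).+1%N%:Z)) -/D; last first.
  by move=> x; clear; split; lia.
apply: eq_wsum => s ts; rewrite -andbA; case: (boolP (des s == D)) => //= /eqP ds.
have -> : (0 < last 0 s < (size P + j).+2%N%:Z) && (last 0 s != (size P + j).+1%N%:Z) =
   (0 < last 0 s < (size P + j).+1%N%:Z) by clear; lia.
case: (boolP (_ < _ < _)) => //= bl; apply/esym; apply: contraT => Ns.
have ln : last 0 s != (size P + j).+1%N%:Z by case/andP: bl => _; apply: contraTneq => ->; rewrite ltxx.
case: (structure_min_last _ ts Ns ln) => // [[t [e so sg]]|e].
  have := des_min_first sg so; rewrite -e ds /D -cat_rcons -[RHS](cat0s) => /last_true_inj[].
  by case: (P).
by move: bl; rewrite e last_rcons oppr_gt0.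
Qed.

Lemma mem_ids n (x : int) : (x \in ids n) = (0 < x <= n%:Z).
Proof.
apply/mapP/idP => [[i]|]; first by rewrite mem_iota => ? ->; lia.
by exists (absz x); [rewrite mem_iota|]; lia.
Qed.

Lemma topword_ids_min n : topword n.+1 (rcons (ids n) (- n.+1%:Z)).
Proof.
have nN : - n.+1%:Z \notin ids n by rewrite mem_ids; lia.
apply/and3P; split.
- rewrite insert_rcons signed_insert ?abszN // /signed -map_comp.
  by rewrite (eq_map (g := id)) // map_id.
- apply/goodP => x y z xs ys zs b yx.
  have ex w : w \in rcons (ids n) (- n.+1%:Z) -> w = - n.+1%:Z \/ w \in ids n.
    by rewrite mem_rcons inE => /orP[/eqP|]; [left | right].
  have yN : y = - n.+1%:Z.
    case: (ex y ys) => // yi; move: b yx.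
    have [->|xi] := ex x xs.
      by rewrite insert_rcons before_insertl // leqNgt index_mem yi.
    rewrite insert_rcons before_insert // => b.
    have inc : increasing (ids n).
      rewrite sorted_map; apply: sub_sorted (iota_sorted 1 n) => i j /=; lia.
    by have := before_increasing inc xi yi b; move=> /lt_trans h /h; rewrite ltxx.
  have xi : x \in ids n by case: (ex x xs) yx => // ->; rewrite yN ltxx.
  split; last by case: (ex z zs) => [->|zi _]; [rewrite yN eqxx | move: xi zi; rewrite !mem_ids; lia].
  rewrite yN; case: (ex z zs) => [->|zi]; first by rewrite /before ltnn.
  by rewrite insert_rcons before_insertl // leqNgt index_mem zi.
by rewrite /has_neg has_rcons oppr_lt0.
Qed.

Lemma inv_blocks_ids_min n : (0 < n)%N -> inv_blocks (rcons (ids n) (- n.+1%:Z)) = 1%N.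
Proof.
move=> n0; rewrite /inv_blocks size_rcons size_map size_iota /=.
rewrite (eq_in_count (a2 := pred0)) ?count_pred0 // => i; rewrite mem_iota => /andP[i1 i2] /=.
have m1 : 1 \in rcons (ids n) (- n.+1%:Z) by rewrite mem_rcons inE mem_ids; lia.
have mN : - n.+1%:Z \in rcons (ids n) (- n.+1%:Z) by rewrite mem_rcons mem_head.
apply/negP => /cutP /(_ 1 (- n.+1%:Z) m1 mN); rewrite abszN /inv_lt oppr_gt0 /=.
by rewrite i1 -[in (_ < n.+1)%N]add1n i2 => /(_ isT).
Qed.

(** With a negative last letter each deletion of n + 1 costs one block, hence the factor q; a word
    without n + 1 must be the exceptional one. *)
Lemma eneg_rec P j : eneg (P ++ false :: true :: zeros j) =
  'X * (eneg (P ++ false :: zeros j) + eneg (P ++ true :: zeros j)) + corner P j.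
Proof.
set D := P ++ _; have sD : size D = (size P + j).+2%N by rewrite size_cat /= size_nseq !addnS.
have sE b : size (P ++ b :: zeros j) = (size P + j).+1%N by rewrite size_cat /= size_nseq !addnS.
set n := (size P + j).+1%N in sD sE *.
rewrite /eneg sD !sE (wsum_split _ (fun s => n.+1%:Z \in s)); congr (_ + _).
  rewrite -wsum_or => [|s /eqP-> /eqP /(congr1 (drop (size P)))]; last by rewrite !drop_size_cat.
  rewrite -{1}['X]expr1 -(wsum_delete_max (a := fun x => x < 0)) -/D -/n; last first.
    by move=> x x0; rewrite x0 !lt_eqF // (lt_le_trans x0).
  by apply: eq_wsum => s ts; rewrite -andbA.
have key s : topword n.+1 s ->
    (des s == D) && (last 0 s < 0) && (n.+1%:Z \notin s) =
    ((j == 0)%N && (P == zeros (size P))) && (s == rcons (ids n) (- n.+1%:Z)).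
  move=> ts; apply/idP/idP.
    case/andP=> /andP[/eqP ds ls] Ns.
    have ln : last 0 s != n%:Z by rewrite lt_eqF // (lt_le_trans ls).
    case: (structure_min_last _ ts Ns ln) => // [[t [e so sg]]|e].
      have := des_min_first sg so; rewrite -e ds /D -cat_rcons -[RHS](cat0s) => /last_true_inj[].
      by case: (P).
    have := des_ids_min n; rewrite -e ds /D -cat_rcons (_ : rcons _ true = zeros n ++ true :: zeros 0); last by rewrite cats1.
    move=> /last_true_inj[eP ej]; rewrite e eqxx ej eqxx /= andbT.
    by move: eP; rewrite /n ej addn0 -addn1 nseqD cats1 => /rcons_inj[->]; rewrite size_nseq.
  case/andP=> /andP[/eqP ej /eqP eP] /eqP->.
  rewrite last_rcons oppr_lt0 des_ids_min mem_rcons inE mem_ids.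
  have -> : rcons (zeros n) true = D.
    by rewrite /D /n ej eP size_nseq addn0 -addn1 nseqD -cats1 -catA.
  by rewrite eqxx lez_nat ltnn andbF orbF.
rewrite (eq_wsum key) /wsum /corner; case: ifP => c /=; last by rewrite big_pred0.
rewrite -big_filter (_ : filter _ _ = [:: rcons (ids n) (- n.+1%:Z)]).
  by rewrite big_seq1 inv_blocks_ids_min.
by apply: filter_pred1_uniq; rewrite ?uniq_tops // mem_tops topword_ids_min.
Qed.

Lemma good_increasing (s : seq int) : increasing s -> good s.
Proof.
move=> so; apply/goodP => x y z xs ys zs b.
by rewrite ltNge (ltW (before_increasing so xs ys b)).
Qed.

(** The inverse sends n + 1 to -1, so a comparison with it asks for a negative letter. At n this is
    decided by the last letter. At i < n a cut of [t] already forces it, by comparison with - n,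
    which occurs because n would end the increasing word. *)
Lemma inv_blocks_prepend_min n t : topword n t -> increasing t -> last 0 t != n%:Z ->
  inv_blocks (- n.+1%:Z :: t) = (inv_blocks t + (last 0%R t < 0)%R)%N.
Proof.
move=> tt so ln; have [sg _ _] := and3P tt; have n0 := topword_neq0 tt.
have ut := signed_uniq sg; have lt := topword_last tt.
have nN : - n.+1%:Z \notin t by apply/negP => /(signed_gtS sg); rewrite ltxx.
have e : - n.+1%:Z :: t = insert 0 (- n.+1%:Z) t by rewrite /insert take0 drop0.
have le_last (x : int) : x \in t -> x <= last 0 t.
  by move=> xt; apply: (@le_last_drop 0) => //; rewrite drop0.
have nt : - n%:Z \in t.
  have n1 : (0 < n <= n)%N by rewrite n0 leqnn.
  case: (signed_ex sg n1) => // /le_last h; case/negP: ln; rewrite eq_le h andbT.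
  by have [/andP[]] := absz_le_signed sg lt.
rewrite e /inv_blocks size_insert // (signed_size sg) /= -addnA; congr (1 + _)%N.
have -> : iota 1 n = iota 1 n.-1 ++ [:: n] by rewrite cats1 -[in LHS](prednK n0) iotaSr prednK.
have E (x : int) : x \in t -> inv_lt (insert 0 (- n.+1%:Z) t) x (- n.+1%:Z) = (x < 0).
  by move=> xt; rewrite /inv_lt oppr_gt0 /= before_insertl // andbT.
rewrite count_cat /= addn0; congr (_ + nat_of_bool _)%N; last first.
  rewrite cut_insert ?abszN // (cut_max sg) /=; apply/allP/idP => [/(_ _ lt)|l0 x xt].
    by rewrite E // (andP (signed_mem sg lt)).2.
  by rewrite E // (le_lt_trans (le_last x xt) l0) implybT.
apply: eq_in_count => i; rewrite mem_iota => /andP[_ ilt].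
have i_n : (i < n)%N by move: ilt; rewrite add1n (prednK n0).
rewrite cut_insert ?abszN //; last exact: ltnW.
case: (boolP (cut t i)) => //= /cutP C; apply/allP => x xt; apply/implyP => xi; rewrite E //.
by have := C x _ xt nt; rewrite abszN xi i_n => /(_ isT); rewrite /inv_lt oppr_gt0 /= => /andP[].
Qed.

(** With the only descent in front, n + 1 cannot be the top of a descent, and it is not last; so
    -(n+1) leads the word and is peeled off. *)
Lemma wsum_prepend_min n (a : pred int) k : (0 < n)%N ->
  (forall x, a x -> [/\ x != n%:Z, x != n.+1%:Z & nat_of_bool (x < 0) = k]) ->
  wsum n.+1 (fun s => (des s == true :: zeros n) && a (last 0 s)) =
  'X^k * wsum n (fun t => (des t == true :: zeros n.-1) && a (last 0 t)).
Proof.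
move=> n0 H.
apply: (wsum_bij (h := behead) (h' := cons (- n.+1%:Z))) => [s ts|t tt].
  case/andP=> /eqP ds al; have [ln lN lk] := H _ al.
  have Ns : n.+1%:Z \notin s.
    apply/negP => Ns; have [e pt so tt] := structure_max ts Ns lN.
    have [sg _ _] := and3P tt; have [Q [b [sQ dt ds']]] := des_insert_max sg pt so.
    move: ds; rewrite e ds' -cat_rcons -[RHS]cat0s => /last_true_inj[].
    by case: (Q).
  case: (structure_min_last n0 ts Ns ln) => [[t [e so sg]]|e]; last first.
    have := des_ids_min n; rewrite -e ds (_ : rcons _ true = zeros n ++ true :: zeros 0); last by rewrite cats1.
    rewrite -[LHS]cat0s.
    by case/last_true_inj; case: (n) n0.
  rewrite e in ds al ln lk *; rewrite /=.
  have tn : t != [::] by case: t sg n0 {e so ds al ln lk} => // /signed_size /= <-.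
  have lst x0 : last x0 t = last 0 t by case: (t) tn.
  rewrite /= lst in al ln lk; rewrite lst.
  have n1 : (0 < n <= n)%N by rewrite n0 leqnn.
  have ut := signed_uniq sg.
  have lt : last 0 t \in t by case: (t) tn => // b u _; rewrite /= mem_last.
  (* The letter n would be last in the increasing [t], which is excluded; so [t] keeps a negative
     letter and is again a top word. *)
  have nt : - n%:Z \in t.
    case: (signed_ex sg n1) => // nt; case/negP: ln; rewrite eq_le.
    have [/andP[_ ->] _] := absz_le_signed sg lt.
    by apply: (@le_last_drop 0); rewrite ?drop0.
  have hn : has_neg t by apply/hasP; exists (- n%:Z) => //; rewrite oppr_lt0.
  have tt : topword n t by rewrite /topword sg hn good_increasing.
  split=> //; last by rewrite inv_blocks_prepend_min // lk.
  rewrite al andbT /des; move: tn so nt; rewrite -(signed_size sg).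
  case: t {e ds sg al ln lk lst n1 ut lt hn tt} => // b u _ so nt /=.
  rewrite eqseq_cons pairmap_increasing [path _ _ _]so andbT eqb_id.
  have tr : transitive (fun x y : int => x <= y) by move=> c d f; apply: le_trans.
  move: nt; rewrite inE => /orP[/eqP<-|nt]; first by rewrite oppr_lt0.
  have /allP/(_ _ nt) := order_path_min tr so; move/le_lt_trans; apply.
  by rewrite oppr_lt0.
case/andP=> /eqP dt al; have [ln lN lk] := H _ al; have [sg _ hn] := and3P tt.
have so : increasing t.
  by rewrite -(drop0 t); apply: (@des_increasing_drop [::] true n.-1); rewrite dt.
have nN : - n.+1%:Z \notin t by apply/negP => /(signed_gtS sg); rewrite ltxx.
have so' : increasing (- n.+1%:Z :: t).
  rewrite /=; case: (t) so sg => //= b u -> sg; rewrite andbT.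
  by have := signed_gtS sg (mem_head b u); clear; lia.
split=> //.
  apply/and3P; split; rewrite ?good_increasing //.
  have -> : - n.+1%:Z :: t = insert 0 (- n.+1%:Z) t by rewrite /insert take0 drop0.
  by rewrite signed_insert ?abszN.
rewrite des_min_first // eqxx /=; have := topword_nil tt; case: (t) al => //.
Qed.

Lemma zeros_rcons n : zeros n.+1 = rcons (zeros n) false.
Proof. by rewrite -addn1 nseqD cats1. Qed.

Lemma cat_zeros_rcons (P : seq bool) b j : P ++ b :: zeros j.+1 = rcons (P ++ b :: zeros j) false.
Proof. by rewrite zeros_rcons rcons_cat. Qed.

(** The only such word is -(m+1), ..., -1; its inverse is increasing, so every position is a cut. *)
Lemma eneg_first m : eneg (true :: zeros m) = 'X^(m.+1).
Proof.
elim: m => [|m IH]; last first.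
  rewrite /eneg /= size_nseq (wsum_prepend_min (a := fun x => x < 0) (k := 1)) //.
    by rewrite expr1 [in RHS]exprS -IH /eneg /= size_nseq.
  by move=> x x0; rewrite x0 !lt_eqF // (lt_le_trans x0).
rewrite /eneg /wsum -big_filter (_ : filter _ _ = [:: [:: - 1%:Z]]).
  by rewrite big_seq1 /inv_blocks.
(* For length 1 the exceptional word is the single letter -1. *)
have t1 := topword_ids_min 0; rewrite -(@filter_pred1_uniq _ (tops 1)) ?uniq_tops ?mem_tops //.
apply: eq_in_filter => s; rewrite mem_tops => ts; have [sg _ _] := and3P ts.
have := signed_size sg; case: s sg {ts} => // a [|//] sg _ /=.
have := signed_mem sg (mem_head a [::]); rewrite /des /= eqseq_cons andbT eqb_id andbb.
by rewrite [RHS]eqseq_cons andbT; clear; lia.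
Qed.

Lemma epos_first0 : epos [:: true] = 0.
Proof.
apply: wsum0 => s ts; apply/negP => /andP[_] /=.
by have := topword_last_bound ts; clear; lia.
Qed.

Lemma between_split (l : int) m : (0 < l < m.+2%:Z) && (l != m.+1%:Z) = (0 < l < m.+1%:Z).
Proof. lia. Qed.

Lemma epos_first m : epos (true :: zeros m.+1) = esub (true :: zeros m.+1) + epos (true :: zeros m).
Proof.
rewrite /epos /= !size_nseq (wsum_split _ (fun s => last 0 s == m.+1%:Z)); congr (_ + _).
  rewrite /esub /= size_nseq /=; apply: eq_wsum => s _; rewrite -andbA; congr (_ && _).
  by clear; lia.
rewrite -[RHS]mul1r -(expr0 'X) -(wsum_prepend_min (n := m.+1) (a := fun x => 0 < x < m.+1%:Z)) //.
  by apply: eq_wsum => s _; rewrite -andbA; congr (_ && _); apply: between_split.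
by move=> x; clear; split; lia.
Qed.

Lemma esub_first m : esub (true :: zeros m.+1) = epos (true :: zeros m) + eneg (true :: zeros m).
Proof. by rewrite zeros_rcons -rcons_cons esub_rcons_false. Qed.

Lemma emax_first m : emax (true :: zeros m.+1) = 'X * eall (true :: zeros m).
Proof. by rewrite zeros_rcons -rcons_cons emax_rcons_false. Qed.

Lemma des_zeros_neg n s : des s = zeros n -> ~~ has_neg s.
Proof.
move=> e; have := congr1 size e; rewrite size_des size_nseq => sz.
apply/hasPn => x xs; rewrite -leNgt.
have tr : transitive (fun x y : int => x <= y) by move=> c d f; apply: le_trans.
suff /(order_path_min tr)/allP : path (fun x y : int => x <= y) 0 s by apply.
by rewrite -pairmap_increasing sz; apply/eqP.
Qed.

Lemma topword_des_zeros n m s : topword n s -> (des s == zeros m) = false.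
Proof. by case/and3P=> _ _ hn; apply/negP => /eqP/des_zeros_neg; rewrite hn. Qed.

Lemma eall_zeros n : eall (zeros n) = 0.
Proof. by apply: wsum0 => s ts; rewrite (topword_des_zeros _ ts). Qed.

Lemma eneg_zeros n : eneg (zeros n) = 0.
Proof. by apply: wsum0 => s ts; rewrite (topword_des_zeros _ ts). Qed.

Lemma index_mid (u v : seq int) (x : int) : uniq (u ++ x :: v) -> index x (u ++ x :: v) = size u.
Proof.
rewrite cat_uniq => /and3P[_ /hasPn/(_ x (mem_head _ _)) /= xu _].
by rewrite index_cat (negbTE xu) /= eqxx addn0.
Qed.

(** Two adjacent descents form a 321 pattern or, at the front, an inversion whose left letter is
    negative. *)
Lemma topword_des_double n P Q s : topword n s -> (des s == P ++ true :: true :: Q) = false.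
Proof.
move=> ts; have [sg gs _] := and3P ts; have us := signed_uniq sg.
apply/eqP => e; have sz := congr1 size e; rewrite size_des size_cat /= in sz.
have Ps : (size P <= size s)%N by rewrite sz leq_addr.
move: e us gs; rewrite -(cat_take_drop (size P) s) des_cat => /eqP.
rewrite eqseq_cat ?size_des ?size_takel // => /andP[_].
have : size (drop (size P) s) = (size Q).+2 by rewrite size_drop sz addKn.
set u := take _ _; case: (drop _ _) => [|y [|z v]] //= _ /eqP[yu zy _] us /goodP G.
have yz : before (u ++ [:: y, z & v]) y z.
  rewrite /before index_mid // -cat_rcons index_mid ?size_rcons //.
  by rewrite cat_rcons.
have mem (x : int) : (x \in u) || (x == y) || (x == z) -> x \in u ++ [:: y, z & v].
  by rewrite mem_cat !inE -orbA => /or3P[] ->; rewrite ?orbT.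
case/lastP: u us yz G mem yu => [|u x] us yz G mem yu.
  have := G y z y; rewrite !mem ?eqxx ?orbT // => /(_ isT isT isT yz zy) [_].
  rewrite (before_neq yz) => /(_ isT); move: yu => /=; clear; lia.
have xy : before (rcons u x ++ [:: y, z & v]) x y.
  by rewrite /before index_mid // size_rcons cat_rcons index_mid // -cat_rcons.
rewrite last_rcons in yu.
have := G x y z; rewrite !mem ?mem_rcons ?mem_head ?eqxx ?orbT // => /(_ isT isT isT xy yu) [/(_ yz)].
by move=> /lt_trans /(_ zy); rewrite ltxx.
Qed.

Lemma eall_double P Q : eall (P ++ true :: true :: Q) = 0.
Proof. by apply: wsum0 => s ts; rewrite (topword_des_double _ _ ts). Qed.

Lemma eneg_double P Q : eneg (P ++ true :: true :: Q) = 0.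
Proof. by apply: wsum0 => s ts; rewrite (topword_des_double _ _ ts). Qed.

Lemma emax_cat_true P : emax (P ++ [:: true]) = 0.
Proof. by rewrite cats1 emax_rcons_true. Qed.

Lemma epos_eall D : epos D = eall D - emax D - eneg D.
Proof. by rewrite eall_split; ring. Qed.

Lemma eall_first0 : eall [:: true] = 'X.
Proof. by rewrite eall_split epos_first0 (emax_cat_true [::]) (eneg_first 0) !add0r expr1. Qed.

(** The descent set [P ++ true :: zeros j] without its last step; for j = 0 the last step is a
    descent, and no maximal letter can stand there. *)
Definition eall_prev P j := if j is j'.+1 then eall (P ++ true :: zeros j') else 0.

Lemma emax_prev P j : emax (P ++ true :: zeros j) = 'X * eall_prev P j.
Proof.
case: j => [|j]; first by rewrite emax_cat_true mulr0.
by rewrite cat_zeros_rcons emax_rcons_false.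
Qed.

(** In this form a_m - 2 a_(m-1) obeys a recursion of first order, solved in [eall_first_defect]. *)
Lemma eall_first_rec m (a := fun m => eall (true :: zeros m)) :
  a m.+1 - 2 * a m = 'X * (a m - 2 * eall_prev [::] m) + ('X - 1) * 'X^(m.+1).
Proof.
rewrite /a eall_split emax_first epos_first esub_first (epos_eall (true :: zeros m)).
rewrite (emax_prev [::] m) (eneg_first m.+1) (eneg_first m) !exprS; ring.
Qed.

(** Measures the failure of the rule e(P01 0^j) = e(P01 0^(j-1)) + e(P0 0^j) + e(P1 0^j), which
    would hold exactly for sums of a function obeying the plain Pascal rule. *)
Definition edefect P j := eall (P ++ false :: true :: zeros j) - eall_prev (rcons P false) j
  - (eall (P ++ false :: zeros j) + eall (P ++ true :: zeros j)).

Definition esum_neg P j := eneg (P ++ false :: zeros j) + eneg (P ++ true :: zeros j).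

Lemma edefect0 P : edefect P 0 = ('X - 1) * esum_neg P 0 + corner P 0.
Proof.
rewrite /edefect /esum_neg eall_split epos_rec eneg_rec /=.
have -> : P ++ [:: false; true] = rcons (P ++ [:: false]) true by rewrite -cats1 -catA.
rewrite esub_rcons_true ?size_cat ?addn1 // emax_rcons_true !epos_eall emax_cat_true; ring.
Qed.

(** Words ending in n + 1 or n reduce to the descent set shorter by one step and those remaining to
    deletions; the leftovers combine into q times the previous defect, with the negative words as
    source. *)
Lemma edefectS P j : edefect P j.+1 = 'X * edefect P j + ('X - 1) * esum_neg P j.+1.
Proof.
rewrite /edefect /esum_neg eall_split epos_rec eneg_rec /corner /=.
have e : P ++ [:: false, true & zeros j.+1] = rcons (P ++ [:: false, true & zeros j]) false.
  by rewrite -!(cat_rcons false P) cat_zeros_rcons.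
rewrite e emax_rcons_false esub_rcons_false; last by rewrite size_cat /= addnS.
rewrite -[in epos (P ++ [:: false, true & zeros j])](cat_rcons false P) !epos_eall emax_prev.
rewrite !(cat_zeros_rcons P _ j) !emax_rcons_false cat_rcons.
case: j e => [|j] _ /=; rewrite ?cat_rcons; ring.
Qed.

(** * Solution of the recursions *)

(** The polynomials b_(n,k) of the theorem, as [sum_bcoef] shows. The test on [k] keeps the extra
    term from spreading beyond the diagonal. *)
Fixpoint pascal (n k : nat) : {poly int} :=
  if n is n'.+1 then
    if (k <= n)%N then
      pascal n' k + (if k is k'.+1 then pascal n' k' else 0) + ('X^n - 'X^n')
    else 0
  else (k == 0%N)%:R.

Lemma pascal_gt n k : (n < k)%N -> pascal n k = 0.
Proof. by case: n => [|n] /=; [case: k | rewrite ltnNge => /negbTE->]. Qed.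

Lemma pascal_0 n : pascal n 0 = 'X^n.
Proof. by elim: n => [|n IH] /=; rewrite ?expr0 // IH; ring. Qed.

Lemma pascalS n k : (k <= n)%N ->
  pascal n.+1 k.+1 = pascal n k.+1 + pascal n k + ('X^(n.+1) - 'X^n).
Proof. by rewrite -ltnS /= => ->. Qed.

Definition fnl : Type := (nat -> {poly int}) -> {poly int}.

(** One letter is appended: an ascent puts 1 after 0, any other step puts 0 after anything or 1
    after 1; [g \o succn] counts the new one. The empty word counts as ending in 0, which makes a
    leading 1 an initial ascent. *)
Definition end_step (fg : fnl * fnl) (b : bool) : fnl * fnl :=
  if b then (fun _ => 0, fun g => fg.1 (g \o succn))
  else (fun g => fg.1 g + fg.2 g, fun g => fg.2 (g \o succn)).

(* [ends D] sums [g] of the number of ones over the binary words whose ascents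
   (including an initial one) are marked by [D]: words ending in 0, then in 1. *)
Definition ends (D : seq bool) : fnl * fnl :=
  foldl end_step (fun g => g 0%N, fun _ => 0) D.

Definition end0 D g := (ends D).1 g.
Definition end1 D g := (ends D).2 g.
Definition ends_total D g := end0 D g + end1 D g.

Lemma end0_false D g : end0 (rcons D false) g = ends_total D g.
Proof. by rewrite /end0 /ends foldl_rcons. Qed.
Lemma end1_false D g : end1 (rcons D false) g = end1 D (g \o succn).
Proof. by rewrite /end1 /ends foldl_rcons. Qed.
Lemma end0_true D g : end0 (rcons D true) g = 0.
Proof. by rewrite /end0 /ends foldl_rcons. Qed.
Lemma end1_true D g : end1 (rcons D true) g = end0 D (g \o succn).
Proof. by rewrite /end1 /ends foldl_rcons. Qed.

Definition endsE := (end0_false, end1_false, end0_true, end1_true).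

Lemma ends_ext D g h : (forall k, (k <= size D)%N -> g k = h k) ->
  end0 D g = end0 D h /\ end1 D g = end1 D h.
Proof.
elim/last_ind: D g h => [|D b IH] g h H; first by rewrite /end0 /end1 /= H.
rewrite size_rcons in H.
have [e0 e1] : end0 D g = end0 D h /\ end1 D g = end1 D h by apply: IH => k /leqW; apply: H.
have [s0 s1] : end0 D (g \o succn) = end0 D (h \o succn) /\ end1 D (g \o succn) = end1 D (h \o succn).
  by apply: IH => k kD /=; apply: H.
by case: b; rewrite !endsE /ends_total ?e0 ?e1 ?s0 ?s1.
Qed.

Lemma total_ext D g h : (forall k, (k <= size D)%N -> g k = h k) -> ends_total D g = ends_total D h.
Proof. by move=> H; have [e0 e1] := ends_ext H; rewrite /ends_total e0 e1. Qed.

Lemma end1_ext D g h : g =1 h -> end1 D g = end1 D h.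
Proof. by move=> H; have [] := @ends_ext D g h (fun k _ => H k). Qed.

Lemma ends_linear D g h c :
  end0 D (fun k => g k + c * h k) = end0 D g + c * end0 D h /\
  end1 D (fun k => g k + c * h k) = end1 D g + c * end1 D h.
Proof.
elim/last_ind: D g h => [|D b IH] g h; first by rewrite /end0 /end1 /= mulr0 addr0.
have [e0 e1] := IH g h; have [s0 s1] := IH (g \o succn) (h \o succn).
rewrite /comp in s0 s1.
by case: b; rewrite !endsE /ends_total /comp ?e0 ?e1 ?s0 ?s1; split; ring.
Qed.

Lemma total_linear D g h c :
  ends_total D (fun k => g k + c * h k) = ends_total D g + c * ends_total D h.
Proof. by have [e0 e1] := ends_linear D g h c; rewrite /ends_total e0 e1; ring. Qed.

Definition shift i (g : nat -> {poly int}) k := g (k + i)%N.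

Lemma end1_zeros D j g : end1 (D ++ zeros j) g = end1 D (shift j g).
Proof.
elim: j g => [|j IH] g; first by rewrite cats0; apply: end1_ext => k; rewrite /shift addn0.
rewrite zeros_rcons -rcons_cat end1_false IH; apply: end1_ext => k.
by rewrite /shift /= addnS.
Qed.

Lemma end0_zeros D j g : end0 (D ++ zeros j) g = end0 D g + \sum_(i < j) end1 D (shift i g).
Proof.
elim: j g => [|j IH] g; first by rewrite cats0 big_ord0 addr0.
by rewrite zeros_rcons -rcons_cat end0_false big_ord_recr /= addrA -IH -end1_zeros.
Qed.

Lemma total_zeros D j g : ends_total (D ++ zeros j) g = end0 D g + \sum_(i < j.+1) end1 D (shift i g).
Proof. by rewrite /ends_total end0_zeros end1_zeros big_ord_recr /= addrA. Qed.

(** A word over [P] is continued by 0 1^(i+1) 0^(j-i) with 0 <= i <= j. *)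
Lemma total_corner P j g :
  ends_total (P ++ false :: true :: zeros j) g = \sum_(i < j.+1) ends_total P (shift i.+1 g).
Proof.
rewrite -cat_rcons -cat_rcons total_zeros end0_true add0r; apply: eq_bigr => i _.
rewrite end1_true end0_false; apply: total_ext => k _.
by rewrite /shift /= addSnnS.
Qed.

(** A word over [P] is continued by 1^i 0^(j+1-i) with 0 <= i <= j + 1. Whether the first of these
    steps is an ascent depends on the letter before it, so the two sets together allow every [i]
    after every prefix. *)
Lemma total_pair P j g :
  ends_total (P ++ false :: zeros j) g + ends_total (P ++ true :: zeros j) g =
  \sum_(i < j.+2) ends_total P (shift i g).
Proof.
rewrite -!cat_rcons !total_zeros end0_true end0_false add0r -addrA -big_split /=.
rewrite [RHS]big_ord_recl; congr (_ + _).
  by apply: total_ext => k _; rewrite /shift addn0.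
apply: eq_bigr => i _; rewrite end1_true end1_false addrC.
by apply: total_ext => k _; rewrite /shift /= addSnnS.
Qed.

(** A prefix has at most [size P] ones, so the bound keeps every argument in the range of
    [pascalS]. *)
Lemma total_pascal P i n : (size P + i <= n)%N ->
  ends_total P (shift i.+1 (pascal n.+1)) =
  ends_total P (shift i.+1 (pascal n)) + ends_total P (shift i (pascal n)) +
  ('X^(n.+1) - 'X^n) * ends_total P (fun _ => 1).
Proof.
move=> Pn.
rewrite -[ends_total P (shift i (pascal n))]mul1r -total_linear -total_linear.
by apply: total_ext => k kP; rewrite /shift addnS pascalS ?mul1r ?mulr1 //; lia.
Qed.

Definition geom n : {poly int} := \sum_(1 <= i < n) 'X^i.

Lemma geomS n : ('X - 1) * geom n.+1 = 'X^(n.+1) - 'X.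
Proof.
rewrite /geom; elim: n => [|n IH]; first by rewrite big_geq // mulr0 expr1 subrr.
by rewrite big_nat_recr //= mulrDr IH [in RHS]exprS; ring.
Qed.

(** The shape just before the last [true] decides which recursion applies. *)
Lemma bits_cases (D : seq bool) :
  [\/ exists n, D = zeros n, exists m, D = true :: zeros m,
      exists P j, D = P ++ false :: true :: zeros j |
      exists P j, D = P ++ true :: true :: zeros j].
Proof.
have [[n ->]|[Q [j ->]]] : (exists n, D = zeros n) \/ exists Q j, D = Q ++ true :: zeros j.
- elim/last_ind: D => [|D [|] IH]; first by left; exists 0%N.
    by right; exists D, 0%N; rewrite cats1.
  case: IH => [[n ->]|[Q [j ->]]]; first by left; exists n.+1; rewrite zeros_rcons.
  by right; exists Q, j.+1; rewrite cat_zeros_rcons.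
- by constructor 1; exists n.
case/lastP: Q => [|P [|]]; first by constructor 2; exists j.
  by constructor 4; exists P, j; rewrite cat_rcons.
by constructor 3; exists P, j; rewrite cat_rcons.
Qed.

Lemma end1_const_zeros D j c : end1 (D ++ zeros j) (fun _ => c) = end1 D (fun _ => c).
Proof. by rewrite end1_zeros. Qed.

Lemma end1_pair P j c :
  end1 (P ++ false :: zeros j) (fun _ => c) + end1 (P ++ true :: zeros j) (fun _ => c)
  = ends_total P (fun _ => c).
Proof. by rewrite -!cat_rcons !end1_const_zeros !endsE addrC. Qed.

Definition single_last D := D == rcons (zeros (size D).-1) true.

Lemma single_last_cat Q j : single_last (Q ++ true :: zeros j) = (j == 0)%N && (Q == zeros (size Q)).
Proof.
rewrite /single_last size_cat /= size_nseq addnS /=; apply/eqP/andP.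
  rewrite -cats1 => /(@last_true_inj _ _ j 0)[eQ ej].
  by move: eQ; rewrite ej addn0 => {1}->.
by case=> /eqP -> /eqP ->; rewrite size_nseq addn0 cats1.
Qed.

Lemma single_last_zeros n : single_last (zeros n) = false.
Proof.
apply/negbTE/eqP => /(congr1 (has id)); rewrite has_rcons /=.
by rewrite has_nseq andbF.
Qed.

Lemma single_last_false P j : single_last (P ++ false :: zeros j) = false.
Proof.
rewrite /single_last; apply/negbTE/eqP => /(congr1 (last true)); rewrite last_rcons last_cat /=.
by case: j => // j; rewrite zeros_rcons last_rcons.
Qed.

Lemma rcons_zeros (P : seq bool) b : (rcons P b == zeros (size P).+1) = (P == zeros (size P)) && ~~ b.
Proof. by rewrite zeros_rcons eqseq_rcons eqbF_neg. Qed.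

Lemma cat_zerosE (P : seq bool) b j :
  (P ++ b :: zeros j == zeros (size (P ++ b :: zeros j))) = (P == zeros (size P)) && ~~ b.
Proof.
elim: P => [|a P IH] /=; rewrite ?size_nseq !eqseq_cons ?eqxx ?andbT ?eqbF_neg //.
by rewrite IH andbA.
Qed.

(** Each deletion multiplies by q, so up to the exceptional words only a count of binary words
    ending in 1 remains. The geometric sum collects the [corner] terms along 0^m 1, see
    [geom_rec]. *)
Definition eneg_formula D : {poly int} :=
  'X^(size D) * end1 D (fun _ => 1) + (if single_last D then geom (size D) else 0).

Lemma geom_rec n : 'X * geom n.+1 + 'X = geom n.+2.
Proof.
rewrite /geom [RHS]big_ltn // expr1 addrC; congr (_ + _).
by rewrite big_add1 /= big_distrr /=; apply: eq_bigr => i _; rewrite exprS.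
Qed.

Lemma enegE D : eneg D = eneg_formula D.
Proof.
have [m] := ubnP (size D); elim: m D => // m IH D; rewrite ltnS => Dm.
case: (bits_cases D) Dm => [[n ->]|[n ->]|[P [j ->]]|[P [j ->]]] Dm.
- rewrite eneg_zeros /eneg_formula single_last_zeros -[zeros n]cat0s end1_const_zeros.
  by rewrite /end1 /= mulr0 addr0.
- rewrite eneg_first /eneg_formula -[true :: _]cat0s single_last_cat eqxx andbT.
  rewrite -cat_rcons end1_const_zeros end1_true /end0 /= size_nseq mulr1.
  by case: (n) => [|k] /=; rewrite /geom ?big_geq ?addr0.
- rewrite eneg_rec !IH; try by move: Dm; rewrite !size_cat /= !addnS.
  have sE b : size (P ++ b :: zeros j) = (size P + j).+1%N by rewrite size_cat /= size_nseq !addnS.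
  have sD : size (P ++ false :: true :: zeros j) = (size P + j).+2%N.
    by rewrite size_cat /= size_nseq !addnS.
  have sc : single_last (P ++ false :: true :: zeros j) = (j == 0)%N && (P == zeros (size P)).
    by rewrite -cat_rcons single_last_cat size_rcons rcons_zeros andbT.
  have eD : end1 (P ++ false :: true :: zeros j) (fun _ => 1) = ends_total P (fun _ => 1).
    by rewrite -cat_rcons -cat_rcons end1_const_zeros end1_true end0_false.
  rewrite /eneg_formula !sE sD single_last_false sc eD single_last_cat -(end1_pair P j 1) /corner [in RHS]exprS.
  by case: ifP => _; rewrite -?geom_rec; ring.
rewrite eneg_double /eneg_formula -[P ++ _](cat_rcons true) single_last_cat -cat_rcons.
rewrite end1_const_zeros end1_true end0_true size_rcons rcons_zeros andbF andbF.
by rewrite mulr0 addr0.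
Qed.

Lemma esum_negE P j : esum_neg P j = 'X^((size P + j).+1) * ends_total P (fun _ => 1)
  + (if (j == 0)%N && (P == zeros (size P)) then geom (size P).+1 else 0).
Proof.
rewrite /esum_neg !enegE /eneg_formula -(end1_pair P j 1) single_last_cat.
have sE b : size (P ++ b :: zeros j) = (size P + j).+1%N by rewrite size_cat /= size_nseq !addnS.
rewrite !sE single_last_false; case: (j =P 0%N) => [->|_] /=; rewrite ?addn0; [case: ifP => _|]; ring.
Qed.

(** Each step in j adds one more copy of the same multiple of the count. For j = 0 the geometric sum
    times q - 1 telescopes and leaves, together with [corner], a single power of q. *)
Lemma edefectE P j : edefect P j =
  j.+1%:R * ('X^((size P + j).+2) - 'X^((size P + j).+1)) * ends_total P (fun _ => 1)
  + (if P == zeros (size P) then 'X^((size P + j).+1) else 0).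
Proof.
elim: j => [|j IH].
  rewrite edefect0 esum_negE /corner /= addn0 [in RHS]exprS.
  case: ifP => _; last by ring.
  by rewrite mulrDr geomS; ring.
by rewrite edefectS IH esum_negE /= !addnS !exprS -[j.+2%:R]natr1; case: ifP => _; ring.
Qed.

(** The subtracted term belongs to the word 0^n, the only one with an empty ascent set: it removes k
    = 0, where b_(n,0) = q^n. *)
Definition eall_formula D : {poly int} :=
  ends_total D (pascal (size D)) - (if D == zeros (size D) then 'X^(size D) else 0).

Lemma eall_first_defect m :
  eall (true :: zeros m) - 2 * eall_prev [::] m = 'X^(m.+1) + m%:R * ('X^(m.+1) - 'X^m).
Proof.
elim: m => [|m IH]; first by rewrite eall_first0 expr1 /=; ring.
by rewrite eall_first_rec IH /= !exprS -natr1; ring.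
Qed.

Lemma total_first m g : ends_total (true :: zeros m) g = \sum_(i < m.+1) g i.+1.
Proof.
rewrite -[true :: _]cat0s -cat_rcons total_zeros end0_true add0r.
by apply: eq_bigr => i _; rewrite end1_true /end0 /= /shift add1n.
Qed.

Lemma shift_sum_identity (f : nat -> {poly int}) c w z j :
  j.+1%:R * c * w + z + \sum_(i < j) f i.+1 + (\sum_(i < j.+2) f i - z) =
  \sum_(i < j.+1) (f i.+1 + f i + c * w).
Proof.
rewrite !big_split /= sumr_const card_ord [in LHS]big_ord_recr /= [\sum_(i < j.+1) f i.+1]big_ord_recr /=.
by move: (\sum_(i < j) _) (\sum_(i < j.+1) _) => S T; ring.
Qed.

Lemma eallE D : eall D = eall_formula D.
Proof.
have [m] := ubnP (size D); elim: m D => // m IH D; rewrite ltnS => Dm.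
case: (bits_cases D) Dm => [[n ->]|[n ->]|[P [j ->]]|[P [j ->]]] Dm.
- rewrite eall_zeros /eall_formula size_nseq eqxx -[zeros n]cat0s total_zeros big1 // addr0.
  by rewrite /end0 /= pascal_0 subrr.
- have -> : eall (true :: zeros n) = 2 * eall_prev [::] n + ('X^(n.+1) + n%:R * ('X^(n.+1) - 'X^n)).
    by rewrite -eall_first_defect; ring.
  have -> : eall_prev [::] n = \sum_(i < n) pascal n i.+1.
    case: n Dm => [|n] Dm /=; first by rewrite big_ord0.
    rewrite IH; last by move: Dm; rewrite /= !size_nseq.
    by rewrite /eall_formula total_first /= size_nseq subr0.
  rewrite /eall_formula total_first [size _]/= size_nseq [_ == _]/= subr0.
  rewrite (eq_bigr (fun i : 'I_n.+1 => pascal n i.+1 + pascal n i + ('X^(n.+1) - 'X^n))); last first.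
    by move=> i _; rewrite pascalS // -ltnS ltn_ord.
  rewrite !big_split sumr_const card_ord /= big_ord_recr /= pascal_gt //.
  rewrite [X in _ = _ + X + _]big_ord_recl pascal_0 sumr_const card_ord.
  have -> : \sum_(i < n) pascal n (lift ord0 i) = \sum_(i < n) pascal n i.+1 by apply: eq_bigr => i _; rewrite lift0.
  by move: (\sum_(i < n) _) ('X^(n.+1)) ('X^n) => S x y; ring.
- have sE b : size (P ++ b :: zeros j) = (size P + j).+1%N by rewrite size_cat /= size_nseq !addnS.
  have sD : size (P ++ false :: true :: zeros j) = (size P + j).+2%N.
    by rewrite size_cat /= size_nseq !addnS.
  have zD : (P ++ false :: true :: zeros j == zeros (size P + j).+2) = false.
    by rewrite -sD -cat_rcons cat_zerosE andbF.
  rewrite sD in Dm.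
  have -> : eall (P ++ false :: true :: zeros j) =
     edefect P j + eall_prev (rcons P false) j
      + (eall (P ++ false :: zeros j) + eall (P ++ true :: zeros j)) by rewrite /edefect; ring.
  have -> : eall_prev (rcons P false) j = \sum_(i < j) ends_total P (shift i.+1 (pascal (size P + j).+1)).
    case: j Dm {sE sD zD} => [|j] Dm /=; first by rewrite big_ord0.
    have sz : size (rcons P false ++ true :: zeros j) = (size P + j.+1).+1%N.
      by rewrite size_cat size_rcons /= size_nseq; lia.
    rewrite IH; last by rewrite sz.
    by rewrite /eall_formula cat_zerosE andbF subr0 sz cat_rcons total_corner.
  rewrite !IH ?sE // /eall_formula !cat_zerosE !sE sD zD andbF andbT !subr0.
  rewrite edefectE total_corner.
  have e (x y z : {poly int}) : x - y + z = (x + z) - y by ring.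
  rewrite e total_pair {e}; set g := pascal (size P + j).+1.
  (* The power of q left in [edefectE] cancels the term subtracted in the formula for
     [P ++ false :: zeros j]. *)
  apply: (etrans (shift_sum_identity (fun i => ends_total P (shift i g)) _ _ _ _)).
  apply: eq_bigr => i _; apply/esym/total_pascal.
  by rewrite -addnS leq_add2l ltnW.
have sz : size (P ++ true :: true :: zeros j) = (size P + j).+2%N.
  by rewrite size_cat /= size_nseq !addnS.
rewrite eall_double /eall_formula -[P ++ _](cat_rcons true) cat_zerosE andbF subr0 -cat_rcons.
rewrite total_zeros end0_true add0r big1 // => i _.
by rewrite end1_true end0_true.
Qed.

(** * Products of complete homogeneous functions *)

Fixpoint bits n : seq (seq bool) :=
  if n is n'.+1 then [seq rcons D b | D <- bits n', b <- [:: false; true]] else [:: [::]].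

Lemma bitsS n : bits n.+1 = [seq rcons D b | D <- bits n, b <- [:: false; true]].
Proof. by []. Qed.

Lemma size_bits n D : D \in bits n -> size D = n.
Proof.
elim: n D => [|n IH] D; first by rewrite inE => /eqP->.
by rewrite bitsS => /(allpairsP (f := @rcons bool)) [[E b] /= [/IH <- _ ->]]; rewrite size_rcons.
Qed.

Lemma mem_bits D : D \in bits (size D).
Proof.
elim/last_ind: D => // D b IH; rewrite size_rcons bitsS; apply/(allpairsP (f := @rcons bool)); exists (D, b).
by split=> //=; case: b.
Qed.

Lemma uniq_bits n : uniq (bits n).
Proof.
elim: n => // n IH; rewrite bitsS; apply: allpairs_uniq => // -[D b] [E c] _ _ /= /rcons_inj[-> ->] //.
Qed.

Lemma sum_bitsS (V : nmodType) n (F : seq bool -> V) :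
  \sum_(D <- bits n.+1) F D = \sum_(D <- bits n) (F (rcons D false) + F (rcons D true)).
Proof.
rewrite bitsS big_allpairs_dep; apply: eq_bigr => D _.
by rewrite big_cons big_seq1.
Qed.

(** * Monomial sums over sequences of indices *)

Section Quasisymmetric.
Variable N : nat.
Notation R := {poly int}.
Notation MP := {mpoly R[N]}.

(** Indices are plain numbers, with value 0 out of range, so that sequences can be extended and
    truncated freely. *)
Definition var (v : nat) : MP := if insub v is Some i then 'X_i else 0.

Fixpoint words n : seq (seq nat) :=
  if n is n'.+1 then [seq rcons s v | s <- words n', v <- iota 0 N] else [:: [::]].

Lemma mem_words n s : (s \in words n) = (size s == n) && all (fun v => v < N)%N s.
Proof.
elim: n s => [|n IH] s; first by rewrite inE; case: s.
apply/(allpairsP (f := @rcons nat))/idP => [[[t v] /= [tw vN ->]]|].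
  move: tw vN; rewrite IH mem_iota size_rcons eqSS all_rcons => /andP[-> ->] /=.
  by rewrite add0n => ->.
case/lastP: s => // s v; rewrite size_rcons eqSS all_rcons => /and3P[sn vN sN].
by exists (s, v); rewrite /= IH sn sN mem_iota.
Qed.

Lemma uniq_words n : uniq (words n).
Proof.
elim: n => // n IH /=; apply: allpairs_uniq; rewrite ?iota_uniq // => -[D b] [E c] _ _ /=.
by move=> /rcons_inj[-> ->].
Qed.

Definition monomial (s : seq nat) : MP := \prod_(v <- s) var v.

Definition values n (c : {ffun 'I_n -> 'I_N}) := [seq val (c i) | i <- enum 'I_n].

Lemma nth_values n (c : {ffun 'I_n -> 'I_N}) (i : 'I_n) : nth 0%N (values c) i = c i.
Proof. by rewrite (nth_map i) ?size_enum_ord // nth_ord_enum. Qed.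

Lemma size_values n (c : {ffun 'I_n -> 'I_N}) : size (values c) = n.
Proof. by rewrite size_map size_enum_ord. Qed.

Lemma monom_values n (c : {ffun 'I_n -> 'I_N}) : monom_of R c = monomial (values c).
Proof.
rewrite /monomial big_map big_enum /=; apply: eq_bigr => j _.
by rewrite /var valK.
Qed.

Lemma sum_values n (Q : pred (seq nat)) :
  \sum_(c : {ffun 'I_n -> 'I_N} | Q (values c)) monom_of R c = \sum_(s <- words n | Q s) monomial s.
Proof.
have p : perm_eq [seq values c | c <- enum {ffun 'I_n -> 'I_N}] (words n).
  apply: uniq_perm; rewrite ?uniq_words //.
    rewrite map_inj_uniq; first exact: enum_uniq.
    by move=> c d e; apply/ffunP => i; apply: val_inj; rewrite /= -!nth_values e.
  move=> s; rewrite mem_words; apply/mapP/andP => [[c _ ->]|[/eqP sn /allP sN]].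
    rewrite size_values; split=> //; apply/allP => v /mapP[i _ ->]; exact: ltn_ord.
  have lt (i : 'I_n) : (nth 0%N s i < N)%N by apply: sN; rewrite mem_nth ?sn.
  exists [ffun i => Ordinal (lt i)]; first by rewrite mem_enum.
  apply: (@eq_from_nth _ 0%N); rewrite ?size_values // sn => i ilt.
  by rewrite (nth_values _ (Ordinal ilt)) ffunE.
rewrite -(perm_big _ p) /= big_map big_enum_cond /=.
by apply: eq_bigr => c _; rewrite monom_values.
Qed.

Fixpoint chow_path (x : nat) (D : seq bool) (s : seq nat) : bool :=
  match D, s with
  | b :: D', v :: s' => (if b then (x < v)%N else (x <= v)%N) && chow_path v D' s'
  | [::], [::] => true
  | _, _ => false
  end.

(** The bound [v + ~~ b] merges the strict and the weak comparison into one strict bound on the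
    preceding index. *)
Lemma chow_path_rcons x D b s v : chow_path x (rcons D b) (rcons s v) =
  chow_path x D s && (last x s < v + ~~ b)%N.
Proof.
elim: D x s => [|a D IH] x [|u s] //=; last by rewrite IH andbA.
- by rewrite andbT; case: b; rewrite ?addn0 ?addn1 ?ltnS.
- by case: s => [|w s]; rewrite ?andbF.
- by case: D {IH} => [|c D]; rewrite ?andbF.
Qed.

Lemma chow_pathE x D s : size D = size s -> chow_path x D s =
  all (fun j => if nth false D j then (nth 0 (x :: s) j < nth 0 s j)%N
                else (nth 0 (x :: s) j <= nth 0 s j)%N) (iota 0 (size s)).
Proof.
elim: s D x => [|v s IH] [|b D] x //= [sz]; rewrite IH // -[1%N]addn0 iotaDl all_map.
by [].
Qed.

(** The bound [M] on the last index is the induction parameter; at [M = N] this is Chow's function.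
    On the empty sequence the default 0 of [last] makes the sum 1 only for M > 0. *)
Definition chow_sum (D : seq bool) (M : nat) : MP :=
  \sum_(s <- words (size D) | chow_path 0 D s && (last 0%N s < M)%N) monomial s.

Definition hsum (a m M : nat) : MP :=
  \sum_(s <- words m | path leq a s && all (fun v => v < M)%N s) monomial s.

Lemma FB_chow_sum n (J : pred nat) : (0 < n)%N -> FB R N n J = chow_sum (map J (iota 0 n)) N.
Proof.
move=> n0; rewrite /FB /chow_sum size_map size_iota.
rewrite (eq_bigl (fun c => chow_path 0 (map J (iota 0 n)) (values c))) => [|c].
  rewrite sum_values big_seq_cond [RHS]big_seq_cond; apply: eq_bigl => s.
  rewrite mem_words; case: eqP => //= sn; case: allP => //= sN.
  have -> : (last 0%N s < N)%N; last by rewrite andbT.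
  by apply: sN; case: s sn n0 => [<-|v s _ _] //=; apply: mem_last.
rewrite /chow_ok chow_pathE; last by rewrite size_values size_map size_iota.
rewrite size_values; apply/forallP/allP => H.
  move=> j; rewrite mem_iota /= add0n => jn; have := H (Ordinal jn) => /=.
  rewrite (nth_map 0%N) ?size_iota // nth_iota // add0n (nth_values _ (Ordinal jn)).
  by case: j jn => [|j] jn.
move=> j; have := H (val j); rewrite mem_iota /= add0n ltn_ord => /(_ isT).
rewrite (nth_map 0%N) ?size_iota // nth_iota // add0n nth_values.
by case: (val j).
Qed.

Lemma hrow_hsum a m : hrow R N a m = hsum a m N.
Proof.
rewrite /hrow /hsum (eq_bigl (fun c => path leq a (values c))) => [|c].
  rewrite sum_values big_seq_cond [RHS]big_seq_cond; apply: eq_bigl => s.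
  by rewrite mem_words; case: eqP => //= sn; case: all; rewrite ?andbT ?andbF.
rewrite (path_sortedE leq_trans) andbC; congr (_ && _); apply/forallP/allP => H.
  by move=> v /mapP[i _ ->]; apply: H.
by move=> i; apply: H; apply: map_f; rewrite mem_enum.
Qed.

Lemma monomial_rcons s v : monomial (rcons s v) = var v * monomial s.
Proof. by rewrite /monomial -cats1 big_cat big_seq1 mulrC. Qed.

Lemma chow_sum_rcons D b M : chow_sum (rcons D b) M =
  \sum_(0 <= v < N | (v < M)%N) var v * chow_sum D (v + ~~ b).
Proof.
rewrite /chow_sum size_rcons /= big_mkcond big_allpairs_dep exchange_big /=.
rewrite [RHS]big_mkcond /index_iota subn0; apply: eq_bigr => v _.
rewrite big_distrr /= [in RHS]big_mkcond /=; case: (ltnP v M) => vM; last first.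
  by rewrite big1 // => s _; rewrite last_rcons ltnNge vM andbF.
by apply: eq_bigr => s _; rewrite chow_path_rcons last_rcons vM andbT monomial_rcons.
Qed.

Lemma path_last_le a s v : path leq a s -> (last a s <= v)%N = (a <= v)%N && all (fun w => w < v.+1)%N s.
Proof.
elim: s a => [|w s IH] a /=; first by rewrite andbT.
case/andP=> aw /IH ->; rewrite ltnS; case: (leqP w v) => wv //=; last by rewrite andbF.
by rewrite (leq_trans aw wv).
Qed.

Lemma hsum0 a M : hsum a 0 M = 1.
Proof. by rewrite /hsum /= big_mkcond big_seq1 /= /monomial big_nil. Qed.

Lemma hsum_rec a m M : hsum a m.+1 M =
  \sum_(0 <= v < N | (a <= v < M)%N) var v * hsum a m v.+1.
Proof.
rewrite /hsum /= big_mkcond big_allpairs_dep exchange_big /=.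
rewrite [RHS]big_mkcond /index_iota subn0; apply: eq_bigr => v _.
rewrite big_distrr /= [in RHS]big_mkcond /=.
case: ifP => avM.
  have [av vM] := andP avM; apply: eq_bigr => s _; rewrite rcons_path all_rcons vM /= monomial_rcons.
  case: (boolP (path leq a s)) => //= p; rewrite path_last_le // av /=.
  case: allP => //= H; case: allP => //= [[]] w ws; exact: leq_trans (H w ws) vM.
apply: big1 => s _; rewrite rcons_path all_rcons; case: ifP => //.
case/and3P=> /andP[p l] vM _; move: l; rewrite path_last_le // => /andP[av _].
by move: avM; rewrite av vM.
Qed.
End Quasisymmetric.

(** * Merging two alphabets, one variable at a time *)

Section Product.
Variable N : nat.
Notation MP := {mpoly {poly int}[N]}.
Notation chow_sum := (@chow_sum N).
Notation hsum := (@hsum N).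
Notation var := (@var N).

Lemma sum_below_recr (V : nmodType) (F : nat -> V) M : (M < N)%N ->
  \sum_(0 <= v < N | (v < M.+1)%N) F v = \sum_(0 <= v < N | (v < M)%N) F v + F M.
Proof.
move=> MN; have W K : (K <= N)%N -> \sum_(0 <= v < N | (v < K)%N) F v = \sum_(0 <= v < K) F v.
  by move=> KN; rewrite [RHS](big_nat_widen _ _ N).
by rewrite !W ?big_nat_recr // ltnW.
Qed.

Lemma chow_sumS D b M : (M < N)%N ->
  chow_sum (rcons D b) M.+1 = chow_sum (rcons D b) M + var M * chow_sum D (M + ~~ b).
Proof. by move=> MN; rewrite !chow_sum_rcons sum_below_recr. Qed.

Lemma hsumS a m M : (a <= M < N)%N -> hsum a m.+1 M.+1 = hsum a m.+1 M + var M * hsum a m M.+1.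
Proof.
case/andP=> aM MN; rewrite !hsum_rec !big_mkcondl.
by rewrite sum_below_recr // aM.
Qed.

Definition bits_sum (e : seq bool -> {poly int}) n M : MP := \sum_(D <- bits n) e D *: chow_sum D M.

Definition sum0 g n M := bits_sum (fun D => end0 D g) n M.
Definition sum1 g n M := bits_sum (fun D => end1 D g) n M.
Definition sum_total g n M := bits_sum (fun D => ends_total D g) n M.

Lemma sum_totalE g n M : sum_total g n M = sum0 g n M + sum1 g n M.
Proof. by rewrite -big_split; apply: eq_bigr => D _; rewrite scalerDl. Qed.

Lemma chow_sum_nil M : (0 < M)%N -> chow_sum [::] M = 1.
Proof. by move=> M0; rewrite /chow_sum big_mkcond big_seq1 /= M0 /monomial big_nil. Qed.

Lemma chow_sum_0 D : chow_sum D 0 = 0.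
Proof. by rewrite /chow_sum big_pred0 // => s; rewrite andbF. Qed.

Lemma bits_sum_0 e n : bits_sum e n 0 = 0.
Proof. by rewrite /bits_sum big1 // => D _; rewrite chow_sum_0 scaler0. Qed.

Lemma sum0S g n M : (M < N)%N -> sum0 g n.+1 M.+1 = sum0 g n.+1 M + var M * sum_total g n M.+1.
Proof.
move=> MN; rewrite /sum0 /sum_total /bits_sum !sum_bitsS big_distrr -big_split /=.
apply: eq_bigr => D _; rewrite !endsE !scale0r !addr0 chow_sumS // addn1.
by rewrite scalerDr scalerAr.
Qed.

(** Among equal indices the ones come before the zeros: a one with index [M] follows a zero only if
    that zero has index below [M], but it may follow a one with index [M]. *)
Lemma sum1S g n M : (M < N)%N ->
  sum1 g n.+1 M.+1 = sum1 g n.+1 M + var M * (sum0 (g \o succn) n M + sum1 (g \o succn) n M.+1).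
Proof.
move=> MN; rewrite /sum0 /sum1 /bits_sum !sum_bitsS -big_split big_distrr -big_split /=.
apply: eq_bigr => D _; rewrite !endsE !chow_sumS // addn1 addn0.
by rewrite !scalerDr mulrDr !scalerAr addrACA [X in _ + X]addrC.
Qed.

(* In the merged words, the letter [M] may only come from the alphabet of the ones. *)
Definition sum_partial g n M := sum0 g n M + sum1 g n M.+1.

Lemma sum_partialS g n M : (M < N)%N ->
  sum_partial g n.+1 M = sum_total g n.+1 M + var M * sum_partial (g \o succn) n M.
Proof. by move=> MN; rewrite /sum_partial sum1S // addrA sum_totalE. Qed.

Lemma sum_totalS g n M : (M < N)%N ->
  sum_total g n.+1 M.+1 = sum_partial g n.+1 M + var M * sum_total g n M.+1.
Proof. by move=> MN; rewrite [LHS]sum_totalE sum0S // addrAC. Qed.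

Lemma bits_sum_nil e M : (0 < M)%N -> bits_sum e 0 M = e [::] *: 1.
Proof. by move=> M0; rewrite /bits_sum big_seq1 chow_sum_nil. Qed.

Lemma sum_partial_nil g M : (0 < M)%N -> sum_partial g 0 M = g 0%N *: 1.
Proof. by move=> M0; rewrite /sum_partial /sum0 /sum1 !bits_sum_nil // scale0r addr0. Qed.

Lemma sum_total_nil g M : (0 < M)%N -> sum_total g 0 M = g 0%N *: 1.
Proof. by move=> M0; rewrite /sum_total bits_sum_nil // /ends_total /end0 /end1 /= addr0. Qed.

Lemma sum_partial_0 g n : (0 < N)%N -> sum_partial g n 0 = 0.
Proof.
move=> N0; elim: n g => [|n IH] g.
  by rewrite /sum_partial /sum0 bits_sum_0 add0r /sum1 bits_sum_nil // scale0r.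
by rewrite sum_partialS // IH mulr0 addr0 /sum_total bits_sum_0.
Qed.

(** The two factors have separate bounds, so that x_M can enter one of them first. *)
Definition product_sum (g : nat -> {poly int}) n K M : MP := \sum_(k < n.+1) g k *: (hsum 1 k K * hsum 0 (n - k) M).

Lemma product_sumSl g n K M : (0 < K < N)%N ->
  product_sum g n.+1 K.+1 M = product_sum g n.+1 K M + var K * product_sum (g \o succn) n K.+1 M.
Proof.
move=> KN; rewrite /product_sum ![\sum_(k < n.+2) _]big_ord_recl !hsum0 -addrA; congr (_ + _).
rewrite big_distrr -big_split /=; apply: eq_bigr => k _.
by rewrite hsumS // mulrDl scalerDr -mulrA -scalerAr.
Qed.

Lemma product_sumSr g n K M : (M < N)%N ->
  product_sum g n.+1 K M.+1 = product_sum g n.+1 K M + var M * product_sum g n K M.+1.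
Proof.
move=> MN; rewrite /product_sum ![\sum_(k < n.+2) _]big_ord_recr !subnn !hsum0 addrAC; congr (_ + _).
rewrite big_distrr -big_split /=; apply: eq_bigr => k _.
by rewrite subSn -1?ltnS // hsumS // mulrDr scalerDr mulrCA -scalerAr.
Qed.

Lemma product_sum_nil g K M : product_sum g 0 K M = g 0%N *: 1.
Proof. by rewrite /product_sum big_ord1 !hsum0 mulr1. Qed.

Lemma hsum_below a m : (0 < m)%N -> hsum a m a = 0.
Proof.
case: m => // m _; rewrite hsum_rec big_pred0 // => v.
by case: leqP => //= av; rewrite ltnNge av.
Qed.

Lemma product_sum_one g n M : product_sum g n 1 M = g 0%N *: hsum 0 n M.
Proof.
rewrite /product_sum big_ord_recl hsum0 mul1r subn0 big1 ?addr0 // => k _.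
by rewrite hsum_below // mul0r scaler0.
Qed.

(** Passing from [M] to [M.+1] takes two moves: x_M is first opened to the ones, which gives
    [sum_partial], then to the zeros. On the right each move raises the bound of one factor. *)
Lemma sum_total_product M : (0 < M <= N)%N -> forall g n, sum_total g n M = product_sum g n M M.
Proof.
elim: M => // M IH /= MN g.
have IHp g' n : sum_partial g' n.+1 M = product_sum g' n.+1 M.+1 M.
  (* The ones may never use x_0 and the zeros have no index below 0, so both sides vanish at M =
     0. *)
  have [M0|M0] := posnP M.
    by rewrite M0 sum_partial_0 ?(leq_ltn_trans _ MN) // product_sum_one hsum_below // scaler0.
  elim: n g' => [|n IHn] g'.
    rewrite sum_partialS // sum_partial_nil // IH ?M0 1?ltnW // product_sumSl ?M0 //.
    by rewrite product_sum_nil.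
  by rewrite sum_partialS // IHn IH ?M0 1?ltnW // [RHS]product_sumSl ?M0 //.
elim=> [|n IHn]; first by rewrite sum_total_nil // product_sum_nil.
by rewrite sum_totalS // IHp IHn product_sumSr.
Qed.
End Product.

(** * Two-row skew tableaux *)

Lemma mem_bitsE n (D : seq bool) : (D \in bits n) = (size D == n).
Proof. by apply/idP/eqP => [/size_bits|<-] //; apply: mem_bits. Qed.

(** [bits] grows at the right, while the last ascent is best followed when a letter is added in
    front. *)
Lemma sum_bits_cons (V : nmodType) n (F : seq bool -> V) :
  \sum_(D <- bits n.+1) F D = \sum_(D <- bits n) (F (false :: D) + F (true :: D)).
Proof.
have p : perm_eq (bits n.+1) ([seq false :: D | D <- bits n] ++ [seq true :: D | D <- bits n]).
  apply: uniq_perm; first exact: uniq_bits.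
    rewrite cat_uniq !map_inj_uniq ?uniq_bits; try by move=> ? ? [].
    by rewrite andbT /=; apply/hasPn => _ /mapP[D _ ->]; apply/mapP => -[].
  move=> D; rewrite mem_bitsE mem_cat; apply/idP/orP.
    case: D => // -[] D; rewrite eqSS -mem_bitsE => Dn; [right | left]; exact: map_f.
  by case=> /mapP[E En ->]; rewrite /= eqSS -mem_bitsE.
by rewrite (perm_big _ p) big_cat !big_map big_split.
Qed.

(** An ascent is indexed by the position of its 0, counted from 1, as for descents of tableaux; 0
    means that there is none. *)
Fixpoint last_ascent (B : seq bool) : nat :=
  if B is b :: B' then
    if (0 < last_ascent B')%N then (last_ascent B').+1 else (~~ b && head false B' : nat)
  else 0%N.

Definition ascent_at (B : seq bool) i :=
  [&& (0 < i)%N, (i < size B)%N, ~~ nth false B i.-1 & nth false B i].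

Lemma last_ascentP B : ((0 < last_ascent B)%N -> ascent_at B (last_ascent B)) /\
  (forall i, ascent_at B i -> (i <= last_ascent B)%N).
Proof.
elim: B => [|b B [IH1 IH2]]; first by split=> // -[].
split; last move=> [|[|i]]; rewrite /=.
- have [m0|m0] := posnP (last_ascent B).
    by case: b; case: (B) => //= -[].
  by have := IH1 m0; case: (last_ascent B) m0.
- by [].
- case/and4P=> _ /= _ nb; case: B {IH1 IH2} => [|c B] //= cT; rewrite nb cT.
  by case: ifP.
move=> a; have : ascent_at B i.+1 by [].
by move=> /IH2 h; rewrite (leq_trans _ h).
Qed.

Lemma last_ascent_max B :
  last_ascent B = (\max_(i < size B | ascent_at B i) i)%N.
Proof.
have [H1 H2] := last_ascentP B; apply/eqP; rewrite eqn_leq; apply/andP; split.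
  have [->//|m0] := posnP (last_ascent B); have a := H1 m0.
  have mlt : (last_ascent B < size B)%N by case/and4P: a.
  exact: (leq_bigmax_cond (Ordinal mlt)).
by apply/bigmax_leqP => i; apply: H2.
Qed.

Lemma last_ascent_0 B : (last_ascent B == 0%N) = (B == nseq (count id B) true ++ zeros (size B - count id B)).
Proof.
elim: B => //= b B IH; case: b => /=.
  rewrite add1n subSS eqseq_cons /= -IH; by case: (last_ascent B).
rewrite add0n subSn ?count_size //; case e: (count id B) IH => [|c] /= IH.
  rewrite eqseq_cons eqxx -IH; case: (last_ascent B) IH => //= /esym/eqP->.
  by rewrite subn0; case: (size B).
by case: (last_ascent B) IH => //= /esym/eqP->.
Qed.

Definition ascent_sum n k : {poly int} :=
  \sum_(B <- bits n | count id B == k) 'X^(n - last_ascent B).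

(** The only word is 1^k 0^(n-k). *)
Lemma sum_no_ascent n k : (k <= n)%N ->
  \sum_(B <- bits n | (count id B == k) && (last_ascent B == 0%N)) (1 : {poly int}) = 1.
Proof.
move=> kn; rewrite -big_filter (_ : filter _ _ = [:: nseq k true ++ zeros (n - k)]) ?big_seq1 //.
rewrite -(@filter_pred1_uniq _ (bits n)); rewrite ?uniq_bits //; last first.
  by rewrite mem_bitsE size_cat !size_nseq subnKC.
apply: eq_in_filter => B; rewrite mem_bitsE => /eqP Bn; rewrite last_ascent_0 Bn.
apply/andP/eqP => [[/eqP-> /eqP //]|e].
have ck : count id B = k by rewrite e count_cat !count_nseq mul1n mul0n addn0.
by rewrite ck e !eqxx.
Qed.

(** A letter put in front raises the length and the last ascent together, or creates an ascent at 1;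
    the exponent stays. The exception is the word without ascents when none is created: 1 in front
    of it, or 0 in front of 0^n. There the exponent grows from n to n + 1. *)
Lemma ascent_sumS n k : (k <= n.+1)%N ->
  ascent_sum n.+1 k = ascent_sum n k + (if k is k'.+1 then ascent_sum n k' else 0) + ('X^(n.+1) - 'X^n).
Proof.
move=> kn; rewrite /ascent_sum big_mkcond sum_bits_cons big_split /= -!big_mkcond /=.
have T j : (j <= n)%N -> \sum_(B <- bits n | count id B == j) 'X^(n.+1 - last_ascent (true :: B)) =
   \sum_(B <- bits n | count id B == j) 'X^(n - last_ascent B) + ('X^(n.+1) - 'X^n) :> {poly int}.
  move=> jn; rewrite -[X in _ + X]mulr1 -(sum_no_ascent jn) big_mkcondr big_distrr -big_split /=.
  apply: eq_bigr => B _; case: (last_ascent B) => [|m] /=; last by rewrite subSS mulr0 addr0.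
  by rewrite !subn0; ring.
have F j : (0 < j)%N -> \sum_(B <- bits n | count id B == j) 'X^(n.+1 - last_ascent (false :: B)) =
   \sum_(B <- bits n | count id B == j) 'X^(n - last_ascent B) :> {poly int}.
  move=> j0; rewrite big_seq_cond [RHS]big_seq_cond; apply: eq_bigr => B.
  case/andP=> _ /eqP cB; congr 'X^_; rewrite /=; case e: (last_ascent B) => [|m] /=; last by rewrite subSS.
  move/eqP: e; rewrite last_ascent_0 cB => /eqP eB.
  have -> : head false B = true by rewrite eB; case: j j0 {cB eB}.
  by rewrite subSS subn0.
case: k kn => [|k] kn.
  rewrite [X in _ + X]big_pred0 ?addr0; last by move=> B /=; rewrite add1n.
  rewrite -[X in _ + X]mulr1 -(sum_no_ascent (leq0n n)) big_mkcondr big_distrr -big_split /=.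
  rewrite big_seq_cond [RHS]big_seq_cond; apply: eq_bigr => B /andP[_ /eqP cB].
  have {}cB : count id B = 0%N := cB.
  case e: (last_ascent B) => [|m] /=; last by rewrite subSS mulr0 addr0.
  move/eqP: e; rewrite last_ascent_0 cB /= subn0 => /eqP eB.
  have -> : head false B = false by rewrite eB; case: (size B).
  by rewrite !subn0; ring.
rewrite (F k.+1) // -addrA; congr (_ + _); rewrite -T //.
Qed.

Lemma ascent_sumE n k : ascent_sum n k = if (k <= n)%N then pascal n k else 0.
Proof.
case: leqP => kn; last first.
  rewrite /ascent_sum big_seq_cond big_pred0 // => B; rewrite mem_bitsE.
  apply/negP => /andP[/eqP Bn /eqP ck]; have := count_size id B.
  by rewrite Bn ck leqNgt kn.
elim: n k kn => [|n IH] k kn.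
  by move: kn; rewrite leqn0 => /eqP->; rewrite /ascent_sum /= big_mkcond big_seq1 /= expr0.
rewrite ascent_sumS // /= kn; congr (_ + _); congr (_ + _); last by case: k kn => // k /IH.
have [/IH //|nk] := leqP k n.
rewrite pascal_gt // /ascent_sum big_seq_cond big_pred0 // => B; rewrite mem_bitsE.
apply/negP => /andP[/eqP Bn /eqP ck]; have := count_size id B.
by rewrite Bn ck leqNgt nk.
Qed.

(** * Tableaux as binary words *)

Section Tableaux.
Variables n k : nat.
Hypothesis kn : (k <= n)%N.
Notation cell := ('I_3 * 'I_n.+1)%type.
Notation filling := {ffun 'I_n -> cell}.

(* Every column of the shape has a single cell, so columns index the cells. *)
Definition column_cell (i : 'I_n) : cell :=
  (if (i < k)%N then inord 2 else inord 1, inord i.+1).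

Lemma column_cell_inj : injective column_cell.
Proof.
move=> i j [_ e]; apply: val_inj; have := congr1 val e.
by rewrite /= !inordK ?ltnS ?ltn_ord // => -[].
Qed.

Lemma skew_cellP rc : reflect (exists i, rc = column_cell i) (skew_cell k rc).
Proof.
case: rc => r c; apply: (iffP idP) => [|[i ->]]; last first.
  rewrite /skew_cell /column_cell /= !inordK ?ltnS ?ltn_ord //.
  by case: ltnP => ik; rewrite !inordK //= ?ltn_ord //= ?ik ?orbT.
rewrite /skew_cell /= => H.
have c0 : (0 < c <= n)%N.
  by case/orP: H => /and3P[_ h1 h2]; [rewrite h2 (leq_ltn_trans _ h1) | rewrite h1 (leq_trans h2)].
have lt : (c.-1 < n)%N by case: (val c) c0 => //= m /andP[].
exists (Ordinal lt); congr (_, _); apply: val_inj.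
  have -> : (Ordinal lt < k)%N = (c <= k)%N by rewrite /=; case: (val c) c0.
  case/orP: H => /and3P[/eqP r1 h1 h2]; rewrite [LHS]r1.
    by rewrite leqNgt h1 /= inordK.
  by rewrite h2 /= inordK.
by rewrite /= inordK ?prednK ?ltn_ord //; case/andP: c0.
Qed.

Lemma row_column_cell i : val (column_cell i).1 = if (i < k)%N then 2%N else 1%N.
Proof. by rewrite /column_cell /=; case: ifP => _; rewrite inordK. Qed.

Definition in_row2 (T : filling) (e : 'I_n) : bool := val (T e).1 == 2%N.

Definition row_word (T : filling) : seq bool := [seq in_row2 T e | e <- enum 'I_n].

Lemma size_row_word T : size (row_word T) = n.
Proof. by rewrite size_map size_enum_ord. Qed.

Lemma nth_row_word T (e : 'I_n) : nth false (row_word T) e = in_row2 T e.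
Proof. by rewrite (nth_map e) ?size_enum_ord // nth_ord_enum. Qed.

Lemma SYT_cell (T : filling) e : isSYT k T -> skew_cell k (T e).
Proof. by case/and5P=> _ /forallP H _ _ _. Qed.

Lemma SYT_inj (T : filling) : isSYT k T -> injective T.
Proof. by case/and5P=> /injectiveP. Qed.

Lemma SYT_surj T (rc : cell) : isSYT k T -> skew_cell k rc -> exists e, T e = rc.
Proof. by case/and5P=> _ _ /forallP/(_ rc)/implyP H _ _ /H/existsP[e /eqP <-]; exists e. Qed.

Lemma SYT_row (T : filling) e1 e2 : isSYT k T -> (T e1).1 = (T e2).1 -> (val (T e1).2 < val (T e2).2)%N ->
  (e1 < e2)%N.
Proof.
case/and5P=> _ _ _ /forallP/(_ e1)/forallP/(_ e2)/implyP H _ r c; apply: H.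
by rewrite r eqxx.
Qed.

Lemma SYT_rowE (T : filling) e : isSYT k T -> val (T e).1 = if in_row2 T e then 2%N else 1%N.
Proof.
move=> sT; have /skew_cellP[i ei] := SYT_cell e sT.
by rewrite /in_row2 ei row_column_cell; case: ifP.
Qed.

(** At the first entry placed differently, the cell further left holds, in the other tableau, a
    smaller entry of the same row; there the two tableaux agree, against injectivity. *)
Lemma row_word_inj (T T' : filling) : isSYT k T -> isSYT k T' -> row_word T = row_word T' -> T = T'.
Proof.
move=> sT sT' eT; have er e : (T e).1 = (T' e).1.
  by apply: val_inj; rewrite SYT_rowE // [RHS]SYT_rowE // -!nth_row_word eT.
suff H m : forall e : 'I_n, (e < m)%N -> T e = T' e by apply/ffunP => e; apply: (H e.+1).
have key (U U' : filling) (e : 'I_n) : isSYT k U -> isSYT k U' -> (U e).1 = (U' e).1 ->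
    (forall e' : 'I_n, (e' < e)%N -> U e' = U' e') -> ~~ (val (U e).2 < val (U' e).2)%N.
  move=> sU sU' r IH; apply/negP => lt.
  have [e'' E] := SYT_surj sU' (SYT_cell e sU).
  have le : (e'' < e)%N by apply: (SYT_row sU'); rewrite E.
  have := IH e'' le; rewrite E => /(SYT_inj sU) ee; move: le; by rewrite ee ltnn.
elim: m => // m IH e; rewrite ltnS leq_eqVlt => /orP[/eqP em|]; last exact: IH.
have IHe : forall e' : 'I_n, (e' < e)%N -> T e' = T' e' by move=> e'; rewrite em; apply: IH.
have h1 := key T T' e sT sT' (er e) IHe.
have h2 := key T' T e sT' sT (esym (er e)) (fun e' h => esym (IHe e' h)).
rewrite -!leqNgt in h1 h2.
have e2 : (T e).2 = (T' e).2 by apply: val_inj; apply/eqP; rewrite eqn_leq h1 h2.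
by move: (er e) e2; case: (T e) => a b; case: (T' e) => a' b' /= -> ->.
Qed.

Lemma count_enum_card (P : pred 'I_n) : count P (enum 'I_n) = #|P|.
Proof. by rewrite -size_filter cardE enumT. Qed.

Lemma card_first : #|[pred i : 'I_n | (i < k)%N]| = k.
Proof.
rewrite -[RHS](size_iota 0 k) -count_enum_card.
rewrite -(count_map val (fun i => i < k)%N) val_enum_ord.
rewrite -{1}(subnKC kn) iotaD count_cat [X in (X + _)%N](eq_in_count (a2 := predT)); last first.
  by move=> i; rewrite mem_iota /= add0n => ->.
rewrite count_predT (eq_in_count (a2 := pred0)); first by rewrite count_pred0 addn0.
by move=> i; rewrite mem_iota add0n => /andP[h _] /=; apply/negbTE; rewrite -leqNgt.
Qed.

Lemma count_row_word (T : filling) : isSYT k T -> count id (row_word T) = k.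
Proof.
move=> sT; rewrite count_map count_enum_card -[RHS]card_first.
rewrite -(card_image (SYT_inj sT)) -[RHS](card_image column_cell_inj).
apply: eq_card => rc; apply/imageP/imageP => [[e]|[i]]; rewrite !inE => H ->.
  have /skew_cellP[i ei] := SYT_cell e sT; exists i; rewrite ?inE //.
  by move: H; rewrite /in_row2 /preim /= ei row_column_cell; case: ifP.
have [|e E] := @SYT_surj T (column_cell i) sT; first by apply/skew_cellP; exists i.
by exists e; rewrite // inE /in_row2 /= E row_column_cell H.
Qed.

Lemma count_take_lt (a : pred bool) B e1 e2 : (e1 < e2 <= size B)%N -> a (nth false B e1) ->
  (count a (take e1 B) < count a (take e2 B))%N.
Proof.
case/andP=> e12 e2B ae; have e1B := leq_trans e12 e2B.
have -> : take e1 B = take e1 (take e2 B) by rewrite -take_min (minn_idPl (ltnW e12)).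
have sz : size (take e2 B) = e2 by rewrite size_takel.
rewrite -{2}(cat_take_drop e1 (take e2 B)) count_cat (drop_nth false) ?sz //=.
by rewrite nth_take // ae addnA addn1 addSn ltnS leq_addr.
Qed.

(** Columns are counted from 0: the second row fills 0, ..., k - 1 and the first row continues from
    k, each in the order of the entries. *)
Definition word_column (B : seq bool) (e : nat) : nat :=
  if nth false B e then count id (take e B) else (k + count negb (take e B))%N.

Section Word.
Variable B : seq bool.
Hypotheses (Bn : size B = n) (Bk : count id B = k).

Lemma word_column_row (e : 'I_n) : (word_column B e < k)%N = nth false B e.
Proof.
rewrite /word_column; case: ifP => ne; last by rewrite ltnNge leq_addr.
by rewrite -[X in (_ < X)%N]Bk -[in X in (_ < X)%N](take_size B) count_take_lt // Bn ltn_ord leqnn.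
Qed.

Lemma word_column_lt (e : 'I_n) : (word_column B e < n)%N.
Proof.
have [h|h] := boolP (nth false B e).
  by apply: leq_trans kn; rewrite word_column_row.
rewrite /word_column (negbTE h).
have E : (k + count negb B)%N = n by rewrite -Bk -Bn -(count_predC id B).
by rewrite -[X in (_ < X)%N]E ltn_add2l -[in X in (_ < X)%N](take_size B) count_take_lt // Bn ltn_ord leqnn.
Qed.

Lemma word_column_lt_mono (e1 e2 : 'I_n) : nth false B e1 = nth false B e2 -> (e1 < e2)%N ->
  (word_column B e1 < word_column B e2)%N.
Proof.
move=> r e12; have h : (e1 < e2 <= size B)%N by rewrite e12 Bn ltnW.
rewrite /word_column -r; case: ifP => ne; rewrite ?ltn_add2l; apply: count_take_lt; rewrite //= ?ne //.
Qed.

Definition word_index (e : 'I_n) : 'I_n := Ordinal (word_column_lt e).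

Lemma word_index_inj : injective word_index.
Proof.
move=> e1 e2 /(congr1 val) /= e.
have r : nth false B e1 = nth false B e2 by rewrite -!word_column_row e.
apply: val_inj; case: (ltngtP e1 e2) => // h.
  by have := word_column_lt_mono r h; rewrite e ltnn.
by have := word_column_lt_mono (esym r) h; rewrite e ltnn.
Qed.

Definition word_filling : filling := [ffun e => column_cell (word_index e)].

Lemma word_filling_row2 e : in_row2 word_filling e = nth false B e.
Proof.
by rewrite /in_row2 ffunE row_column_cell /= word_column_row; case: nth.
Qed.

Lemma row_word_filling : row_word word_filling = B.
Proof.
apply: (@eq_from_nth _ false); rewrite size_row_word // => i ilt.
by rewrite (nth_row_word _ (Ordinal ilt)) word_filling_row2.
Qed.

Lemma word_filling_SYT : isSYT k word_filling.
Proof.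
have colE (e : 'I_n) : val (word_filling e).2 = (word_column B e).+1.
  by rewrite ffunE /= inordK // ltnS word_column_lt.
have rowE (e1 e2 : 'I_n) : (word_filling e1).1 = (word_filling e2).1 -> nth false B e1 = nth false B e2.
  by move=> h; rewrite -!word_filling_row2 /in_row2 h.
apply/and5P; split.
- by apply/injectiveP => e1 e2; rewrite !ffunE => /column_cell_inj/word_index_inj.
- by apply/forallP => e; apply/skew_cellP; exists (word_index e); rewrite ffunE.
- apply/forallP => rc; apply/implyP => /skew_cellP[i ->]; apply/existsP.
  have /codomP[e ->] : i \in codom word_index by apply: injF_onto; exact: word_index_inj.
  by exists e; rewrite ffunE.
- apply/forallP => e1; apply/forallP => e2; apply/implyP => /andP[/eqP/rowE r].
  rewrite !colE ltnS => lt; rewrite ltnNge; apply: contraL lt; rewrite -leqNgt leq_eqVlt.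
  by case/orP=> [/eqP e|/(word_column_lt_mono (esym r))/ltnW //]; rewrite (val_inj e).
(* Equal columns mean equal entries here, so the condition on columns is vacuous. *)
apply/forallP => e1; apply/forallP => e2; apply/implyP => /andP[/eqP e].
have := congr1 val e; rewrite !colE => -[ec].
have -> : e1 = e2 by apply: word_index_inj; apply: val_inj.
by rewrite ltnn.
Qed.
End Word.

Lemma rowOf_word (T : filling) i : isSYT k T -> (i < n)%N ->
  rowOf T i = if nth false (row_word T) i then 2%N else 1%N.
Proof.
move=> sT ilt; have -> : i = Ordinal ilt by [].
by rewrite nth_row_word -SYT_rowE // /rowOf (nth_map (Ordinal ilt)) ?size_enum_ord // nth_ord_enum.
Qed.

(** A descent of [T] is a step from the first row to the second, that is, from 0 to 1 in the
    word. *)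
Lemma ldes_row_word (T : filling) : isSYT k T -> ldes T = last_ascent (row_word T).
Proof.
move=> sT; rewrite last_ascent_max size_row_word; apply: eq_bigl => i.
rewrite /DesT /ascent_at size_row_word; case: (posnP i) => [->//|i0] /=.
rewrite ltn_ord !rowOf_word ?(leq_ltn_trans (leq_pred i)) //=.
by do 2!case: nth.
Qed.

Lemma sum_bcoef : \sum_(j < n.+1) ((bcoef n k j)%:R *: ('X^j : {poly int})) = pascal n k.
Proof.
have <- : ascent_sum n k = pascal n k by rewrite ascent_sumE kn.
pose W := [seq row_word T | T <- enum [pred T : filling | isSYT k T]].
have p : perm_eq W [seq B <- bits n | count id B == k].
  apply: uniq_perm; rewrite ?filter_uniq ?uniq_bits //.
    rewrite map_inj_in_uniq ?enum_uniq // => T T'; rewrite !mem_enum => sT sT'.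
    exact: row_word_inj.
  move=> B; rewrite mem_filter mem_bitsE; apply/mapP/andP => [[T]|[/eqP Bk /eqP Bn]].
    by rewrite mem_enum => sT ->; rewrite size_row_word count_row_word.
  exists (word_filling Bn Bk); last by rewrite row_word_filling.
  by rewrite mem_enum; apply: word_filling_SYT.
rewrite /ascent_sum -[RHS]big_filter -(perm_big _ p) big_map big_enum_cond /=.
rewrite (eq_bigl (fun T : filling => isSYT k T)); last by move=> T; rewrite andbT.
have lt (T : filling) : (n - ldes T < n.+1)%N by rewrite ltnS leq_subr.
have le (T : filling) : (ldes T <= n)%N by apply/bigmax_leqP => i _; apply: ltnW.
rewrite (eq_bigr (fun T : filling => 'X^(n - ldes T))); last by move=> T sT; rewrite ldes_row_word.
rewrite (partition_big (fun T : filling => Ordinal (lt T)) predT) //=; apply: eq_bigr => j _.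
rewrite (eq_bigr (fun _ => 'X^j)) => [|T /andP[_ /eqP <-] //].
rewrite big_const iter_addr_0 scaler_nat /bcoef; congr (_ *+ _); apply: eq_card => T.
rewrite !inE; congr (_ && _); rewrite -val_eqE /=.
move: (le T) (ltn_ord j); rewrite ltnS => l1 l2; apply/eqP/eqP; lia.
Qed.
End Tableaux.

(** * Coxeter length and reduced words *)

(** Right multiplication by s_k, which acts on positions; see [wseq_mul_gen]. *)
Definition gen_act (s : seq int) (k : nat) : seq int :=
  if k is j.+1 then take j s ++ nth 0 s j.+1 :: nth 0 s j :: drop j.+2 s
  else if s is x :: t then - x :: t else [::].

Definition desc_at (s : seq int) (k : nat) : bool := nth 0 s k < nth 0 (0 :: s) k.

Lemma split_at2 j (s : seq int) : (j.+1 < size s)%N ->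
  s = take j s ++ nth 0 s j :: nth 0 s j.+1 :: drop j.+2 s.
Proof. by move=> js; rewrite -!drop_nth ?cat_take_drop // ltnW. Qed.

Lemma act_cat (u : seq int) a b v : gen_act (u ++ a :: b :: v) (size u).+1 = u ++ b :: a :: v.
Proof.
rewrite /gen_act take_size_cat // !nth_cat ltnn subnn ltnNge leqnSn /= subSnn /=.
have -> : u ++ [:: a, b & v] = rcons (rcons u a) b ++ v by rewrite !cat_rcons.
by rewrite drop_size_cat // !size_rcons.
Qed.

Lemma desc_at_cat (u : seq int) a b v : desc_at (u ++ a :: b :: v) (size u).+1 = (b < a).
Proof. by rewrite /desc_at /= !nth_cat ltnn subnn ltnNge leqnSn /= subSnn. Qed.

Lemma actS_ex (s : seq int) j : (j.+1 < size s)%N ->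
  exists u a b v, [/\ s = u ++ a :: b :: v, size u = j, gen_act s j.+1 = u ++ b :: a :: v &
                      desc_at s j.+1 = (b < a)].
Proof.
move=> js; exists (take j s), (nth 0 s j), (nth 0 s j.+1), (drop j.+2 s).
by split; [exact: split_at2 | rewrite size_takel // ltnW // ltnW | | ].
Qed.

Lemma size_act s k : size (gen_act s k) = size s \/ (size s <= k)%N.
Proof.
case: k => [|j]; first by left; case: s.
case: (ltnP j.+1 (size s)) => js; last by right.
by left; have [u [a [b [v [-> _ -> _]]]]] := actS_ex js; rewrite !size_cat.
Qed.

Lemma actK (s : seq int) k : (k < size s)%N -> gen_act (gen_act s k) k = s.
Proof.
case: k => [|j] js; first by case: s js => //= x t _; rewrite opprK.
have [u [a [b [v [e su -> _]]]]] := actS_ex js.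
by rewrite e -su act_cat.
Qed.

Lemma perm_swap2 (T : eqType) (u : seq T) a b v : perm_eq (u ++ a :: b :: v) (u ++ b :: a :: v).
Proof. by rewrite perm_cat2l -(cat1s a) -(cat1s b v) perm_catCA. Qed.

Lemma signed_act n s k : signed n s -> (k < n)%N -> signed n (gen_act s k).
Proof.
move=> sg kn; have sz := signed_size sg; case: k kn => [|j] kn.
  by case: s sg sz => //= x t; rewrite /signed /= abszN.
rewrite -sz in kn; have [u [a [b [v [e su -> _]]]]] := actS_ex kn.
by move: sg; rewrite e /signed !map_cat /=; apply: perm_trans; apply: perm_swap2.
Qed.

Lemma signed_neq0 n s (x : int) : signed n s -> x \in s -> x != 0.
Proof. by move=> sg /(absz_le_signed sg)[]. Qed.

Lemma desc_act n s k : signed n s -> (k < n)%N -> desc_at (gen_act s k) k = ~~ desc_at s k.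
Proof.
move=> sg kn; have sz := signed_size sg; case: k kn => [|j] kn.
  case: s sg sz => [|x t] sg sz; first by rewrite -sz in kn.
  have := signed_neq0 sg (mem_head x t); rewrite /desc_at /= oppr_lt0 -leNgt => x0.
  by rewrite le_eqVlt eq_sym (negbTE x0).
rewrite -sz in kn; have [u [a [b [v [e su -> ->]]]]] := actS_ex kn.
rewrite -su desc_at_cat -leNgt le_eqVlt; have := signed_uniq sg; rewrite e cat_uniq /= inE.
by case: eqP => //= _; rewrite !andbF.
Qed.

(** The length formula of type B: inversions, pairs with negative sum, and negative letters. *)
Fixpoint cox_length (s : seq int) : nat :=
  if s is x :: t then
    (count (fun y => (y < x)%R) t + count (fun y => (x + y < 0)%R) t + (x < 0)%R + cox_length t)%N
  else 0%N.

Lemma length_swap (u : seq int) a b v : b < a ->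
  cox_length (u ++ a :: b :: v) = (cox_length (u ++ b :: a :: v)).+1.
Proof.
move=> ba; elim: u => [|x u IH] /=.
  rewrite ba (ltNge a b) (ltW ba) [b + a]addrC; lia.
have p := perm_swap2 u a b v.
by rewrite IH !(seq.permP p) addnS.
Qed.

(** Negating the first letter exchanges its inversions with its pairs of negative sum, so only the
    count of negative letters changes. *)
Lemma length_neg (x : int) t : x < 0 -> cox_length (x :: t) = (cox_length (- x :: t)).+1.
Proof.
move=> x0; rewrite /= x0 oppr_lt0 (ltNge 0 x) (ltW x0) /=.
have -> : count (fun y => y < - x) t = count (fun y => (x + y < 0)%R) t.
  by apply: eq_count => y; rewrite ltrNr -subr_lt0 opprK.
have -> : count (fun y => (- x + y < 0)%R) t = count (fun y => y < x) t.
  by apply: eq_count => y; rewrite addrC subr_lt0.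
by rewrite addn0 addn1 addSn; congr (_ + _).+1; rewrite addnC.
Qed.

Lemma length_desc s k : (k < size s)%N -> desc_at s k -> cox_length s = (cox_length (gen_act s k)).+1.
Proof.
case: k => [|j] js; first by case: s js => // x t _; rewrite /desc_at => /length_neg.
have [u [a [b [v [-> _ -> ->]]]]] := actS_ex js; exact: length_swap.
Qed.

Lemma length_nondesc n s k : signed n s -> (k < n)%N -> ~~ desc_at s k ->
  cox_length (gen_act s k) = (cox_length s).+1.
Proof.
move=> sg kn nd; have sg' := signed_act sg kn.
have kn' : (k < size s)%N by rewrite (signed_size sg).
by rewrite (@length_desc _ k) ?(desc_act sg) ?actK // (signed_size sg').
Qed.

Lemma signed_ids n : signed n (ids n).
Proof. by rewrite /signed -map_comp (eq_map (g := id)) // map_id. Qed.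

Lemma increasing_ids n : increasing (ids n).
Proof. by rewrite sorted_map; apply: sub_sorted (iota_sorted 1 n) => i j /=; lia. Qed.

Lemma length_increasing (s : seq int) : increasing s -> (forall x : int, x \in s -> 0 < x) -> cox_length s = 0%N.
Proof.
elim: s => //= x s IH so pos; have x0 : 0 < x by apply: pos; rewrite mem_head.
have tr : transitive (fun x y : int => x <= y) by move=> b c d; apply: le_trans.
have /allP le := order_path_min tr so.
rewrite IH ?(path_sorted so) //; last by move=> y ys; apply: pos; rewrite inE ys orbT.
rewrite (ltNge x) (ltW x0) addn0 addn0 /=.
rewrite (eq_in_count (a2 := pred0)) ?count_pred0 => [|y /le]; last by rewrite ltNge => ->.
rewrite (eq_in_count (a2 := pred0)) ?count_pred0 // => y /le xy.
by apply/negbTE; rewrite -leNgt addr_ge0 ?(ltW x0) // (le_trans (ltW x0)).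
Qed.

Lemma length_ids n : cox_length (ids n) = 0%N.
Proof. by apply: length_increasing (increasing_ids n) _ => x; rewrite mem_ids => /andP[]. Qed.

Lemma nodesc_ids n s : signed n s -> (forall k, (k < n)%N -> ~~ desc_at s k) -> s = ids n.
Proof.
move=> sg nd; have sz := signed_size sg.
have : path (fun x y : int => x <= y) 0 s.
  by apply/(pathP 0) => i; rewrite sz => /nd; rewrite /desc_at -leNgt.
have tr : transitive (fun x y : int => x <= y) by move=> b c d; apply: le_trans.
move=> pa; apply: increasing_pos_ids => // [|x xs]; first exact: path_sorted pa.
have /allP/(_ x xs) := order_path_min tr pa.
by rewrite le_eqVlt eq_sym (negbTE (signed_neq0 sg xs)).
Qed.

Definition run n (ws : seq nat) : seq int := foldl gen_act (ids n) ws.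

Lemma run_rcons n ws k : run n (rcons ws k) = gen_act (run n ws) k.
Proof. by rewrite /run -cats1 foldl_cat. Qed.

Notation valid n := (all (fun k => k < n)%N).

Lemma signed_run n ws : valid n ws -> signed n (run n ws).
Proof.
elim/last_ind: ws => [|ws k IH]; first by rewrite signed_ids.
by rewrite all_rcons run_rcons => /andP[kn /IH sg]; apply: signed_act.
Qed.

Lemma length_run n ws : valid n ws -> (cox_length (run n ws) <= size ws)%N.
Proof.
elim/last_ind: ws => [|ws k IH]; first by rewrite /run /= length_ids.
rewrite all_rcons run_rcons size_rcons => /andP[kn v]; have sg := signed_run v.
have kn' : (k < size (run n ws))%N by rewrite (signed_size sg).
have [d|d] := boolP (desc_at (run n ws) k); last by rewrite (length_nondesc sg) // ltnS IH.
by have := IH v; rewrite (length_desc kn' d) => /ltnW/leqW.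
Qed.

(** Minimality is replaced by a comparison with [cox_length], so that words can be built and
    shortened at descents; [reduced_wordP] returns to minimal words. *)
Definition reduced n (s : seq int) (ws : seq nat) :=
  [&& valid n ws, run n ws == s & size ws == cox_length s].

Lemma reduced_rcons n s k ws : signed n s -> (k < n)%N -> desc_at s k ->
  reduced n s (rcons ws k) = reduced n (gen_act s k) ws.
Proof.
move=> sg kn d; have ks : (k < size s)%N by rewrite (signed_size sg).
rewrite /reduced all_rcons kn run_rcons size_rcons (length_desc ks d) eqSS /=.
apply/and3P/and3P => -[v /eqP r l]; split=> //.
  by rewrite -r actK // (signed_size (signed_run v)).
by rewrite r actK.
Qed.

Lemma reduced_desc n s k ws : signed n s -> reduced n s (rcons ws k) ->
  (k < n)%N /\ desc_at s k.
Proof.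
move=> sg /and3P[]; rewrite all_rcons run_rcons size_rcons => /andP[kn v] /eqP r /eqP l.
have sg' := signed_run v; split=> //; rewrite -r (desc_act sg') //.
apply/negP => d; have := length_run v; have ks : (k < size (run n ws))%N by rewrite (signed_size sg').
by rewrite (length_desc ks d) r -l ltnNge leqnSn.
Qed.

Lemma reduced_exists n s : signed n s -> exists ws, reduced n s ws.
Proof.
have [m] := ubnP (cox_length s); elim: m s => // m IH s; rewrite ltnS => lm sg.
have [/hasP[k]|/hasPn nd] := boolP (has (desc_at s) (iota 0 n)).
  rewrite mem_iota add0n => /= kn d; have ks : (k < size s)%N by rewrite (signed_size sg).
  have [|ws r] := IH (gen_act s k) _ (signed_act sg kn).
    by rewrite -(length_desc ks d).
  by exists (rcons ws k); rewrite reduced_rcons.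
exists [::]; have <- : ids n = s.
  by apply/esym/nodesc_ids => // k kn; apply: nd; rewrite mem_iota.
by rewrite /reduced /= /run /= eqxx length_ids.
Qed.

(** * Full commutativity *)

Lemma before_adjacent (u : seq int) (a b : int) v (X Y : int) : uniq (u ++ a :: b :: v) ->
  before (u ++ b :: a :: v) X Y =
    ((X == b) && (Y == a)) || (before (u ++ a :: b :: v) X Y && ~~ ((X == a) && (Y == b))).
Proof.
rewrite cat_uniq /= !inE !negb_or => /and3P[_ /and3P[au bu _] /and3P[/andP[ab _] _ _]].
have iu (Z : int) : Z \in u -> (index Z u < size u)%N by rewrite index_mem.
have nu (Z : int) : Z \in u -> (Z == a = false) * (Z == b = false).
  by move=> Zu; split; apply: contraTF Zu => /eqP->.
rewrite /before !index_cat /= ![_ == X]eq_sym ![_ == Y]eq_sym.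
case: (boolP (X \in u)) => Xu; case: (boolP (Y \in u)) => Yu; rewrite ?(nu _ Xu) ?(nu _ Yu) ?andbT ?andbF //=.
- by have := iu X Xu; case: (Y == b); case: (Y == a); rewrite ?andbT /=; lia.
- by have := iu Y Yu; case: (X == b); case: (X == a); rewrite ?andbT /=; lia.
case: (X =P a) => [->|_]; rewrite ?(negbTE ab) /=.
  case: (Y =P a) => [->|_]; rewrite ?(negbTE ab) //= ?eqxx ?ltnn //=.
  by case: (Y =P b) => _ /=; lia.
case: (X =P b) => _ /=.
  case: (Y =P a) => [->|_]; rewrite ?(negbTE ab) //=; first lia.
  by case: (Y =P b) => _ /=; lia.
by case: (Y =P a) => [->|_]; rewrite ?(negbTE ab) //=; [lia | case: (Y =P b) => _ /=; lia].
Qed.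

Lemma bad_321 (s : seq int) (x y z : int) : x \in s -> y \in s -> z \in s ->
  before s x y -> before s y z -> y < x -> z < y -> ~~ good s.
Proof.
move=> xs ys zs bxy byz yx zy; apply/goodP => /(_ x y z xs ys zs bxy yx)[/(_ byz)].
by move=> /lt_trans/(_ zy); rewrite ltxx.
Qed.

Lemma bad_sum (s : seq int) (x y z : int) : x \in s -> y \in s -> z \in s ->
  before s x y -> y < x -> z != y -> x + z < 0 -> ~~ good s.
Proof.
move=> xs ys zs bxy yx zy xz; apply/goodP => /(_ x y z xs ys zs bxy yx)[_ /(_ zy)].
by rewrite leNgt xz.
Qed.

Lemma not_goodP (s : seq int) : uniq s -> ~~ good s -> exists x y z : int,
  [/\ x \in s, y \in s, z \in s, before s x y /\ y < x &
      (before s y z /\ z < y) \/ (z != y /\ x + z < 0)].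
Proof.
move=> us /allPn[x xs /allPn[y ys]]; rewrite negb_imply => /andP[/andP[bxy yx] /allPn[z zs]].
rewrite negb_and !negb_imply => H; exists x, y, z; split=> //.
case/orP: H => /andP[h1]; rewrite -?leNgt -?ltNge => h2; last by right.
by left; rewrite lt_neqAle h2 eq_sym (before_neq h1).
Qed.

(** For k > 0 the exchange creates no inversion. For k = 0 the negative first letter x lies below
    all others, so -x has non-negative sums with them; and if Y < -x had a smaller letter after it,
    that inversion would already violate Y + x >= 0. *)
Lemma good_act n (s : seq int) k : signed n s -> good s -> (k < n)%N -> desc_at s k -> good (gen_act s k).
Proof.
move=> sg gs kn; have us := signed_uniq sg; have ks : (k < size s)%N by rewrite (signed_size sg).
case: k kn ks => [|j] kn ks.
  case: s sg gs us kn ks => // x t sg /goodP G us kn ks; rewrite /desc_at /= => x0.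
  have sg' : signed n (- x :: t) := signed_act sg kn.
  have us' := signed_uniq sg'; case/andP: (us) => xt _; case/andP: (us') => nxt _.
  have cons_before w X Y : w \notin t -> X \in t -> Y \in t -> before (w :: t) X Y = before t X Y.
    move=> wt Xt Yt; rewrite /before /= !ifN //; apply: contraNneq wt => ->; by rewrite ?Xt ?Yt.
  have tgt y : y \in t -> x < y.
    move=> yt; rewrite ltNge; apply/negP => yx.
    have yx' : y < x by rewrite lt_neqAle yx andbT; apply: contraNneq xt => <-.
    have b : before (x :: t) x y by rewrite /before /= eqxx ifN //; apply: contraNneq xt => ->.
    have := G x y x (mem_head _ _) _ (mem_head _ _) b yx'; rewrite inE yt orbT => /(_ isT)[_].
    by rewrite gt_eqF // => /(_ isT); move: x0; clear; lia.
  have first_after w y : y \in t -> w \notin t -> before (w :: t) y w = false.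
    by move=> yt wt; rewrite /before /= eqxx; case: eqP => // e; rewrite ltn0.
  apply/goodP => X Y Z; rewrite !inE.
  case/orP=> [/eqP->|Xt]; case/orP=> [/eqP->|Yt]; rewrite ?ltxx //.
  - case/orP=> [/eqP->|Zt] _ Yx.
      by rewrite first_after //; split=> // _; move: x0; clear; lia.
    rewrite cons_before //; split.
      move=> bYZ; rewrite ltNge; apply/negP => ZY.
      have ZY' : Z < Y by rewrite lt_neqAle ZY eq_sym (before_neq bYZ).
      have := G Y Z x; rewrite !inE Yt Zt eqxx !orbT cons_before // => /(_ isT isT isT bYZ ZY')[_].
      by rewrite lt_eqF ?tgt // => /(_ isT); move: Yx; clear; lia.
    by move=> _; have := tgt Z Zt; clear; lia.
  - by rewrite first_after.
  rewrite cons_before //; case/orP=> [/eqP->|Zt] b YX.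
    by rewrite first_after //; split=> // _; have := tgt X Xt; clear; lia.
  by rewrite cons_before //; have := G X Y Z; rewrite !inE Xt Yt Zt !orbT !cons_before //; apply.
have [u [a [b [v [e su -> ->]]]]] := actS_ex ks; rewrite {}e in sg gs us *; move=> ba.
have mem := perm_mem (perm_swap2 u a b v); apply/goodP => X Y Z; rewrite -!mem => Xs Ys Zs.
have noba : (X == b) && (Y == a) -> Y < X = false.
  by case/andP=> /eqP-> /eqP->; rewrite ltNge (ltW ba).
rewrite before_adjacent // => B YX; have bXY : before (u ++ [:: a, b & v]) X Y.
  by case/orP: B => [/noba|/andP[]//]; rewrite YX.
have /goodP/(_ X Y Z Xs Ys Zs bXY YX)[G1 G2] := gs; split=> //.
rewrite before_adjacent // => /orP[/andP[/eqP-> /eqP->]//|/andP[/G1]//].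
Qed.

Lemma split_before (s : seq int) (x y : int) : uniq s -> x \in s -> y \in s -> before s x y ->
  exists u w v, s = u ++ x :: w ++ y :: v.
Proof.
move=> us xs; case/splitPr: xs us => u t us ys b; case: (boolP (y \in t)) => [yt|yt].
  by case/splitPr: yt => w v; exists u, w, v.
exfalso; have yx : y != x by rewrite eq_sym (before_neq b).
move: b ys; rewrite /before mem_cat inE (negbTE yt) orbF index_mid // (negbTE yx) orbF => b yu.
by move: b; rewrite index_cat yu ltnNge ltnW // index_mem.
Qed.

Lemma before_mid (u w v : seq int) (x y : int) : uniq (u ++ x :: w ++ y :: v) ->
  before (u ++ x :: w ++ y :: v) x y.
Proof.
move=> us; rewrite /before index_mid //; move: us; rewrite -cat_cons catA => us.
by rewrite index_mid // size_cat /= addnS leq_addr.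
Qed.

(** Supplies an adjacent descent that can be undone without reversing x and y, unless it is the pair
    (x, y) itself. *)
Lemma descent_between (s : seq int) (x y : int) : uniq s -> x \in s -> y \in s ->
  before s x y -> y < x -> exists u a b v,
    [/\ s = u ++ a :: b :: v, b < a, a = x \/ before s x a & b = y \/ before s b y].
Proof.
move=> us xs ys bxy yx; have [u0 [w0 [v e]]] := split_before us xs ys bxy.
suff H w u c : s = u ++ c :: w ++ y :: v -> c = x \/ before s x c -> y < c -> exists u a b v,
    [/\ s = u ++ a :: b :: v, b < a, a = x \/ before s x a & b = y \/ before s b y].
  by apply: (H w0 u0 x) => //; left.
elim: w u c => [|d w IH] u c es cx yc; first by exists u, c, y, v; split=> //; left.
have [dc|cd] := ltP d c.
  exists u, c, d, (w ++ y :: v); split=> //; right.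
  by move: es; rewrite /= -cat_rcons => es; rewrite es before_mid // -es.
apply: (IH (rcons u c) d); first by rewrite cat_rcons.
  right; have bcd : before s c d.
    by rewrite es /= (@before_mid u [::]) // -[[::] ++ _]/(d :: w ++ y :: v) -es.
  by case: cx => [<- //|]; move: bcd; rewrite /before => h1 h2; apply: ltn_trans h2 h1.
exact: lt_le_trans yc cd.
Qed.

Lemma size_cat2 (u : seq int) a b v n : signed n (u ++ a :: b :: v) -> ((size u).+1 < n)%N.
Proof. by move/signed_size <-; rewrite size_cat /= !addnS !ltnS leq_addr. Qed.

Definition removable_bad n s := exists k, [/\ (k < n)%N, desc_at s k & ~~ good (gen_act s k)].
Definition consecutive_descents n s := exists k, [/\ (k.+1 < n)%N, desc_at s k & desc_at s k.+1].

(** A descent between x and y, or between y and z, can be undone while the pattern survives, unless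
    it is that pair itself. If both are, the three letters are consecutive. *)
Lemma bad_step_321 n s (x y z : int) : signed n s -> x \in s -> y \in s -> z \in s ->
  before s x y -> before s y z -> y < x -> z < y -> consecutive_descents n s \/ removable_bad n s.
Proof.
move=> sg xs ys zs bxy byz yx zy; have us := signed_uniq sg.
have [u [a [b [v [e ba ax by_]]]]] := descent_between us xs ys bxy yx.
have keep u' a' b' v' : s = u' ++ a' :: b' :: v' -> b' < a' ->
    ~~ ((x == a') && (y == b')) -> ~~ ((y == a') && (z == b')) -> removable_bad n s.
  move=> e' ba' h1 h2; exists (size u').+1; split.
  - by apply: (@size_cat2 u' a' b' v'); rewrite -e'.
  - by rewrite e' desc_at_cat.
  rewrite e' act_cat; have us' := us; rewrite e' in us'.
  have mem := perm_mem (perm_swap2 u' a' b' v').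
  by apply: (@bad_321 _ x y z); rewrite -?mem -?e' // before_adjacent // -e' ?bxy ?byz ?h1 ?h2 orbT.
have [/andP[/eqP xa /eqP yb]|n1] := boolP ((x == a) && (y == b)); last first.
  right; apply: (keep u a b v) => //; apply/negP => /andP[/eqP ya /eqP zb].
  case: by_ => [bz|]; first by move: zy; rewrite zb bz ltxx.
  by rewrite -zb (before_asym byz).
have [u' [c [d [v' [e' dc yc dz]]]]] := descent_between us ys zs byz zy.
have [/andP[/eqP yc' /eqP zd]|n2] := boolP ((y == c) && (z == d)); last first.
  right; apply: (keep u' c d v') => //; apply/negP => /andP[/eqP xc /eqP yd].
  case: yc => [cy|]; first by move: yx; rewrite xc cy ltxx.
  by rewrite -xc (before_asym bxy).
left; exists (size u).+1; have su : size u' = (size u).+1.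
  have : index y s = size u' by rewrite e' -yc' index_mid // yc' -e'.
  move=> <-; rewrite e -yb -cat_rcons index_mid ?size_rcons // cat_rcons yb -e.
  exact: us.
split; [|by rewrite e desc_at_cat|by rewrite -su e' desc_at_cat].
by rewrite -su; apply: (@size_cat2 u' c d v'); rewrite -e'.
Qed.

Lemma before_head (w : int) (t : seq int) (X Y : int) : w \notin t -> X \in t -> Y \in t ->
  before (w :: t) X Y = before t X Y.
Proof. by move=> wt Xt Yt; rewrite /before /= !ifN //; apply: contraNneq wt => ->. Qed.

Lemma before_first (w : int) (t : seq int) (Y : int) : w \notin t -> Y \in t -> before (w :: t) w Y.
Proof. by move=> wt Yt; rewrite /before /= eqxx ifN //; apply: contraNneq wt => ->. Qed.

Lemma bad_step n s : signed n s -> ~~ good s -> consecutive_descents n s \/ removable_bad n s.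
Proof.
move=> sg ngs; have us := signed_uniq sg.
have [x [y [z [xs ys zs [bxy yx] [[byz zy]|[zy xz]]]]]] := not_goodP us ngs.
  exact: bad_step_321 bxy byz yx zy.
have [[byz zy']|n321] : (before s y z /\ z < y) \/ (before s y z -> y < z).
- case: (boolP (before s y z)) => [b|_]; last by right.
  by case: (ltgtP z y) zy => // zy' _; [left | right].
- exact: bad_step_321 bxy byz yx zy'.
have keep u' a' b' v' : s = u' ++ a' :: b' :: v' -> b' < a' ->
    ~~ ((x == a') && (y == b')) -> removable_bad n s.
  move=> e' ba' h1; exists (size u').+1; split.
  - by apply: (@size_cat2 u' a' b' v'); rewrite -e'.
  - by rewrite e' desc_at_cat.
  rewrite e' act_cat; have us' := us; rewrite e' in us'.
  have mem := perm_mem (perm_swap2 u' a' b' v').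
  by apply: (@bad_sum _ x y z); rewrite -?mem -?e' // before_adjacent // -e' bxy h1 orbT.
have [u [a [b [v [e ba _ _]]]]] := descent_between us xs ys bxy yx.
have [/andP[/eqP xa /eqP yb]|n1] := boolP ((x == a) && (y == b)); last by right; apply: keep e ba n1.
(* Any other descent of adjacent letters can be undone, as x stays before y and the sum condition
   ignores positions. *)
have [/hasP[j]|/hasPn nd] := boolP (has (fun j => desc_at s j.+1 && (j != size u)) (iota 0 n.-1)).
  rewrite mem_iota add0n => /= jn /andP[dj ju].
  have js : (j.+1 < size s)%N by rewrite (signed_size sg); move: jn; case: (n).
  have [u' [a' [b' [v' [e' su' _ dj']]]]] := actS_ex js; rewrite dj' in dj.
  right; apply: (keep u' a' b' v') => //; apply: contra ju => /andP[/eqP xa' _].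
  have : index x s = size u' by rewrite e' xa' index_mid // -e'.
  by rewrite e xa index_mid -?e // => ->; rewrite su'.
have e1 : s = u ++ x :: y :: v by rewrite e xa yb.
have lt1 : ((size u).+1 < n)%N by apply: (@size_cat2 u x y v); rewrite -e1.
have us1 : uniq (u ++ x :: y :: v) by rewrite -e1.
(* If x leads the word, positions 0 and 1 are both descents. Otherwise the first letter is negated,
   which keeps the violation; when it is z itself, -z, x, y is a 321 pattern since x + z < 0. *)
have [d0|nd0] := boolP (desc_at s 0).
  case: u e e1 nd lt1 us1 {n321} => [|f u] e e1 nd lt1 us1.
    by left; exists 0%N; split=> //; rewrite e1 /desc_at.
  right; exists 0%N; split=> //; first exact: ltn_trans lt1.
  have sg' : signed n (gen_act s 0) by apply: signed_act => //; apply: ltn_trans lt1.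
  have := signed_uniq sg'; rewrite e1 /= => /andP[nft _].
  have f0 : f < 0 by move: d0; rewrite e1.
  set t := u ++ _ in nft *; have ft : f \notin t by move: us1 => /= /andP[].
  have xt : x \in t by rewrite mem_cat mem_head orbT.
  have yt : y \in t by rewrite mem_cat !inE eqxx !orbT.
  have bxy' : before t x y by rewrite -(before_head ft) // -[f :: t]/((f :: u) ++ _) -e1.
  have [zf|zf] := eqVneq z f.
    apply: (@bad_321 _ (- f) x y) => //; rewrite ?inE ?eqxx ?xt ?yt ?orbT //.
    - exact: before_first.
    - by rewrite before_head.
    by move: xz; rewrite zf; clear; lia.
  have zt : z \in t by move: zs; rewrite e1 inE (negbTE zf).
  by apply: (@bad_sum _ x y z); rewrite ?inE ?xt ?yt ?zt ?orbT ?before_head.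
(* No descent is left up to x, so these letters are positive. Hence z is negative, stands after y
   and exceeds y; exchanging x and y leaves the inversion (x, z) with x + y < x + z < 0. *)
have pos (w : int) : w \in rcons u x -> 0 < w.
  move=> wu; have ws : w \in s by rewrite e1 -cat_rcons mem_cat wu.
  have : path (fun x y : int => x <= y) 0 (rcons u x).
    apply/(pathP 0) => i; rewrite size_rcons ltnS => iu.
    have nth1 m : (m <= size u)%N -> nth 0 (rcons u x) m = nth 0 s m.
      by move=> mu; rewrite e1 -cat_rcons nth_cat size_rcons ltnS mu.
    rewrite nth1 //; case: i iu => [|i] iu /=.
      by move: nd0; rewrite /desc_at -leNgt.
    rewrite nth1 ?(ltnW iu) //; have := nd i; rewrite mem_iota add0n (ltn_eqF iu) andbT.
    have -> : (0 <= i < n.-1)%N by rewrite /= -ltnS prednK ?(ltn_trans _ lt1) // (leq_trans _ lt1) // ltnS ltnW.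
    by move=> /(_ isT); rewrite /desc_at -leNgt.
  have tr : transitive (fun x y : int => x <= y) by move=> b1 c d; apply: le_trans.
  move=> /(order_path_min tr)/allP/(_ w wu).
  by rewrite le_eqVlt eq_sym (negbTE (signed_neq0 sg ws)).
have x0 : 0 < x by apply: pos; rewrite mem_rcons mem_head.
have z0 : z < 0 by move: xz x0; clear; lia.
have zv : z \in v.
  move: zs; rewrite e1 -cat_rcons mem_cat inE (negbTE zy) /=.
  by case/orP=> // /pos; rewrite ltNge (ltW z0).
have [v1 [v2 ev]] : exists v1 v2, v = v1 ++ z :: v2 by case/splitPr: zv => v1 v2; exists v1, v2.
have byz : before s y z.
  by rewrite e1 ev -cat_rcons before_mid // cat_rcons -ev.
have bxz : before s x z by rewrite e1 ev (@before_mid u (y :: v1)) //= -ev.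
right; exists (size u).+1; split=> //; first by rewrite e1 desc_at_cat.
have mem := perm_mem (perm_swap2 u x y v).
rewrite e1 act_cat; apply: (@bad_sum _ x z y); rewrite -?mem -?e1 //.
- by rewrite before_adjacent // -e1 bxz (negbTE zy) andbF orbT.
- exact: lt_trans x0.
- by rewrite eq_sym.
by apply: lt_trans xz; rewrite ltrD2l; apply: n321.
Qed.

(** The two sides of the relations between non-commuting generators, of order 4 for s_0, s_1 and of
    order 3 otherwise. *)
Definition braid_pair (w1 w2 : seq nat) : Prop :=
  (w1 = [:: 0; 1; 0; 1]%N /\ w2 = [:: 1; 0; 1; 0]%N) \/
  exists j, w1 = [:: j.+1; j.+2; j.+1] /\ w2 = [:: j.+2; j.+1; j.+2].

Lemma reduced_swap n (u : seq int) a b v j ws : signed n (u ++ a :: b :: v) -> size u = j -> b < a ->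
  reduced n (u ++ b :: a :: v) ws -> reduced n (u ++ a :: b :: v) (rcons ws j.+1).
Proof.
move=> sg <- ba r; rewrite reduced_rcons ?desc_at_cat // ?act_cat //.
exact: size_cat2 sg.
Qed.

Lemma reduced_flip n (x : int) t ws : signed n (x :: t) -> x < 0 ->
  reduced n (- x :: t) ws -> reduced n (x :: t) (rcons ws 0).
Proof. by move=> sg x0 r; rewrite reduced_rcons // -(signed_size sg). Qed.

Lemma signed_flip n (x : int) t : signed n (- x :: t) = signed n (x :: t).
Proof. by rewrite /signed /= abszN. Qed.

Lemma signed_swap2 n (u : seq int) a b v : signed n (u ++ b :: a :: v) = signed n (u ++ a :: b :: v).
Proof. by rewrite /signed (permPl (perm_map absz (perm_swap2 u b a v))). Qed.

(** At two adjacent descents the longest element of the dihedral subgroup of these generators splits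
    off on the right with additive lengths; its two reduced words are the braid pair. *)
Lemma consecutive_braid n s : signed n s -> consecutive_descents n s ->
  exists ws w1 w2, [/\ braid_pair w1 w2, reduced n s (ws ++ w1) & reduced n s (ws ++ w2)].
Proof.
move=> sg [[|j] [kn d1 d2]].
  case: s sg d1 d2 => [|x [|y v]] sg; try by move: kn; rewrite -(signed_size sg).
  rewrite /desc_at /= => x0 yx.
  have sgf := @signed_flip n; have sgs := @signed_swap2 n [::].
  have sg' : signed n (- x :: - y :: v) by rewrite sgf (sgs (- y) x) sgf (sgs x y).
  have [ws r] := reduced_exists sg'; exists ws, [:: 0; 1; 0; 1]%N, [:: 1; 0; 1; 0]%N.
  have e w a b c d : w ++ [:: a; b; c; d] = rcons (rcons (rcons (rcons w a) b) c) d :> seq nat.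
    by rewrite -!cats1 -!catA.
  have y0 := lt_trans yx x0.
  split; [by left | |]; rewrite e.
    apply: (@reduced_swap n [::] x y v 0) => //=; apply: reduced_flip; rewrite ?(sgs x y) //.
    apply: (@reduced_swap n [::] (- y) x v 0); rewrite //= ?sgf ?(sgs x y) //.
      by rewrite (lt_trans x0) ?oppr_gt0.
    by apply: reduced_flip; rewrite ?(sgs (- y) x) ?sgf ?(sgs x y).
  apply: reduced_flip => //; apply: (@reduced_swap n [::] (- x) y v 0); rewrite //= ?sgf //.
    by rewrite (lt_trans y0) ?oppr_gt0.
  apply: reduced_flip; rewrite // ?(sgs (- x) y) ?sgf //.
  apply: (@reduced_swap n [::] (- y) (- x) v 0); rewrite //= ?ltrN2 //.
  by rewrite sgf (sgs (- x) y) sgf.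
have ks : (j.+2 < size s)%N by rewrite (signed_size sg).
have [u [x [y [v [e su _ e1]]]]] := actS_ex (ltnW ks).
have : v != [::].
  by apply/eqP => v0; move: ks; rewrite e v0 size_cat /= su addn2 ltnn.
case: v e => // z v e _; rewrite e1 in d1.
have d2' : z < y by move: d2; rewrite e -cat_rcons -su -(size_rcons u x) desc_at_cat.
rewrite {}e in sg *; clear d2 e1 ks s.
have zx := lt_trans d2' d1.
have sx a : size (rcons u a) = j.+1 by rewrite size_rcons su.
have S1 : signed n (u ++ y :: x :: z :: v) by rewrite signed_swap2.
have S2 : signed n (u ++ y :: z :: x :: v) by move: S1; rewrite -!(cat_rcons y) -signed_swap2.
have S3 : signed n (u ++ z :: y :: x :: v) by rewrite signed_swap2.
have T1 : signed n (u ++ x :: z :: y :: v) by move: sg; rewrite -!(cat_rcons x) -signed_swap2.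
have T2 : signed n (u ++ z :: x :: y :: v) by rewrite signed_swap2.
have [ws r] := reduced_exists S3; exists ws, [:: j.+1; j.+2; j.+1], [:: j.+2; j.+1; j.+2].
have e w a b c : w ++ [:: a; b; c] = rcons (rcons (rcons w a) b) c :> seq nat.
  by rewrite -!cats1 -!catA.
split; [by right; exists j | |]; rewrite e.
  apply: reduced_swap => //; rewrite -(cat_rcons y); apply: reduced_swap; rewrite ?sx //.
    by rewrite cat_rcons.
  by rewrite cat_rcons; apply: reduced_swap.
rewrite -(cat_rcons x); apply: reduced_swap; rewrite ?sx ?cat_rcons //.
apply: reduced_swap => //; rewrite -(cat_rcons z); apply: reduced_swap; rewrite ?sx ?cat_rcons //.
Qed.

Lemma bad_braid n s : signed n s -> ~~ good s ->
  exists p w1 w2 t, [/\ braid_pair w1 w2, reduced n s (p ++ w1 ++ t) & reduced n s (p ++ w2 ++ t)].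
Proof.
have [m] := ubnP (cox_length s); elim: m s => // m IH s; rewrite ltnS => lm sg ngs.
case: (bad_step sg ngs) => [/(consecutive_braid sg)[p [w1 [w2 [b r1 r2]]]]|[k [kn d ng]]].
  by exists p, w1, w2, [::]; rewrite !cats0.
have ks : (k < size s)%N by rewrite (signed_size sg).
have [|p [w1 [w2 [t [b r1 r2]]]]] := IH _ _ (signed_act sg kn) ng.
  by rewrite -(length_desc ks d).
exists p, w1, w2, (rcons t k); split=> //; rewrite -!rcons_cat reduced_rcons //.
Qed.

Lemma far_desc n s j k : signed n s -> (j < n)%N -> (k < n)%N -> (j.+1 < k)%N ->
  [/\ desc_at (gen_act s j) k = desc_at s k, desc_at (gen_act s k) j = desc_at s j
    & gen_act (gen_act s j) k = gen_act (gen_act s k) j].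
Proof.
move=> sg jn kn jk; have sz := signed_size sg.
case: k kn jk => // k kn; rewrite ltnS => jk.
have ks : (k.+1 < size s)%N by rewrite sz.
have [u [a [b [v [e su ea ed]]]]] := actS_ex ks.
case: j jn jk => [|j] jn jk.
  case: u e su ea => [|f u] e su ea; first by rewrite -su in jk.
  rewrite ea; rewrite e -su; split.
  - by rewrite (@desc_at_cat (- f :: u)) (@desc_at_cat (f :: u)).
  - by [].
  exact: (@act_cat (- f :: u)).
have js : (j.+1 < size u)%N by rewrite su.
have [u1 [c [d [u2 [e' su' _ _]]]]] := actS_ex js.
rewrite ea e -su e' -!catA !cat_cons -su' !act_cat !desc_at_cat.
have sw : size (u1 ++ c :: d :: u2) = size (u1 ++ d :: c :: u2) by rewrite !size_cat.
have H x y (w : seq int) : u1 ++ x :: y :: u2 ++ w = (u1 ++ x :: y :: u2) ++ w by rewrite -catA.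
split=> //; first by rewrite !H desc_at_cat sw desc_at_cat.
by rewrite H sw act_cat -catA.
Qed.

Lemma good_far n s j k : signed n s -> good s -> (j < n)%N -> (k < n)%N ->
  desc_at s j -> desc_at s k -> (j < k)%N -> (j.+1 < k)%N.
Proof.
move=> sg gs jn kn dj dk; rewrite leq_eqVlt => /orP[/eqP ejk|//]; exfalso.
rewrite -ejk in dk kn => {k ejk}; have sz := signed_size sg.
have us := signed_uniq sg; case: j jn dj dk kn => [|j] jn dj dk kn.
  case: s sg gs dj dk sz us => [|x [|y v]] sg gs; try by move: kn; rewrite -(signed_size sg).
  rewrite /desc_at /= => x0 yx _ us; move/goodP: gs => /(_ x y x).
  rewrite !inE !eqxx !orbT (@before_mid [::] [::]) // => /(_ isT isT isT isT yx)[_].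
  by rewrite gt_eqF // => /(_ isT); move: x0; clear; lia.
have ks : (j.+2 < size s)%N by rewrite sz.
have [u [x [y [v [e su _ e1]]]]] := actS_ex (ltnW ks).
have : v != [::] by apply/eqP => v0; move: ks; rewrite e v0 size_cat /= su addn2 ltnn.
case: v e => // z v e _; rewrite e1 in dj.
have zy : z < y by move: dk; rewrite e -cat_rcons -su -(size_rcons u x) desc_at_cat.
have : ~~ good s; last by rewrite gs.
apply: (@bad_321 s x y z) => //; rewrite e ?mem_cat ?inE ?eqxx ?orbT //.
  by rewrite (@before_mid u [::]) // -e.
by rewrite -cat_rcons (@before_mid (rcons u x) [::]) // cat_rcons -e.
Qed.

(** * From words back to the group *)

Lemma nth_act (s : seq int) j i : (j.+1 < size s)%N ->
  nth 0 (gen_act s j.+1) i = nth 0 s (if i == j then j.+1 else if i == j.+1 then j else i).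
Proof.
move=> js; have [u [a [b [v [e <- -> _]]]]] := actS_ex js; rewrite e !nth_cat.
case: (ltngtP i (size u)) => [iu|iu|->].
- by rewrite (ltn_eqF (leqW iu)) iu.
- case: eqP => [->|ne]; first by rewrite ltnn subnn subSnn.
  rewrite ltnNge (ltnW iu) /=.
  have : (i - size u > 1)%N by lia.
  by case: (i - size u)%N => [|[|m]].
by rewrite ltnNge leqnSn /= subnn subSnn.
Qed.

Lemma wseq_mul_gen n (u : Bn n) (k : 'I_n) : wseq (Bmul u (Bgen k)) = gen_act (wseq u) k.
Proof.
apply: (@eq_from_nth _ 0); rewrite size_wseq.
  by case: (size_act (wseq u) k) => [->|]; rewrite size_wseq // leqNgt ltn_ord.
move=> i ilt; rewrite (nth_wseq _ (Ordinal ilt)) /Bgen.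
have svalE : Defs.sval u (Ordinal ilt) = nth 0 (wseq u) i by rewrite -(nth_wseq _ (Ordinal ilt)).
have [k0|k0] := eqVneq (val k) 0%N.
  rewrite /Defs.sval /= mul1g !ffunE perm1 k0.
  case: i ilt svalE => [|i] ilt /=; rewrite /Defs.sval.
    case e: (wseq u) => [|x t] /= <-; last by case: (u.2 _); rewrite ?opprK.
    by have := size_wseq u; rewrite e /= => n0; exfalso; move: (ilt); rewrite -n0.
  by move=> ->; case: (wseq u).
have [j kj] : exists j, val k = j.+1 by exists (val k).-1; rewrite prednK // lt0n.
have js : (j.+1 < size (wseq u))%N by rewrite size_wseq -kj ltn_ord.
have sE : Defs.sval (Bmul u (tperm (ord_prev k) k, [ffun=> false])) (Ordinal ilt) =
          Defs.sval u (tperm (ord_prev k) k (Ordinal ilt)).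
  by rewrite /Defs.sval /= permM !ffunE.
rewrite sE [nat_of_ord k]kj nth_act // -nth_wseq; congr (nth _ _ _).
have pE : val (ord_prev k) = j by rewrite /= kj.
case: tpermP => [e|e|/eqP e1 /eqP e2].
- by have := congr1 val e; rewrite pE /= => ->; rewrite eqxx.
- by have := congr1 val e; rewrite kj /= => ->; rewrite eqxx -pE (gtn_eqF (ltnSn _)) kj.
have n1 : (i == j) = false by apply: negbTE; move: e1; rewrite -(inj_eq val_inj) pE.
have n2 : (i == j.+1) = false by apply: negbTE; move: e2; rewrite -(inj_eq val_inj) kj.
by rewrite n1 n2.
Qed.

Lemma BmulA n (u v w : Bn n) : Bmul u (Bmul v w) = Bmul (Bmul u v) w.
Proof.
rewrite /Bmul /= mulgA; congr (_, _); apply/ffunP => i; rewrite !ffunE permM.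
by rewrite addbA.
Qed.

Lemma Bmul1 n (u : Bn n) : Bmul u (Bone n) = u.
Proof.
case: u => p e; rewrite /Bmul /= mul1g; congr (_, _); apply/ffunP => i.
by rewrite !ffunE perm1.
Qed.

Lemma Bmul1l n (u : Bn n) : Bmul (Bone n) u = u.
Proof.
case: u => p e; rewrite /Bmul /= mulg1; congr (_, _); apply/ffunP => i.
by rewrite !ffunE addbF.
Qed.

Lemma wseq_one n : wseq (Bone n) = ids n.
Proof.
rewrite /wseq /ids -[1%N]addn0 iotaDl -val_enum_ord -!map_comp; apply: eq_map => i.
by rewrite /Defs.sval /= ffunE perm1.
Qed.

Lemma wseq_eval n (ws : seq 'I_n) : wseq (Beval ws) = run n (map val ws).
Proof.
(* [Beval] associates to the right and [run] to the left; a variable left factor in place of the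
   identity reconciles them. *)
rewrite /run -wseq_one -{1}[Beval ws]Bmul1l.
elim: ws (Bone n) => [|k ws IH] u /=; first by rewrite Bmul1.
by rewrite BmulA IH wseq_mul_gen.
Qed.

Lemma valid_val n (ws : seq 'I_n) : all (fun k => k < n)%N (map val ws).
Proof. by apply/allP => k /mapP[i _ ->]; apply: ltn_ord. Qed.

Lemma lift_word n (ws : seq nat) : all (fun k => k < n)%N ws -> exists ws' : seq 'I_n, map val ws' = ws.
Proof.
elim: ws => [|k ws IH] /=; first by exists [::].
by case/andP=> kn /IH[ws' <-]; exists (Ordinal kn :: ws').
Qed.

Lemma reduced_wordP n (w : Bn n) ws : reduced_word w ws <-> reduced n (wseq w) (map val ws).
Proof.
have sg := signed_wseq w; rewrite /reduced valid_val size_map -wseq_eval; split.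
  case=> ew min; rewrite ew eqxx /=; have [us /and3P[v /eqP r /eqP l]] := reduced_exists sg.
  have [us' eu] := lift_word v; rewrite eqn_leq; apply/andP; split.
    rewrite -l -eu size_map; apply: min; apply: wseq_inj.
    by rewrite wseq_eval eu.
  by have := length_run (valid_val ws); rewrite -wseq_eval ew size_map.
case/and3P=> _ /eqP/wseq_inj ew /eqP l; split=> // ws' ew'.
by rewrite l -ew' wseq_eval (leq_trans (length_run (valid_val ws'))) ?size_map.
Qed.

Lemma comm_rcons n (u v : seq 'I_n) a :
  clos_refl_trans _ (@comm_move n) u v -> clos_refl_trans _ (@comm_move n) (rcons u a) (rcons v a).
Proof.
elim=> [x y [p [t [c [d [cd [-> ->]]]]]]|x|x y z _ IH1 _ IH2]; last exact: rt_trans IH1 IH2.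
  apply: rt_step; exists p, (rcons t a), c, d; split=> //.
  by rewrite !rcons_cat.
exact: rt_refl.
Qed.

(** Induction on the length. Reduced words ending in distinct letters a and b are joined through
    words ending in b a and a b: both letters are descents, hence far apart, and undoing both leaves
    a shorter element with a reduced word [t]. *)
Lemma good_connected n s (ws1 ws2 : seq 'I_n) : signed n s -> good s ->
  reduced n s (map val ws1) -> reduced n s (map val ws2) ->
  clos_refl_trans _ (@comm_move n) ws1 ws2.
Proof.
have [m] := ubnP (cox_length s); elim: m s ws1 ws2 => // m IH s ws1 ws2; rewrite ltnS => lm sg gs r1 r2.
have sz : size ws1 = size ws2.
  by case/and3P: r1 => _ _ /eqP; case/and3P: r2 => _ _ /eqP <-; rewrite !size_map.
case/lastP: ws1 r1 sz => [|u a] r1 sz; first by case: ws2 r2 sz => // *; apply: rt_refl.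
case/lastP: ws2 r2 sz => [|v b] r2 sz; first by rewrite size_rcons in sz.
rewrite !map_rcons in r1 r2.
have [an da] := reduced_desc sg r1; have [bn db] := reduced_desc sg r2.
have IHd (k : 'I_n) (x y : seq 'I_n) : desc_at s k -> reduced n s (rcons (map val x) k) ->
    reduced n s (rcons (map val y) k) -> clos_refl_trans _ (@comm_move n) (rcons x k) (rcons y k).
  move=> dk; rewrite !reduced_rcons // => rx ry; apply: comm_rcons.
  apply: IH rx ry; [|exact: signed_act|exact: (good_act sg gs (ltn_ord k) dk)].
  by rewrite -(length_desc _ dk) // (signed_size sg).
have [ab|ab] := eqVneq a b; first by rewrite -ab in r2 db *; apply: IHd.
have key (a' b' : 'I_n) (u' v' : seq 'I_n) : (a' < b')%N -> desc_at s a' -> desc_at s b' ->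
    reduced n s (rcons (map val u') a') -> reduced n s (rcons (map val v') b') ->
    exists t : seq 'I_n, [/\ reduced n s (rcons (map val (rcons t b')) a'),
                  reduced n s (rcons (map val (rcons t a')) b') & (a'.+1 < b')%N].
  move=> lt da' db' _ _; have far := good_far sg gs (ltn_ord a') (ltn_ord b') da' db' lt.
  have [e1 e2 e3] := far_desc sg (ltn_ord a') (ltn_ord b') far.
  have sga := signed_act sg (ltn_ord a'); have sgb := signed_act sg (ltn_ord b').
  have [t0 rt] := reduced_exists (signed_act sga (ltn_ord b')).
  have [vt _ _] := and3P rt; have [t et] := lift_word vt.
  exists t; rewrite !map_rcons et; split=> //.
    rewrite (reduced_rcons _ sg (ltn_ord a') da').
    by rewrite (reduced_rcons _ sga (ltn_ord b')) // e1.
  rewrite (reduced_rcons _ sg (ltn_ord b') db').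
  by rewrite (reduced_rcons _ sgb (ltn_ord a')) ?e2 // -e3.
have comm (a' b' : 'I_n) t : (a'.+1 < b')%N -> comm_move (rcons (rcons t b') a') (rcons (rcons t a') b').
  move=> lt; exists t, [::], b', a'; rewrite -!cats1 -!catA; split=> //.
  by move: lt; rewrite /gens_commute /=; move: (nat_of_ord a') (nat_of_ord b') => x y; clear; lia.
have [lt|lt|/val_inj e] := ltngtP a b; last by rewrite e eqxx in ab.
  have [t [ra rb far]] := key a b u v lt da db r1 r2.
  apply: rt_trans (IHd _ _ _ da r1 ra) _; apply: rt_trans (IHd _ _ _ db rb r2).
  exact/rt_step/comm.
have [t [rb ra far]] := key b a v u lt db da r2 r1.
apply: rt_trans (IHd _ _ _ da r1 ra) _; apply: rt_trans (IHd _ _ _ db rb r2).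
apply: rt_step; exists t, [::], b, a; rewrite -!cats1 -!catA; split=> //.
by move: far; rewrite /gens_commute /=; move: (nat_of_ord a) (nat_of_ord b) => x y; clear; lia.
Qed.

(* Letters k and k+1 do not commute, so their subword is a commutation invariant. *)
Lemma comm_filter n k (ws1 ws2 : seq 'I_n) (P := fun i => (i == k) || (i == k.+1)) :
  clos_refl_trans _ (@comm_move n) ws1 ws2 -> filter P (map val ws1) = filter P (map val ws2).
Proof.
elim=> [x y [p [t [c [d [cd [-> ->]]]]]]|//|x y z _ -> _ -> //].
rewrite !map_cat !filter_cat; congr (_ ++ (_ ++ _)) => /=.
move: cd; rewrite /gens_commute /P /=; move: (nat_of_ord c) (nat_of_ord d) => {}c {}d cd.
case: ifP => // h1; case: ifP => // h2; move: cd h1 h2; clear; lia.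
Qed.

Lemma FC_good n (w : Bn n) : FC w <-> good (wseq w).
Proof.
have sg := signed_wseq w; split=> [fc|gs ws1 ws2 /reduced_wordP r1 /reduced_wordP r2]; last first.
  exact: good_connected sg gs r1 r2.
apply: contraT => /(bad_braid sg)[p [w1 [w2 [t [b r1 r2]]]]].
have [v1 _ _] := and3P r1; have [v2 _ _] := and3P r2.
have [u1 e1] := lift_word v1; have [u2 e2] := lift_word v2; rewrite -e1 in r1; rewrite -e2 in r2.
have conn := fc u1 u2 ((reduced_wordP w u1).2 r1) ((reduced_wordP w u2).2 r2).
have [k nf] : exists k, filter (fun i => (i == k) || (i == k.+1)) w1 != filter (fun i => (i == k) || (i == k.+1)) w2.
  case: b => [[-> ->]|[j [-> ->]]]; first by exists 0%N.
  by exists j.+1; rewrite /= !eqxx !orbT /= eqseq_cons (ltn_eqF (ltnSn _)).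
(* The common prefix and suffix cancel in the projections and leave the two sides of the braid,
   whose projections differ. *)
have := comm_filter k conn; rewrite e1 e2 !filter_cat => E.
have := congr1 size E; rewrite !size_cat => /addnI/addIn sz; move/eqP: E.
by rewrite eqseq_cat // eqxx /= eqseq_cat // (negbTE nf).
Qed.

Lemma FCb_good n (w : Bn n) : FCb w = good (wseq w).
Proof.
rewrite /FCb; case: excluded_middle_informative => h; first by apply/esym/FC_good.
by apply/esym/negbTE/negP => /FC_good.
Qed.

Lemma inSn_has_neg n (w : Bn n) : ~~ inSn w = has_neg (wseq w).
Proof.
have E i : (Defs.sval w i < 0) = w.2 i by rewrite /Defs.sval; case: (w.2 i); lia.
rewrite /inSn negb_forall; apply/existsP/hasP => [[i]|[x /mapP[i _ ->]]].
  by rewrite negbK -E => h; exists (Defs.sval w i); rewrite ?map_f ?mem_enum.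
by rewrite E => h; exists i; rewrite negbK.
Qed.

Lemma topword_wseq n (w : Bn n) : FCb w && ~~ inSn w = topword n (wseq w).
Proof. by rewrite FCb_good inSn_has_neg /topword signed_wseq. Qed.

(** * The statistics, and the final summation *)

Lemma index_wseq n (w : Bn n) (j : 'I_n) : index (Defs.sval w j) (wseq w) = j.
Proof.
by rewrite -nth_wseq index_uniq ?size_wseq ?ltn_ord ?(signed_uniq (signed_wseq w)).
Qed.

Lemma sval_inv n (w : Bn n) (j : 'I_n) :
  Defs.sval (Binv w) (w.1 j) = if w.2 j then - j.+1%:Z else j.+1%:Z.
Proof. by rewrite /Defs.sval /= ffunE permK. Qed.

Lemma inv_lt_sval n (w : Bn n) (j l : 'I_n) : j != l ->
  inv_lt (wseq w) (Defs.sval w j) (Defs.sval w l) =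
  (Defs.sval (Binv w) (w.1 j) < Defs.sval (Binv w) (w.1 l)).
Proof.
rewrite -val_eqE /= !sval_inv /inv_lt /before !index_wseq /Defs.sval => jl.
case: (w.2 j); case: (w.2 l); rewrite ?oppr_gt0 ?oppr_lt0 /=.
- by move: jl; clear; lia.
- by clear; lia.
- by clear; lia.
by move: jl; clear; lia.
Qed.

Lemma cut_wseq n (w : Bn n) i : (i <= n)%N -> cut (wseq w) i =
  all (fun a => all (fun b => (a < b)%R) (drop i (wseq (Binv w)))) (take i (wseq (Binv w))).
Proof.
move=> i_n; apply/cutP/allP => [C a|H x y /mapP[j _ ->] /mapP[l _ ->]].
  case/(nthP 0) => p; rewrite size_takel ?size_wseq // => pi <-; rewrite nth_take //.
  apply/allP => b /(nthP 0)[q]; rewrite size_drop size_wseq nth_drop => qn <-.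
  have pn : (p < n)%N := leq_trans pi i_n.
  have iqn : (i + q < n)%N by rewrite -ltn_subRL.
  rewrite (nth_wseq _ (Ordinal pn)) (nth_wseq _ (Ordinal iqn)).
  rewrite -(permKV w.1 (Ordinal pn)) -(permKV w.1 (Ordinal iqn)) -inv_lt_sval.
    apply: C; rewrite ?map_f ?mem_enum // !absz_sval !permKV /=.
    by rewrite pi ltnS leq_addr.
  rewrite (inj_eq perm_inj) -val_eqE /= neq_ltn.
  by rewrite (leq_trans pi) // leq_addr.
rewrite !absz_sval !ltnS => /andP[ji il].
have jl : j != l by apply: contraTneq il => <-; rewrite -ltnNge.
rewrite inv_lt_sval //.
have mem (m : 'I_n) : Defs.sval (Binv w) m = nth 0 (wseq (Binv w)) m by rewrite nth_wseq.
have tj : Defs.sval (Binv w) (w.1 j) \in take i (wseq (Binv w)).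
  by rewrite mem -(nth_take 0 ji) mem_nth // size_takel ?size_wseq.
have dl : Defs.sval (Binv w) (w.1 l) \in drop i (wseq (Binv w)).
  by rewrite mem -{1}(subnKC il) -nth_drop mem_nth // size_drop size_wseq ltn_sub2r // (leq_ltn_trans il).
by have /allP := H _ tj; apply.
Qed.

Lemma bl_inv n (w : Bn n) : bl (Binv w) = inv_blocks (wseq w).
Proof.
rewrite /bl /inv_blocks size_wseq; congr (1 + _)%N; apply: eq_in_count => i.
rewrite mem_iota => /andP[_ ilt]; rewrite cut_wseq //.
by move: ilt; rewrite add1n ltnS => /leq_trans; apply; apply: leq_pred.
Qed.

Lemma DesB_des n (w : Bn n) : map (DesB w) (iota 0 n) = des (wseq w).
Proof.
apply: (@eq_from_nth _ false); first by rewrite size_map size_iota size_des size_wseq.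
move=> i; rewrite size_map size_iota => ilt; rewrite (nth_map 0%N) ?size_iota // nth_iota // add0n.
by rewrite /DesB /wv ilt /des (nth_pairmap 0) ?size_wseq.
Qed.

(** With no strict inequality Chow's function is h_n; this identifies the term k = 0. *)
Lemma chow_sum_zeros N n : (0 < N)%N -> chow_sum N (zeros n) N = hsum N 0 n N.
Proof.
move=> N0; rewrite /chow_sum /hsum size_nseq big_seq_cond [RHS]big_seq_cond; apply: eq_bigl => s.
rewrite mem_words; case: eqP => //= sn; case: (boolP (all _ s)) => //= /allP sN; rewrite andbT.
have -> : (last 0%N s < N)%N.
  by case: s {sn} sN => //= v s sN; apply: sN; apply: mem_last.
rewrite andbT -sn; elim: s 0%N {sn sN} => //= v s IH x.
by rewrite IH.
Qed.

Lemma sum_tops (V : nmodType) n (F : seq int -> V) :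
  \sum_(w : Bn n | topword n (wseq w)) F (wseq w) = \sum_(s <- tops n) F s.
Proof. by rewrite /tops big_map big_filter big_enum_cond. Qed.

(* Identity of (quasi-)symmetric functions with coefficients in Z[q],
   checked on every truncation to the variables x_0, ..., x_{N-1}. *)
Theorem theorem1p2 (n : nat) (hn : (0 < n)%N) (N : nat) :
  \sum_(w : Bn n | FCb w && ~~ inSn w)
     (('X^(bl (Binv w)) : {poly int}) *: FB {poly int} N n (DesB w))
  = \sum_(1 <= k < n.+1)
      ((\sum_(j < n.+1) ((bcoef n k j)%:R *: ('X^j : {poly int})))
         *: (hrow {poly int} N 1 k * hrow {poly int} N 0 (n - k))).
Proof.
(* The permutations are grouped by descent set. *)
have -> : \sum_(w : Bn n | FCb w && ~~ inSn w)
     (('X^(bl (Binv w)) : {poly int}) *: FB {poly int} N n (DesB w)) =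
   \sum_(D <- bits n) eall D *: chow_sum N D N.
  rewrite (eq_bigl (fun w : Bn n => topword n (wseq w))); last exact: topword_wseq.
  rewrite (eq_bigr (fun w => 'X^(inv_blocks (wseq w)) *: chow_sum N (des (wseq w)) N)); last first.
    by move=> w _; rewrite bl_inv FB_chow_sum // DesB_des.
  rewrite (sum_tops n (fun s => 'X^(inv_blocks s) *: chow_sum N (des s) N)).
  rewrite big_seq (eq_bigr (fun s => \sum_(D <- bits n | des s == D)
     'X^(inv_blocks s) *: chow_sum N D N)) => [|s]; last first.
    rewrite mem_tops => /and3P[/signed_size sn _ _].
    rewrite -big_filter (_ : filter _ _ = [:: des s]) ?big_seq1 //.
    rewrite -(@filter_pred1_uniq _ (bits n)) ?uniq_bits ?mem_bitsE ?size_des ?sn //.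
    by apply: eq_filter => D; rewrite eq_sym.
  rewrite -big_seq (exchange_big_dep predT) //= big_seq [RHS]big_seq; apply: eq_bigr => D.
  by rewrite mem_bitsE => /eqP Dn; rewrite /eall /wsum Dn scaler_suml.
(* Without variables both sides vanish, because n and every k in the sum are positive;
   [sum_total_product] asks for a positive bound. *)
have [N0|N0] := posnP N.
  subst N; rewrite big1 => [|D _]; last by rewrite chow_sum_0 scaler0.
  rewrite big_nat_cond big1 // => k /andP[/andP[k0 _] _].
  rewrite !hrow_hsum; case: k k0 => // k _; rewrite (hsum_rec 0 1).
  by rewrite [X in X * _]big_geq // mul0r scaler0.
(* Summed over [D], the corrections in [eall_formula] amount to q^n times the function of the empty
   descent set, the k = 0 term of the product sum. *)
have -> : \sum_(D <- bits n) eall D *: chow_sum N D N =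
   sum_total N (pascal n) n N - 'X^n *: chow_sum N (zeros n) N.
  have -> : 'X^n *: chow_sum N (zeros n) N =
     \sum_(D <- bits n) (if D == zeros n then 'X^n else 0) *: chow_sum N D N.
    rewrite (bigD1_seq (zeros n)) ?uniq_bits ?mem_bitsE ?size_nseq //= eqxx big1 ?addr0 // => D /negbTE->.
    by rewrite scale0r.
  rewrite /sum_total /bits_sum -sumrB; apply: eq_big_seq => D; rewrite mem_bitsE => /eqP Dn.
  by rewrite eallE /eall_formula Dn scalerBl.
rewrite sum_total_product ?N0 ?leqnn // chow_sum_zeros // /product_sum big_ord_recl.
rewrite hsum0 mul1r subn0 pascal_0 addrC addKr big_add1 /= big_mkord.
apply: eq_bigr => k _; rewrite sum_bcoef ?ltn_ord // !hrow_hsum.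
by [].
Qed.
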